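(* Fix real numbers $A,B\ge0$, not both zero. For $\epsilon>0$ let $E_\epsilon\subset\mathbb{C}^2$ be the real ellipsoid defined by $\rho_\epsilon=0$, where $$\rho_\epsilon=\epsilon A(z^2+\bar z^2)+2(2+\epsilon A)|z|^2+\epsilon B(w^2+\bar w^2)+2(2+\epsilon B)|w|^2-4 .$$ Then, for $\epsilon>0$ sufficiently small, the subset of umbilical points on $E_\epsilon$ either contains points of dimension at least $2$ or contains a curve of umbilical points.
   Context: Coordinates on $\mathbb{C}^2$ are $(z,w)$. Umbilical points: by Chern and Moser, for a Levi-nondegenerate hypersurface $M\subset\mathbb{C}^2$ and $p\in M$ there are (formal) holomorphic coordinates $(z,w)$ vanishing at $p$ in which $M$ is given by $\operatorname{Im}w=\phi(z,\bar z,\operatorname{Re}w)$, with $\phi(z,\bar z,u)=\sum_{k,l}\phi_{kl}(u)z^k\bar z^l$ real-valued, $\phi_{11}=1$ and $\phi_{0k}=\phi_{1s}=\phi_{22}=\phi_{23}=\phi_{33}=0$ for all $k\ge0$, $s\ge2$. The point $p$ is umbilical if $\phi_{24}(0)=0$; this does not depend on the choice of such coordinates. The set of umbilical points of a real-analytic $M$ is a real-analytic subvariety of $M$. The dimension of a real-analytic subvariety at one of its points $p$ is the largest dimension of a nonsingular component of the subvariety having $p$ in its closure; ''contains points of dimension at least 2'' refers to this notion. A curve means a one-dimensional real curve. *)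

(* Defs.v *)
From HB Require Import structures.
From mathcomp Require Import all_boot all_order all_algebra.
(* The notations of Multinomials clash with those of MathComp-Analysis. *)
From mathcomp Require Import -(notations) mpoly.
From mathcomp Require Import complex.
From mathcomp Require Import all_classical all_reals all_analysis.
Set Implicit Arguments.
Unset Strict Implicit.
Unset Printing Implicit Defensive.
Import Order.TTheory GRing.Theory Num.Theory.
Import numFieldNormedType.Exports.
Local Open Scope classical_set_scope.
Local Open Scope ring_scope.
Local Open Scope complex_scope.

Definition mvar (K : nzRingType) (n : nat) (i : 'I_n) : mpoly n K :=
  mpolyX K (mnm1 i).

(* A formal power series is its family of coefficients. Identities between
   series are stated below modulo total degree N, for every N, on polynomial
   truncations. *)
Definition fps (K : Type) (n : nat) := multinom n -> K.

Definition trunc (K : nzRingType) (n N : nat) (f : fps K n) : mpoly n K :=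
  \sum_(m : bmultinom n N) f m *: mpolyX K m.

Definition eq_mod_deg (K : nzRingType) (n N : nat) (p q : mpoly n K) : Prop :=
  forall m : multinom n, (mdeg m < N)%N -> mcoeff m p = mcoeff m q.

Section Umbilical.
Variable R : realType.
Local Notation C := R[i].

(* Real polynomials on C^2 are written as polynomials in the four independent
   variables z, w, zbar, wbar, in this order. *)
Definition Zv : mpoly 4 C := mvar C 0.
Definition Wv : mpoly 4 C := mvar C 1.
Definition Zb : mpoly 4 C := mvar C 2.
Definition Wb : mpoly 4 C := mvar C 3.

Definition point4 (p : C * C) : 'I_4 -> C :=
  tnth [tuple p.1; p.2; conjc p.1; conjc p.2].

Definition hypersurface (rho : mpoly 4 C) : set (C * C) :=
  [set p | meval (point4 p) rho = 0].

(* Taylor expansion of rho at p *)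
Definition recenter (rho : mpoly 4 C) (p : C * C) : mpoly 4 C :=
  comp_mpoly [tuple mvar C i + mpolyC 4 (point4 p i) | i < 4] rho.

(* A truncation of a series in (z, w), and of its conjugate in (zbar, wbar). *)
Definition hol_trunc (N : nat) (F : fps C 2) : mpoly 4 C :=
  comp_mpoly [tuple Zv; Wv] (trunc N F).
Definition antihol_trunc (N : nat) (F : fps C 2) : mpoly 4 C :=
  comp_mpoly [tuple Zb; Wb] (trunc N (fun m => conjc (F m))).

(* (F, G) is a formal holomorphic coordinate system vanishing at the centre. *)
Definition formal_coordinates (F G : fps C 2) : Prop :=
  [/\ F mnm0 = 0, G mnm0 = 0 &
      F (mnm1 0) * G (mnm1 1)
        - F (mnm1 1) * G (mnm1 0) != 0].

(* phi k l j is the coefficient of z^k zbar^l u^j, so that the series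
   phi_{kl}(u) is [phi k l], and phi_{kl}(0) is [phi k l 0]. *)
Definition phi_fps (phi : nat -> nat -> nat -> C) : fps C 3 :=
  fun m => phi (m 0) (m 1) (m 2).

(* In the coordinates (F, G) centred at p, {rho = 0} is given by
   Im w = phi (z, zbar, Re w): as formal power series in
   (z - p.1, w - p.2) and their conjugates,
   Im G - phi (F, Fbar, Re G) is a unit times rho. As F and G have no constant
   term, the terms dropped by truncation have degree at least N. For phi
   in normal form, the linear part of the left-hand side is that of Im G, so
   the identity forces rho = 0 and d rho <> 0 at p. *)
Definition given_by (rho : mpoly 4 C) (p : C * C) (F G : fps C 2)
    (phi : nat -> nat -> nat -> C) : Prop :=
  exists2 U : fps C 4, U mnm0 != 0 &
  forall N : nat,
    let f := hol_trunc N F in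
    let fb := antihol_trunc N F in
    let g := hol_trunc N G in
    let gb := antihol_trunc N G in
    let im_g := (2%:R * (0 +i* 1))^-1 *: (g - gb) in
    let re_g := 2%:R^-1 *: (g + gb) in
    eq_mod_deg N
      (im_g - comp_mpoly [tuple f; fb; re_g] (trunc N (phi_fps phi)))
      (trunc N U * recenter rho p).

Definition real_valued (phi : nat -> nat -> nat -> C) : Prop :=
  forall k l j, phi l k j = conjc (phi k l j).

Definition constant_series (c : C) : nat -> C :=
  fun j => if j == 0%N then c else 0.

Definition normal_form (phi : nat -> nat -> nat -> C) : Prop :=
  [/\ real_valued phi,
      phi 1%N 1%N = constant_series 1,
      forall k, phi 0%N k = constant_series 0,
      forall s, (2 <= s)%N -> phi 1%N s = constant_series 0 &
      [/\ phi 2%N 2%N = constant_series 0, phi 2%N 3%N = constant_series 0 &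
          phi 3%N 3%N = constant_series 0]].

Definition umbilical (rho : mpoly 4 C) (p : C * C) : Prop :=
  exists F G phi,
    [/\ formal_coordinates F G, normal_form phi, given_by rho p F G phi &
        phi 2%N 4%N 0%N = 0].

Definition umbilical_points (rho : mpoly 4 C) : set (C * C) :=
  [set p | hypersurface rho p /\ umbilical rho p].

Definition to_C2 (x : 'rV[R]_4) : C * C :=
  (x 0 0 +i* x 0 1, x 0 2 +i* x 0 3).

(* C^2 is identified with R^4 by (Re z, Im z, Re w, Im w). *)
Definition realification (S : set (C * C)) : set 'rV[R]_4 := to_C2 @^-1` S.

Definition ellipsoid (A B eps : R) : mpoly 4 C :=
    (eps * A)%:C *: (Zv ^+ 2 + Zb ^+ 2)
  + (2 * (2 + eps * A))%:C *: (Zv * Zb)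
  + (eps * B)%:C *: (Wv ^+ 2 + Wb ^+ 2)
  + (2 * (2 + eps * B))%:C *: (Wv * Wb)
  - mpolyC 4 4.

End Umbilical.

Section RealAnalytic.
Variables (R : realType) (n : nat).
Implicit Types (S V W D : set 'rV[R]_n) (x p q : 'rV[R]_n).

(* By the bound on the coefficients, the power series converges absolutely
   on the open cube of radius r about x. *)
Definition analytic_at (f : 'rV[R]_n -> R) x : Prop :=
  exists (c : fps R n) (r M : R),
    [/\ 0 < r,
        forall m, `|c m| * r ^+ mdeg m <= M &
        forall y : 'rV[R]_n, (forall i, `|y 0 i - x 0 i| < r) ->
          meval (fun i => y 0 i - x 0 i) (trunc N c) @[N --> \oo] --> f y].

Definition analytic_map_at (h : 'rV[R]_n -> 'rV[R]_n) x : Prop :=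
  forall i, analytic_at (fun y => h y 0 i) x.

(* Near p, a bianalytic map h : V -> W with inverse g straightens S to the
   part of R^d x 0 in W. *)
Definition submanifold_at S (d : nat) p : Prop :=
  [/\ (d <= n)%N, S p &
  exists V W (h g : 'rV[R]_n -> 'rV[R]_n),
    [/\ open V /\ open W, V p,
        forall x, V x -> [/\ W (h x), g (h x) = x & analytic_map_at h x],
        forall y, W y -> [/\ V (g y), h (g y) = y & analytic_map_at g y] &
        forall x, V x ->
          (S x <-> forall i : 'I_n, (d <= i)%N -> h x 0 i = 0)]].

Definition regular_locus S : set 'rV[R]_n :=
  [set p | exists d, submanifold_at S d p].

Definition nonsingular_component S (d : nat) D : Prop :=
  exists2 q, regular_locus S q &
    D = connected_component (regular_locus S) q
    /\ forall x, D x -> submanifold_at S d x.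

Definition dimension_at S p (d : nat) : Prop :=
  (exists2 D, nonsingular_component S d D & closure D p)
  /\ (forall e D, nonsingular_component S e D -> closure D p -> (e <= d)%N).

Definition contains_points_of_dim_ge S (k : nat) : Prop :=
  exists2 p, S p & exists2 d, dimension_at S p d & (k <= d)%N.

(* A curve is a nonempty connected one-dimensional real-analytic submanifold. *)
Definition curve D : Prop :=
  [/\ D !=set0, connected D & forall q, D q -> submanifold_at D 1 q].

Definition contains_curve S : Prop :=
  exists2 D, curve D & D `<=` S.

End RealAnalytic.

(* Main.v *)
Require Import Defs.
From HB Require Import structures.
From mathcomp Require Import all_boot all_order all_algebra.
From mathcomp Require Import -(notations) mpoly.
From mathcomp Require Import complex.
From mathcomp Require Import all_classical all_reals all_analysis.
From mathcomp Require Import ring lra zify.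
Set Implicit Arguments.
Unset Strict Implicit.
Unset Printing Implicit Defensive.
Import Order.TTheory GRing.Theory Num.Theory.
Import numFieldNormedType.Exports.
Local Open Scope classical_set_scope.
Local Open Scope ring_scope.
Local Open Scope complex_scope.

(** Put a = 1 + eps A, b = 1 + eps B, z = x + i y and w = u + i v. The ellipsoid is
    a x^2 + y^2 + b u^2 + v^2 = 1; its defining function is the sum of a Hermitian form
    and of 2 Re Q, where Q = eps (A z^2 + B w^2). For every eps > 0 there is an explicit
    ellipse of umbilical points: it consists of points whose complex tangent line is
    isotropic for Q.

    Why such a point p is umbilical. Choose linear coordinates (zeta, eta) centred at p,
    orthonormal for a multiple of the Hermitian form and such that eta = 0 is the complex
    tangent line. As Q vanishes on that line, it is divisible by eta, and the ellipsoid
    becomes Im omega = |zeta|^2 + |eta|^2, where omega = eta (1 + h) and h is linear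
    ([umbilical_of_isotropic]). Give zeta weight 1 and eta weight 2. The map
    (zeta, omega) -> (zeta, omega) / (1 + i omega) turns Im omega - |omega|^2 - |zeta|^2
    into a multiple of Im w' - |z'|^2, and the difference |omega|^2 - |eta|^2 is
    |eta|^2 (2 Re h + |h|^2). All terms of weight at most 6 in it can be absorbed by
    a further change of coordinates: the terms with h because |eta|^2 h is congruent to
    eta^2 h - 2 i |zeta|^2 eta h, up to holomorphic terms and multiples of
    |eta|^2 |h|^2, and the term |eta|^2 |h|^2, which is a constant multiple of
    |zeta|^2 |eta|^2 up to weight 6, because, on Im w = |z|^2,
    |z|^2 |w|^2 = Im w^3 - 2 |z|^2 Re w^2 ([osc_identity]). Hence the ellipsoid agrees
    with Im w = |z|^2 up to weight 6 included.

    Why this contact is enough. The order of contact with a normal form can be raised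
    by one, indefinitely: the linearised equation is solvable by the Chern-Moser lemma
    ([chern_moser_surjective], [normalisation_step]). The corrections of phi have
    weight at least 7, so that phi_24(0), which belongs to weight 6, remains 0. The
    coordinate changes converge formally ([umbilical_of_approx]).

    The ellipse. If A > 0 and kap^2 A = B, the plane u = (kap / b) y, v = - kap a x
    consists of points at which isotropy holds, and it meets the ellipsoid in an ellipse;
    if A = 0, the ellipse is the intersection with the w-axis. A rational parametrisation
    straightens the complement of a point in such an ellipse ([ellipse_arc_curve]). *)

(** * Weighted order filtrations of polynomial rings *)

Section Filtration.
Variable K : comNzRingType.

Definition wt n (v : 'I_n -> nat) (m : multinom n) : nat :=
  (\sum_(i < n) v i * m i)%N.

(** The ideals of the weighted order filtration, as predicates: identities between
    formal power series modulo an order become memberships of polynomials. *)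
Definition Filt n (v : 'I_n -> nat) (k : nat) (p : mpoly n K) : Prop :=
  forall m, (wt v m < k)%N -> mcoeff m p = 0.

Lemma wtD n (v : 'I_n -> nat) m1 m2 :
  wt v (mnm_add m1 m2) = (wt v m1 + wt v m2)%N.
Proof.
rewrite /wt -big_split /=; apply: eq_bigr => i _.
by rewrite mnmDE mulnDr.
Qed.

Lemma wt1 n (v : 'I_n -> nat) i : wt v (mnm1 i) = v i.
Proof.
rewrite /wt (bigD1 i) //= mnm1E eqxx muln1 big1 ?addn0 // => j ji.
by rewrite mnm1E eq_sym (negPf ji) muln0.
Qed.

Lemma wt_mdeg n (m : multinom n) : wt (fun=> 1%N) m = mdeg m.
Proof. by rewrite /wt mdegE; apply: eq_bigr => i _; rewrite mul1n. Qed.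

Section Basic.
Variables (n : nat) (v : 'I_n -> nat).
Implicit Types p q : mpoly n K.

Lemma Filt0 k : Filt v k (0 : mpoly n K).
Proof. by move=> m _; rewrite mcoeff0. Qed.

Lemma Filt_all p : Filt v 0 p.
Proof. by move=> m. Qed.

Lemma FiltW j k p : (j <= k)%N -> Filt v k p -> Filt v j p.
Proof. by move=> jk h m mj; apply: h; apply: leq_trans jk. Qed.

Lemma FiltD k p q : Filt v k p -> Filt v k q -> Filt v k (p + q).
Proof. by move=> hp hq m mk; rewrite mcoeffD hp // hq // addr0. Qed.

Lemma FiltN k p : Filt v k p -> Filt v k (- p).
Proof. by move=> hp m mk; rewrite mcoeffN hp // oppr0. Qed.

Lemma FiltB k p q : Filt v k p -> Filt v k q -> Filt v k (p - q).
Proof. by move=> hp hq; apply: FiltD => //; apply: FiltN. Qed.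

Lemma FiltZ k c p : Filt v k p -> Filt v k (c *: p).
Proof. by move=> hp m mk; rewrite mcoeffZ hp // mulr0. Qed.

Lemma Filt_sum (I : Type) (r : seq I) (P : pred I) (F : I -> mpoly n K) k :
  (forall i, P i -> Filt v k (F i)) -> Filt v k (\sum_(i <- r | P i) F i).
Proof.
move=> h; elim/big_ind: _ => //; first exact: Filt0.
by move=> x y; apply: FiltD.
Qed.

Lemma FiltM a b p q : Filt v a p -> Filt v b q -> Filt v (a + b) (p * q).
Proof.
move=> hp hq m mk; rewrite mcoeffM big1 // => -[k1 k2] /= /eqP mE.
have {}mk : (wt v k1 + wt v k2 < a + b)%N by rewrite -wtD -mE.
case: (ltnP (wt v k1) a) => [/hp -> |h1]; first by rewrite mul0r.
by rewrite hq ?mulr0 //; rewrite -(ltn_add2l a); apply: leq_ltn_trans mk; rewrite leq_add2r.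
Qed.

Lemma FiltMl b p q : Filt v b q -> Filt v b (p * q).
Proof. by move=> hq; apply: (@FiltM 0 b) => //; apply: Filt_all. Qed.

Lemma FiltMr a p q : Filt v a p -> Filt v a (p * q).
Proof. by move=> hq; rewrite mulrC; apply: FiltMl. Qed.

Lemma FiltX a j p : Filt v a p -> Filt v (j * a) (p ^+ j).
Proof.
move=> h; elim: j => [|j IH]; first by rewrite mul0n; apply: Filt_all.
by rewrite exprS mulSn; apply: FiltM.
Qed.

Lemma FiltXm m k : (k <= wt v m)%N -> Filt v k (mpolyX K m).
Proof.
move=> km m' m'k; rewrite mcoeffX; case: eqP => // E.
by move: m'k; rewrite -E ltnNge km.
Qed.

Lemma Filt_var i k : (k <= v i)%N -> Filt v k (mvar K i).
Proof. by move=> h; apply: FiltXm; rewrite wt1. Qed.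

Lemma Filt_prod (I : finType) (a : I -> nat) (F : I -> mpoly n K) :
  (forall i, Filt v (a i) (F i)) -> Filt v (\sum_i a i) (\prod_i F i).
Proof.
move=> h; elim/big_ind2: _; [by move=> m | | by []].
by move=> x1 a1 x2 a2 h1 h2; apply: FiltM.
Qed.

Lemma Filt_supp k p m : Filt v k p -> m \in msupp p -> (k <= wt v m)%N.
Proof.
move=> h; rewrite mcoeff_msupp leqNgt; apply: contraNN => /h ->.
by rewrite eqxx.
Qed.

End Basic.

Lemma Filt_comp n1 n2 (v1 : 'I_n1 -> nat) (v2 : 'I_n2 -> nat)
    (q : n1.-tuple (mpoly n2 K)) k (p : mpoly n1 K) :
  (forall i, Filt v2 (v1 i) (tnth q i)) -> Filt v1 k p ->
  Filt v2 k (comp_mpoly q p).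
Proof.
move=> hq hp; rewrite comp_mpolyEX big_seq; apply: Filt_sum => m ms.
apply: FiltZ; rewrite comp_mpolyX.
apply: FiltW (Filt_supp hp ms) _; rewrite /wt; apply: Filt_prod => i.
by rewrite mulnC; apply: FiltX.
Qed.

(** Taylor's formula to order zero: perturbing the substituted polynomials by
    [s] orders more than their own weight perturbs the composite by [s]
    orders more than its own weight. *)
Lemma Filt_compB n1 n2 (v1 : 'I_n1 -> nat) (v2 : 'I_n2 -> nat) (s : nat)
    (q q' : n1.-tuple (mpoly n2 K)) k (p : mpoly n1 K) :
  (forall i, Filt v2 (v1 i) (tnth q i)) ->
  (forall i, Filt v2 (v1 i + s) (tnth q i - tnth q' i)) ->
  Filt v1 k p -> Filt v2 (k + s) (comp_mpoly q p - comp_mpoly q' p).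
Proof.
move=> hq hqq hp; rewrite !comp_mpolyEX big_seq [X in _ - X]big_seq -sumrB.
apply: Filt_sum => m ms; rewrite -scalerBr; apply: FiltZ.
rewrite !comp_mpolyX; apply: (@FiltW _ _ _ (wt v1 m + s)).
  by rewrite leq_add2r; apply: Filt_supp hp ms.
have hmul (a b : nat) (x x' y y' : mpoly n2 K) :
    Filt v2 a x /\ Filt v2 (a + s) (x - x') ->
    Filt v2 b y /\ Filt v2 (b + s) (y - y') ->
    Filt v2 (a + b) (x * y) /\ Filt v2 (a + b + s) (x * y - x' * y').
  move=> [hx hxx] [hy hyy]; split; first exact: FiltM.
  have -> : x * y - x' * y' = x * (y - y') + (x - x') * y - (x - x') * (y - y').
    by ring.
  apply: FiltB.
    apply: FiltD; first by rewrite -addnA; apply: FiltM.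
    by rewrite addnAC; apply: FiltM.
  apply: (@FiltW _ _ _ (a + s + (b + s))); first by lia.
  exact: FiltM.
suff [] : Filt v2 (wt v1 m) (\prod_(i < n1) tnth q i ^+ m i) /\
  Filt v2 (wt v1 m + s) (\prod_(i < n1) tnth q i ^+ m i
     - \prod_(i < n1) tnth q' i ^+ m i) by [].
rewrite /wt; elim/big_ind3: _ => //.
- by split; [apply: Filt_all | rewrite subrr; apply: Filt0].
- by move=> a x x' b y y'; apply: hmul.
move=> i _; elim: (m i) => [|j IH].
  by rewrite !expr0 muln0; split; [apply: Filt_all | rewrite subrr; apply: Filt0].
by rewrite !exprS mulnS; apply: hmul.
Qed.

(** Comparing weights with degrees: an order for the weights (1, 2) bounds the total
    degree, which is what linear changes of coordinates respect. *)
Lemma Filt_change_weight n (v v' : 'I_n -> nat) b k k' (p : mpoly n K) :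
  (forall i, (v i <= b * v' i)%N) -> (b * k'.-1 < k)%N -> Filt v k p -> Filt v' k' p.
Proof.
move=> hv hk hp m mk; apply: hp; apply: leq_ltn_trans hk.
apply: (@leq_trans (b * wt v' m)); last by rewrite leq_mul2l -ltnS (ltn_predK mk) mk orbT.
rewrite /wt big_distrr /=; apply: leq_sum => i _.
by rewrite mulnA leq_mul2r hv orbT.
Qed.

End Filtration.

(** * Conjugation of polynomials in z, w and their conjugates *)

(** Conjugation, substitution and linear changes of coordinates are ring morphisms, so
    that each commutation rule between them is a check on constants and variables. *)
Lemma mpoly_rmorph_ext (K S : comNzRingType) n (f g : {rmorphism mpoly n K -> S}) :
  (forall c, f (mpolyC n c) = g (mpolyC n c)) ->
  (forall i, f (mvar K i) = g (mvar K i)) -> forall p, f p = g p.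
Proof.
move=> hC hX p; rewrite (mpolyE p) !rmorph_sum; apply: eq_bigr => m _.
rewrite -mul_mpolyC !rmorphM hC mpolyXE_id !rmorph_prod; congr (_ * _).
by apply: eq_bigr => i _; rewrite !rmorphXn hX.
Qed.

Lemma comp_mvar (K : comNzRingType) n1 n2 (q : n1.-tuple (mpoly n2 K)) i :
  comp_mpoly q (mvar K i) = tnth q i.
Proof. by rewrite comp_mpolyXU -tnth_nth. Qed.

Section Conjugation.
Variable R : realType.
Local Notation C := R[i].
Local Notation A := (mpoly 4 C).
Local Notation Z := (Zv R).
Local Notation W := (Wv R).
Local Notation Zc := (Zb R).
Local Notation Wc := (Wb R).

Definition iC : C := 0 +i* 1.
Lemma iC2 : iC * iC = -1.
Proof. by apply/eqP; rewrite eq_complex /= !(mul0r, mulr0, mulr1, sub0r, addr0) oppr0 !eqxx. Qed.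
Lemma conj_iC : conjc iC = - iC.
Proof. by rewrite /iC /= ; apply/eqP; rewrite eq_complex /= oppr0 !eqxx. Qed.
Lemma iC_neq0 : iC != 0.
Proof. by apply/eqP => /(congr1 (fun x => x * iC)); rewrite iC2 mul0r => /eqP; rewrite oppr_eq0 oner_eq0. Qed.

Definition cconj n (p : mpoly n C) : mpoly n C := map_mpoly (@conjc R) p.
HB.instance Definition _ n := GRing.RMorphism.copy (@cconj n) (map_mpoly (@conjc R)).

(** Complex conjugation of polynomial functions of (z, w): besides conjugating the
    coefficients it exchanges the variables with their conjugates. *)
Definition bar (p : A) : A := cconj (comp_mpoly [tuple Zc; Wc; Z; W] p).
HB.instance Definition _ := GRing.RMorphism.copy bar
  (@cconj 4 \o comp_mpoly [tuple Zc; Wc; Z; W]).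

Lemma cconjC n c : cconj (mpolyC n c) = mpolyC n (conjc c).
Proof. exact: map_mpolyC. Qed.
Lemma cconjX n m : cconj (mpolyX C m) = mpolyX C m :> mpoly n C.
Proof. exact: map_mpolyX. Qed.
Lemma cconj_coeff n (p : mpoly n C) m : mcoeff m (cconj p) = conjc (mcoeff m p).
Proof. exact: mcoeff_map_mpoly. Qed.
Lemma barC c : bar (mpolyC 4 c) = mpolyC 4 (conjc c).
Proof. by rewrite /bar comp_mpolyC cconjC. Qed.
Lemma barD p q : bar (p + q) = bar p + bar q. Proof. exact: rmorphD. Qed.
Lemma barN p : bar (- p) = - bar p. Proof. exact: rmorphN. Qed.
Lemma barB p q : bar (p - q) = bar p - bar q. Proof. exact: rmorphB. Qed.
Lemma barM p q : bar (p * q) = bar p * bar q. Proof. exact: rmorphM. Qed.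
Lemma barX p n : bar (p ^+ n) = bar p ^+ n. Proof. exact: rmorphXn. Qed.
Lemma bar_Z : bar Z = Zc. Proof. by rewrite /bar comp_mvar [tnth _ _]/= cconjX. Qed.
Lemma bar_W : bar W = Wc. Proof. by rewrite /bar comp_mvar [tnth _ _]/= cconjX. Qed.
Lemma bar_Zc : bar Zc = Z. Proof. by rewrite /bar comp_mvar [tnth _ _]/= cconjX. Qed.
Lemma bar_Wc : bar Wc = W. Proof. by rewrite /bar comp_mvar [tnth _ _]/= cconjX. Qed.
Definition barE := (bar_Z, bar_W, bar_Zc, bar_Wc).

Lemma ord4P (P : 'I_4 -> Prop) : P 0 -> P 1 -> P 2 -> P 3 -> forall i, P i.
Proof.
move=> h0 h1 h2 h3 [[|[|[|[|//]]]] hi].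
- by rewrite (_ : Ordinal hi = 0) //; apply/val_inj.
- by rewrite (_ : Ordinal hi = 1) //; apply/val_inj.
- by rewrite (_ : Ordinal hi = 2) //; apply/val_inj.
- by rewrite (_ : Ordinal hi = 3) //; apply/val_inj.
Qed.
Lemma ord3P (P : 'I_3 -> Prop) : P 0 -> P 1 -> P 2 -> forall i, P i.
Proof.
move=> h0 h1 h2 [[|[|[|//]]] hi].
- by rewrite (_ : Ordinal hi = 0) //; apply/val_inj.
- by rewrite (_ : Ordinal hi = 1) //; apply/val_inj.
- by rewrite (_ : Ordinal hi = 2) //; apply/val_inj.
Qed.
Lemma ord2P (P : 'I_2 -> Prop) : P 0 -> P 1 -> forall i, P i.
Proof.
move=> h0 h1 [[|[|//]] hi].
- by rewrite (_ : Ordinal hi = 0) //; apply/val_inj.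
- by rewrite (_ : Ordinal hi = 1) //; apply/val_inj.
Qed.

Lemma barK : involutive bar.
Proof.
move=> p; rewrite -[RHS]/(idfun p).
apply: (@mpoly_rmorph_ext _ _ _ (bar \o bar) idfun) => [c|].
  by rewrite -[LHS]/(bar (bar (mpolyC 4 c))) !barC conjcK.
by apply: ord4P; rewrite /= -?/Z -?/W -?/Zc -?/Wc !barE.
Qed.

(** The weights 1 of z and 2 of w, u make the quadric Im w = |z|^2 homogeneous. *)
Definition w4 (i : 'I_4) : nat := tnth [tuple 1%N; 2%N; 1%N; 2%N] i.
Definition w3 (i : 'I_3) : nat := tnth [tuple 1%N; 1%N; 2%N] i.
Definition w2 (i : 'I_2) : nat := tnth [tuple 1%N; 2%N] i.

Lemma Filt_cconj n (v : 'I_n -> nat) k p : Filt v k p -> Filt v k (cconj p).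
Proof. by move=> h m mk; rewrite cconj_coeff h // rmorph0. Qed.

Lemma Filt_bar k p : Filt w4 k p -> Filt w4 k (bar p).
Proof.
move=> h; apply: Filt_cconj; apply: Filt_comp h.
by apply: ord4P; rewrite /= /w4 /=; apply: Filt_var.
Qed.

Definition hol (p : mpoly 2 C) : A := comp_mpoly [tuple Z; W] p.
HB.instance Definition _ := GRing.RMorphism.copy hol (comp_mpoly [tuple Z; W]).
Lemma holC c : hol (mpolyC 2 c) = mpolyC 4 c.
Proof. exact: comp_mpolyC. Qed.
Lemma hol0 : hol (mvar C 0) = Z. Proof. by rewrite /hol comp_mvar. Qed.
Lemma hol1 : hol (mvar C 1) = W. Proof. by rewrite /hol comp_mvar. Qed.

Lemma bar_hol p : bar (hol p) = comp_mpoly [tuple Zc; Wc] (cconj p).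
Proof.
apply: (@mpoly_rmorph_ext _ _ _ (bar \o hol) (comp_mpoly [tuple Zc; Wc] \o @cconj 2)) => [c|].
  by rewrite -[LHS]/(bar (hol (mpolyC 2 c))) -[RHS]/(comp_mpoly _ (cconj _)) holC barC cconjC comp_mpolyC.
by apply: ord2P; rewrite -[LHS]/(bar (hol _)) -[RHS]/(comp_mpoly _ (cconj _)) cconjX comp_mvar /= ?hol0 ?hol1 barE.
Qed.

Lemma Filt_hol k p : Filt w2 k p -> Filt w4 k (hol p).
Proof.
by apply: Filt_comp; apply: ord2P; rewrite /= /w2 /=; apply: Filt_var.
Qed.

Definition im (p : A) : A := mpolyC 4 (2 * iC)^-1 * (p - bar p).
Definition re (p : A) : A := mpolyC 4 2^-1 * (p + bar p).

Lemma imD p q : im (p + q) = im p + im q.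
Proof. by rewrite /im -mulrDr barD opprD addrACA. Qed.
Lemma bar_re p : bar (re p) = re p.
Proof. by rewrite /re barM barD barK barC fmorphV rmorph_nat addrC. Qed.
Lemma inv2i : (2 * iC)^-1 = - (iC / 2) :> C.
Proof.
rewrite invfM mulrC -mulNr; congr (_ / _); apply: (mulfI iC_neq0).
by rewrite divff ?iC_neq0 // mulrN iC2 opprK.
Qed.
Lemma bar_im p : bar (im p) = im p.
Proof.
have e : conjc (- (iC / 2)) = iC / 2.
  rewrite rmorphN rmorphM fmorphV rmorph_nat.
  by rewrite (_ : _ iC = - iC) ?mulNr ?opprK //; apply: conj_iC.
rewrite /im barM barB barK inv2i barC e.
by rewrite mpolyCN -opprB mulrN mulNr.
Qed.
Lemma Filt_im k p : Filt w4 k p -> Filt w4 k (im p).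
Proof. by move=> h; apply/FiltMl/FiltB => //; apply: Filt_bar. Qed.
Lemma Filt_re k p : Filt w4 k p -> Filt w4 k (re p).
Proof. by move=> h; apply/FiltMl/FiltD => //; apply: Filt_bar. Qed.
Lemma Filt_Z : Filt w4 1 Z. Proof. exact: Filt_var. Qed.
Lemma Filt_W : Filt w4 2 W. Proof. exact: Filt_var. Qed.
Lemma Filt_Zc : Filt w4 1 Zc. Proof. exact: Filt_var. Qed.
Lemma Filt_Wc : Filt w4 2 Wc. Proof. exact: Filt_var. Qed.

End Conjugation.

(** * The Chern-Moser operator *)

Section ChernMoserOperator.
Variable R : realType.
Local Notation C := R[i].
Local Notation A := (mpoly 4 C).
Local Notation Z := (Zv R).
Local Notation W := (Wv R).
Local Notation Zc := (Zb R).
Local Notation Wc := (Wb R).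
Local Notation cst := (mpolyC 4).
Local Notation x3 := (@mvar C 3).

(** Conjugation of series in (z, zbar, u), with u real. *)
Definition bar3 (p : mpoly 3 C) : mpoly 3 C := cconj (comp_mpoly [tuple x3 1; x3 0; x3 2] p).
HB.instance Definition _ := GRing.RMorphism.copy bar3
  (@cconj R 3 \o comp_mpoly [tuple x3 1; x3 0; x3 2]).
Lemma bar3D p q : bar3 (p + q) = bar3 p + bar3 q. Proof. exact: rmorphD. Qed.
Lemma bar3M p q : bar3 (p * q) = bar3 p * bar3 q. Proof. exact: rmorphM. Qed.
Lemma bar3C c : bar3 (mpolyC 3 c) = mpolyC 3 (conjc c).
Proof. by rewrite /bar3 comp_mpolyC cconjC. Qed.
Lemma bar3_var : [/\ bar3 (x3 0) = x3 1, bar3 (x3 1) = x3 0 & bar3 (x3 2) = x3 2].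
Proof. by split; rewrite /bar3 comp_mvar [tnth _ _]/= cconjX. Qed.

Definition mn3 (i k j : nat) : multinom 3 := Multinom [tuple i; k; j].
Lemma mn3E (m : multinom 3) : m = mn3 (m 0) (m 1) (m 2).
Proof. by apply/mnmP; apply: ord3P. Qed.
Lemma wt_mn3 i k j : wt (@w3) (mn3 i k j) = (i + k + 2 * j)%N.
Proof. by rewrite /wt !big_ord_recl big_ord0 /w3 /= !mul1n addn0 addnA. Qed.
Lemma mpolyX3 i k j : mpolyX C (mn3 i k j) = x3 0 ^+ i * x3 1 ^+ k * x3 2 ^+ j.
Proof.
by rewrite mpolyXE_id !big_ord_recl big_ord0 mulr1 mulrA; do !congr (_ * _);
  congr (mpolyX _ (mnm1 _) ^+ _); apply/val_inj.
Qed.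
Lemma bar3_X i k j : bar3 (mpolyX C (mn3 i k j)) = mpolyX C (mn3 k i j).
Proof.
case: bar3_var => e0 e1 e2.
by rewrite !mpolyX3 !bar3M !rmorphXn /= e0 e1 e2 [x3 1 ^+ _ * _]mulrC.
Qed.

Definition phi_std (p : mpoly 3 C) : A := comp_mpoly [tuple Z; Zc; re W] p.
HB.instance Definition _ := GRing.RMorphism.copy phi_std (comp_mpoly [tuple Z; Zc; re W]).
Lemma phi_stdD p q : phi_std (p + q) = phi_std p + phi_std q. Proof. exact: rmorphD. Qed.
Lemma phi_stdM p q : phi_std (p * q) = phi_std p * phi_std q. Proof. exact: rmorphM. Qed.
Lemma phi_stdC c : phi_std (mpolyC 3 c) = cst c. Proof. exact: comp_mpolyC. Qed.
Lemma phi_std_X i k j : phi_std (mpolyX C (mn3 i k j)) = Z ^+ i * Zc ^+ k * re W ^+ j.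
Proof.
by rewrite mpolyX3 !phi_stdM !rmorphXn /= /phi_std !comp_mvar.
Qed.
(** The indices (k, l) other than (1, 1) that are allowed in a normal form: both are at
    least 2, and of these (2, 2), (2, 3), (3, 2) and (3, 3) are excluded. *)
Definition normal_idx (i k : nat) : bool := [&& 2 <= i, 2 <= k & (4 <= i) || (4 <= k)]%N.
(** Reality appears twice, as an invariance, which passes to composites, and as the
    symmetry of the coefficients. *)
Definition cm_normal (p : mpoly 3 C) : Prop :=
  [/\ bar3 p = p,
      forall i k j, mcoeff (mn3 k i j) p = conjc (mcoeff (mn3 i k j) p) &
      forall i k j, ~~ normal_idx i k -> mcoeff (mn3 i k j) p = 0].

Lemma cm_normal0 : cm_normal 0.
Proof. by split=> [|i k j|i k j _]; rewrite ?rmorph0 ?mcoeff0 ?rmorph0. Qed.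
Lemma cm_normalD p q : cm_normal p -> cm_normal q -> cm_normal (p + q).
Proof.
move=> [p1 p2 p3] [q1 q2 q3]; split=> [|i k j|i k j h].
- by rewrite bar3D p1 q1.
- by rewrite !mcoeffD p2 q2 rmorphD.
- by rewrite mcoeffD p3 // q3 // addr0.
Qed.
Lemma mn3_eq i k j i' k' j' : (mn3 i k j == mn3 i' k' j') = [&& i == i', k == k' & j == j'].
Proof.
apply/eqP/and3P => [/mnmP E|[/eqP -> /eqP -> /eqP ->]] //.
by split; apply/eqP; [apply: (E 0) | apply: (E 1) | apply: (E 2)].
Qed.
Lemma cm_normal_mono c i k j : normal_idx i k ->
  cm_normal (mpolyC 3 c * mpolyX C (mn3 i k j) + mpolyC 3 (conjc c) * mpolyX C (mn3 k i j)).
Proof.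
move=> h; split=> [|a b l|a b l].
- by rewrite bar3D !bar3M !bar3C !bar3_X conjcK addrC.
- rewrite !mcoeffD !mcoeffCM !mcoeffX !mn3_eq rmorphD !rmorphM !rmorph_nat /= conjcK addrC.
  by congr (_ * _%:R + _ * _%:R); rewrite andbCA.
- rewrite mcoeffD !mcoeffCM !mcoeffX !mn3_eq => hn.
  have nh : ~~ normal_idx b a by rewrite /normal_idx andbCA orbC.
  rewrite (_ : [&& i == a, k == b & j == l] = false); last first.
    by apply/negP => /and3P[/eqP Ei /eqP Ek _]; rewrite -Ei -Ek h in hn.
  rewrite (_ : [&& k == a, i == b & j == l] = false) ?mulr0 ?addr0 //.
  by apply/negP => /and3P[/eqP Ek /eqP Ei _]; rewrite -Ei -Ek h in nh.
Qed.

(* defining function of the quadric *)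
(** The defining function of the model Im w = |z|^2. *)
Definition quadric : A := im W - Z * Zc.
Lemma bar_quadric : bar quadric = quadric.
Proof. by rewrite /quadric barB barM bar_im !barE [Zc * _]mulrC. Qed.

(** The image of the Chern-Moser operator, the linearisation at the model of
    (F, G, phi, U) |-> Im G - phi (F, conj F, Re G) - U r. The multiples of the defining
    function stand for the restriction to the quadric. The weights are those under which
    all four contributions have weight at least n + 2. *)
Definition cm_image n (K : A) := exists f g p U,
  [/\ Filt w2 n.+1 f, Filt w2 n.+2 g, cm_normal p /\ Filt w3 n.+2 p, Filt w4 n U /\ bar U = U &
   K = im (hol g) - (Zc * hol f + Z * bar (hol f)) - phi_std p - U * quadric].

Section Span.
Variable n : nat.

Lemma cm_imageD_ring (T : comNzRingType) (a1 a2 a3 a4 b1 b2 c1 c2 u1 u2 z zc q : T) :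
  a1 - (zc * b1 + z * c1) - a3 - u1 * q + (a2 - (zc * b2 + z * c2) - a4 - u2 * q)
  = a1 + a2 - (zc * (b1 + b2) + z * (c1 + c2)) - (a3 + a4) - (u1 + u2) * q.
Proof. ring. Qed.

Lemma cm_imageD K K' : cm_image n K -> cm_image n K' -> cm_image n (K + K').
Proof.
move=> [f [g [p [U [hf hg [hp hp'] [hU bU] ->]]]]] [f' [g' [p' [U' [hf' hg' [hq hq'] [hU' bU'] ->]]]]].
exists (f + f'), (g + g'), (p + p'), (U + U'); split; try exact: FiltD.
- by split; [apply: cm_normalD | apply: FiltD].
- by split; [apply: FiltD | rewrite barD bU bU'].
- have -> : hol (f + f') = hol f + hol f' by exact: rmorphD.
  have -> : hol (g + g') = hol g + hol g' by exact: rmorphD.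
  rewrite imD phi_stdD barD.
  exact: cm_imageD_ring.
Qed.

(** The operator is only linear over the reals. Asking for all complex multiples of K,
    symmetrised by conjugation, yields a complex subspace stable under conjugation, in
    which elimination can be carried out with complex coefficients. *)
Variant cimage (K : A) : Prop :=
  cimageI of forall c, cm_image n (cst c * K + bar (cst c * K)).

Lemma cimageD K K' : cimage K -> cimage K' -> cimage (K + K').
Proof.
move=> [h] [h']; split=> c; rewrite mulrDr barD addrACA; exact: cm_imageD.
Qed.
Lemma cimageC c K : cimage K -> cimage (cst c * K).
Proof. by move=> [h]; split=> d; rewrite mulrA -mpolyCM; apply: h. Qed.
Lemma cimageN K : cimage K -> cimage (- K).
Proof. by move=> /(cimageC (- 1)); rewrite mpolyCN mulNr mpolyC1 mul1r. Qed.
Lemma cimageB K K' : cimage K -> cimage K' -> cimage (K - K').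
Proof. by move=> h h'; exact: (cimageD h (cimageN h')). Qed.
Lemma cimage_bar K : cimage K -> cimage (bar K).
Proof.
move=> [h]; split=> c; have := h (conjc c).
by rewrite !barM !barC conjcK barK addrC.
Qed.
Lemma cimage0 : cimage 0.
Proof.
split=> c; rewrite mulr0 rmorph0 addr0.
exists 0, 0, 0, 0; split; rewrite ?rmorph0; try exact: Filt0.
- by split; [apply: cm_normal0 | apply: Filt0].
- by split=> //; apply: Filt0.
- by rewrite /im !rmorph0 /= !(mulr0, mul0r, subr0, addr0).
Qed.
Lemma cimage_sum (I : Type) (r : seq I) (P : pred I) (F : I -> A) :
  (forall i, P i -> cimage (F i)) -> cimage (\sum_(i <- r | P i) F i).
Proof.
move=> h; exact: (big_ind cimage cimage0 cimageD h).
Qed.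

Lemma im_2i c p : im (cst (2 * iC R * c) * p) = cst c * p + bar (cst c * p).
Proof.
have nz : (2 * iC R) != 0 by rewrite mulf_neq0 ?iC_neq0 ?pnatr_eq0.
have e : conjc (2 * iC R * c) = - (2 * iC R * conjc c).
  have -> : conjc (2 * iC R * c) = conjc 2 * conjc (iC R) * conjc c.
    by rewrite -!rmorphM.
  by rewrite conj_iC conjc_nat mulrN mulNr.
rewrite /im !barM !barC e mpolyCN mulNr opprK mulrDr !mulrA -!mpolyCM.
have e2 d : (2 * iC R)^-1 * (2 * iC R * d) = d by rewrite mulKf.
by rewrite !e2.
Qed.

Lemma cimage_hol g : Filt w2 n.+2 g -> cimage (hol g).
Proof.
move=> hg; split=> c; exists 0, (mpolyC 2 (2 * iC R * c) * g), 0, 0; split.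
- exact: Filt0.
- exact: FiltMl.
- by split; [apply: cm_normal0 | apply: Filt0].
- by split; [apply: Filt0 | rewrite rmorph0].
- have -> : hol (mpolyC 2 (2 * iC R * c) * g) = cst (2 * iC R * c) * hol g.
    by rewrite [LHS]rmorphM; congr (_ * _); apply: holC.
  by rewrite im_2i !rmorph0 !(mulr0, mul0r, subr0, addr0).
Qed.

Lemma cimage_zbar_hol f : Filt w2 n.+1 f -> cimage (Zc * hol f).
Proof.
move=> hf; split=> c; exists (mpolyC 2 (- c) * f), 0, 0, 0; split.
- exact: FiltMl.
- exact: Filt0.
- by split; [apply: cm_normal0 | apply: Filt0].
- by split; [apply: Filt0 | rewrite rmorph0].
- have -> : hol (mpolyC 2 (- c) * f) = - (cst c * hol f).
    by rewrite [LHS]rmorphM -mulNr -mpolyCN; congr (_ * _); apply: holC.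
  rewrite /im !rmorph0 !(mulr0, mul0r, subr0, addr0) barN !barM barE.
  by rewrite !mulrN -opprD opprK mulrCA [bar _ * (Z * _)]mulrCA add0r.
Qed.

Lemma cimage_normal i k j : (n.+2 <= i + k + 2 * j)%N -> normal_idx i k ->
  cimage (Z ^+ i * Zc ^+ k * re W ^+ j).
Proof.
move=> hn h; split=> c.
exists 0, 0, (mpolyC 3 (- c) * mpolyX C (mn3 i k j) + mpolyC 3 (conjc (- c)) * mpolyX C (mn3 k i j)), 0; split.
- exact: Filt0.
- exact: Filt0.
- split; first exact: cm_normal_mono.
  by apply: FiltD; apply/FiltMl/FiltXm; rewrite wt_mn3 // [(k + i)%N]addnC.
- by split; [apply: Filt0 | rewrite rmorph0].
- rewrite /im !rmorph0 !(mulr0, mul0r, subr0, addr0) sub0r.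
  rewrite phi_stdD !phi_stdM !phi_stdC !phi_std_X !barM !barX !barE bar_re barC.
  have -> : conjc (- c) = - conjc c by exact: rmorphN.
  by rewrite !mpolyCN !mulNr -opprD opprK [Zc ^+ i * _]mulrC.
Qed.

Lemma cimage_quadric P : Filt w4 n P -> cimage (P * quadric).
Proof.
move=> hP; split=> c.
exists 0, 0, 0, (- (cst c * P + bar (cst c * P))); split.
- exact: Filt0.
- exact: Filt0.
- by split; [apply: cm_normal0 | apply: Filt0].
- split; last by rewrite barN barD barK addrC.
  by apply/FiltN/FiltD; [|apply: Filt_bar]; apply: FiltMl.
- rewrite /im !rmorph0 !(mulr0, mul0r, subr0, addr0) sub0r mulNr opprK.
  by rewrite mulrDl mulrA barM bar_quadric.
Qed.

End Span.
End ChernMoserOperator.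

(** * Surjectivity of the Chern-Moser operator *)

Lemma binomial_term_ring (T : comNzRingType) (a1 a2 a3 a4 a5 a6 a7 : T) :
  a3 * a4 * a5 * (a2 * (a1 * (a7 * a6))) = a2 * (a3 * a4 * a7 * (a5 * a6) * a1).
Proof. ring. Qed.

Lemma low_terms_add_ring (T : comNzRingType) (e0 e1 e2 e3 c1 c2 c3 ci : T) :
  e0 + c1 * ci * e1 - c2 * e2 - c3 * ci * e3 + (e0 + c1 * - ci * e1 - c2 * e2 - c3 * - ci * e3)
  = 2%:R * (e0 - c2 * e2).
Proof. ring. Qed.

Lemma low_terms_sub_ring (T : comNzRingType) (e0 e1 e2 e3 c1 c2 c3 ci : T) :
  e0 + c1 * ci * e1 - c2 * e2 - c3 * ci * e3 - (e0 + c1 * - ci * e1 - c2 * e2 - c3 * - ci * e3)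
  = 2%:R * ci * (c1 * e1 - c3 * e3).
Proof. ring. Qed.

Lemma diag_elimination_ring (T : comNzRingType) (e1 e3 c1 c2 c3 : T) : c1 * c2 = 3%:R * c3 ->
  c1 * e1 - c3 * e3 - c1 * (e1 - c2 * e3) = 2%:R * c3 * e3.
Proof. by move=> h; ring: h. Qed.

Lemma cimage_mono_ring1 (T : comNzRingType) (a b z zc u w v c q : T) :
  a * b * ((u + c * (q + z * zc)) * w) * v =
  a * b * w * (u * v) + c * (z * a * (zc * b) * w * v) + c * (a * b * w * v) * q.
Proof. ring. Qed.

Lemma cimage_mono_ring2 (T : comNzRingType) (u c v : T) :
  u + - c * v = u + c * v - 2%:R * c * v.
Proof. ring. Qed.

Lemma cimage_mono_ring3 (T : comNzRingType) (a b z zc w v wl c q : T) :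
  a * b * w * ((v - c * (q + z * zc)) * wl) =
  a * b * (v * w) * wl - c * (z * a * (zc * b) * w * wl) - c * (a * b * w * wl) * q.
Proof. ring. Qed.

Section ChernMoserSpan.
Variable R : realType.
Local Notation C := R[i].
Local Notation A := (mpoly 4 C).
Local Notation Z := (Zv R).
Local Notation W := (Wv R).
Local Notation Zc := (Zb R).
Local Notation Wc := (Wb R).
Local Notation cst := (mpolyC 4).
Local Notation u := (re W).
Local Notation cimage := (@cimage R).
Variable n : nat.

Lemma cimageCV a (K : A) : a != 0 -> cimage n (cst a * K) -> cimage n K.
Proof.
move=> a0 /(cimageC a^-1); rewrite mulrA -mpolyCM mulVf // mpolyC1 mul1r.
exact: id.
Qed.

Lemma re_im_W : W = u + cst (iC R) * im W.
Proof.
have e : iC R * (2 * iC R)^-1 = 2^-1 by rewrite invfM mulrCA divff ?iC_neq0 // mulr1.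
rewrite /re /im mulrA -mpolyCM e.
have e1 : 2^-1 + 2^-1 = 1 :> C by rewrite [RHS]splitr !div1r.
by rewrite -mulrDr addrACA subrr addr0 mulrDr -mulrDl -mpolyCD e1 mpolyC1 mul1r.
Qed.

Lemma bar_W_re_im : Wc = u + cst (- iC R) * im W.
Proof.
have := congr1 (@bar R) re_im_W; rewrite barD bar_re barM bar_im barC bar_W => {1}->; congr (_ + cst _ * _).
exact: conj_iC.
Qed.

(** For fixed d and N these monomials are the ones that the expansions of z^d w^N and of
    zbar z^(d+1) w^(N-1) on the quadric mix. *)
Definition diag_term d N m : A := Z ^+ (d + m) * Zc ^+ m * u ^+ (N - m).

(** The part l < 4 of the expansion of z^(d+k) zbar^k (u + c z zbar)^J, when c^2 = -1. *)
Definition low_terms (c : C) d k J : A :=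
  diag_term d (k + J) k + cst (J%:R * c) * diag_term d (k + J) k.+1
  - cst ('C(J, 2))%:R * diag_term d (k + J) k.+2 - cst (('C(J, 3))%:R * c) * diag_term d (k + J) k.+3.

Lemma cimage_diag_normal d N m : (n.+2 <= d + 2 * N)%N -> (m <= N)%N -> normal_idx (d + m) m ->
  cimage n (diag_term d N m).
Proof. by move=> h mN hm; apply: cimage_normal => //; lia. Qed.

(** On the quadric w = u + i z zbar, so that powers of w (c = i) and of its conjugate
    (c = -i) expand binomially; the terms with l >= 4 have indices allowed in
    a normal form. *)
Lemma cimage_low_terms c (X : A) d k J : c * c = -1 -> X = u + cst c * im W ->
  (n.+2 <= d + 2 * (k + J))%N -> cimage n (Z ^+ (d + k) * Zc ^+ k * X ^+ J) ->
  cimage n (low_terms c d k J).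
Proof.
move=> c2 XE hn hX.
pose Y := u + cst c * (Z * Zc).
(* X and Y differ by c times the defining function *)
have hY : cimage n (Z ^+ (d + k) * Zc ^+ k * Y ^+ J).
  have -> : Z ^+ (d + k) * Zc ^+ k * Y ^+ J =
      Z ^+ (d + k) * Zc ^+ k * X ^+ J
      - Z ^+ (d + k) * Zc ^+ k * (cst c * \sum_(i < J) X ^+ (J.-1 - i) * Y ^+ i) * quadric R.
    have -> : Y ^+ J = X ^+ J - (X - Y) * \sum_(i < J) X ^+ (J.-1 - i) * Y ^+ i.
      by rewrite -subrXX subKr.
    have -> : X - Y = cst c * quadric R by rewrite XE /Y opprD addrACA subrr add0r -mulrBr.
    move: (\sum_(i < J) _) (Z ^+ _) (Zc ^+ _) (quadric R) (cst c) (X ^+ J) => a1 a2 a3 a4 a5 a6.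
    by rewrite mulrBr -!mulrA [a4 * _]mulrC.
  apply: (cimageB hX); apply: cimage_quadric.
  apply: (@FiltW _ _ _ _ (d + k + k + 2 * J.-1)); first by lia.
  have hX1 (p : A) j : Filt (@w4) 1 p -> Filt (@w4) j (p ^+ j).
    by move=> h; rewrite -[X in Filt _ X]muln1; apply: FiltX.
  apply: FiltM.
    by apply: FiltM; apply: hX1; [apply: Filt_Z | apply: Filt_Zc].
  apply: FiltMl; apply: Filt_sum => i _.
  have hYf : Filt (@w4) 2 Y.
    apply: FiltD; first exact/Filt_re/Filt_W.
    by apply: FiltMl; apply: (@FiltM _ _ _ 1 1); [apply: Filt_Z | apply: Filt_Zc].
  have hXf : Filt (@w4) 2 X.
    by rewrite XE; apply: FiltD; [apply/Filt_re/Filt_W | apply/FiltMl/Filt_im/Filt_W].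
  apply: (@FiltW _ _ _ _ ((J.-1 - i) * 2 + i * 2)); last by apply: FiltM; apply: FiltX.
  have := ltn_ord i; lia.
have {hX} := hY.
have -> : Z ^+ (d + k) * Zc ^+ k * Y ^+ J =
   \sum_(l < J.+4) cst (('C(J, l))%:R * c ^+ l) * diag_term d (k + J) (k + l).
  have -> : Y ^+ J = \sum_(l < J.+4) cst (('C(J, l))%:R * c ^+ l) * (u ^+ (J - l) * (Z * Zc) ^+ l).
    rewrite /Y exprDn (big_ord_widen J.+4 (fun l => u ^+ (J - l) * (cst c * (Z * Zc)) ^+ l *+ 'C(J, l))); last by lia.
    rewrite big_mkcond /=; apply: eq_bigr => l _; case: ifP => lJ; last first.
      by rewrite bin_small ?mul0r ?mpolyC0 ?mul0r //; lia.
    rewrite exprMn_comm; last exact: mulrC.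
    rewrite -rmorphXn /= mpolyCM mpolyC_nat -mulr_natl -!mulrA; congr (_ * _).
    by rewrite mulrCA.
  rewrite mulr_sumr; apply: eq_bigr => l _; rewrite /diag_term addnA !exprD subnDl.
  rewrite exprMn_comm; last exact: mulrC.
  move: (u ^+ _) (cst _) (Z ^+ _) (Z ^+ _) (Zc ^+ _) (Zc ^+ _) (Z ^+ _) => a1 a2 a3 a4 a5 a6 a7.
  exact: binomial_term_ring.
rewrite (@big_split_ord _ _ _ 4 J) /= => hsum.
have tail : cimage n (\sum_(l < J) cst (('C(J, 4 + l))%:R * c ^+ (4 + l)) * diag_term d (k + J) (k + (4 + l))).
  apply: cimage_sum => l _; case: (leqP (4 + l) J) => h; last first.
    by rewrite bin_small // mul0r mpolyC0 mul0r; apply: cimage0.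
  by apply/cimageC/cimage_diag_normal; rewrite /normal_idx; lia.
have := cimageB hsum tail; rewrite addrK !big_ord_recl big_ord0 /= bin0 bin1.
rewrite expr0 expr1 expr2 exprS expr2 c2 !mulr1 mpolyC1 mul1r addn0 addr0.
rewrite !addn1 !addn2 !addn3 !mulrN1 !mulrN !mpolyCN !mulNr !addrA.
exact: id.
Qed.

Lemma iC_N2 : (- iC R) * (- iC R) = -1. Proof. by rewrite mulrNN iC2. Qed.

(** The expansions of a power of w and of its conjugate together separate even from odd
    powers of i. *)
Lemma low_terms_split d k J : cimage n (low_terms (iC R) d k J) -> cimage n (low_terms (- iC R) d k J) ->
  cimage n (diag_term d (k + J) k - cst ('C(J, 2))%:R * diag_term d (k + J) k.+2) /\
  cimage n (cst J%:R * diag_term d (k + J) k.+1 - cst ('C(J, 3))%:R * diag_term d (k + J) k.+3).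
Proof.
move=> h h'; have i0 := iC_neq0 R.
split.
  apply: (@cimageCV 2); first by rewrite pnatr_eq0.
  rewrite [cst 2]mpolyC_nat.
  have := cimageD h h'; rewrite /low_terms !mpolyCM mpolyCN.
  move: (diag_term _ _ _) (diag_term _ _ _) (diag_term _ _ _) (diag_term _ _ _) (cst _) (cst _) (cst _) (cst _) => e0 e1 e2 e3 c1 c2 c3 ci.
  by rewrite low_terms_add_ring.
apply: (@cimageCV (2 * iC R)); first by rewrite mulf_neq0 // pnatr_eq0.
rewrite [cst (2 * _)]mpolyCM [cst 2]mpolyC_nat.
have := cimageB h h'; rewrite /low_terms !mpolyCM mpolyCN.
move: (diag_term _ _ _) (diag_term _ _ _) (diag_term _ _ _) (diag_term _ _ _) (cst _) (cst _) (cst _) (cst _) => e0 e1 e2 e3 c1 c2 c3 ci.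
by rewrite low_terms_sub_ring.
Qed.

Lemma hol_mono i j : hol (mvar C 0 ^+ i * mvar C 1 ^+ j) = Z ^+ i * W ^+ j.
Proof. by rewrite [LHS]rmorphM !rmorphXn -hol0 -hol1. Qed.

Lemma Filt_mono2 i j : Filt (@w2) (i + 2 * j) (mvar C 0 ^+ i * mvar C 1 ^+ j).
Proof.
apply: FiltM.
  by rewrite -[X in Filt _ X]muln1; apply/FiltX/Filt_var.
by rewrite mulnC; apply/FiltX/Filt_var.
Qed.

Lemma cimage_ZW d J : (n.+2 <= d + 2 * J)%N -> cimage n (Z ^+ d * W ^+ J).
Proof. by move=> h; rewrite -hol_mono; apply: cimage_hol; exact: (FiltW h (@Filt_mono2 d J)). Qed.

Lemma cimage_ZcZW d J : (n.+1 <= d + 2 * J)%N -> cimage n (Zc * (Z ^+ d * W ^+ J)).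
Proof. by move=> h; rewrite -hol_mono; apply: cimage_zbar_hol; exact: (FiltW h (@Filt_mono2 d J)). Qed.

Lemma cimage_coef0 (x : nat) (K : A) : ((0 < x)%N -> cimage n K) -> cimage n (cst x%:R * K).
Proof.
by case: x => [|x] h; [rewrite mpolyC0 mul0r; apply: cimage0 | apply/cimageC/h].
Qed.

Lemma cimage_natV (x : nat) (K : A) : (0 < x)%N -> cimage n (cst x%:R * K) -> cimage n K.
Proof. by move=> h; apply: cimageCV; rewrite pnatr_eq0 -lt0n. Qed.

Lemma cimage_addl (x y : A) : cimage n (x + y) -> cimage n y -> cimage n x.
Proof. by move=> h h'; have := cimageB h h'; rewrite addrK. Qed.
Lemma cimage_subl (x y : A) : cimage n (x - y) -> cimage n y -> cimage n x.
Proof. by move=> h h'; have := cimageD h h'; rewrite subrK. Qed.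

Lemma low_terms_hol d N : (n.+2 <= d + 2 * N)%N -> cimage n (low_terms (iC R) d 0 N).
Proof.
move=> h; apply: (cimage_low_terms (iC2 R) re_im_W) => //.
by rewrite addn0 expr0 mulr1; apply: cimage_ZW.
Qed.

Lemma low_terms_zbar_hol d N : (n.+2 <= d + 2 * N.+1)%N -> cimage n (low_terms (iC R) d 1 N).
Proof.
move=> h; apply: (cimage_low_terms (iC2 R) re_im_W) => //.
rewrite addn1 expr1 [_ * Zc]mulrC -mulrA; apply: cimage_ZcZW; lia.
Qed.

Lemma cimage_coef0c (x : nat) c (K : A) : ((0 < x)%N -> cimage n K) -> cimage n (cst (x%:R * c) * K).
Proof. by move=> h; rewrite [_%:R * c]mulrC mpolyCM -mulrA; apply/cimageC/cimage_coef0. Qed.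

Lemma low_terms_head c d k J : cimage n (low_terms c d k J) ->
  ((0 < J)%N -> cimage n (diag_term d (k + J) k.+1)) -> ((1 < J)%N -> cimage n (diag_term d (k + J) k.+2)) ->
  ((2 < J)%N -> cimage n (diag_term d (k + J) k.+3)) -> cimage n (diag_term d (k + J) k).
Proof.
move=> h h1 h2 h3; apply: (cimage_addl (y := cst (J%:R * c) * diag_term d (k + J) k.+1)); last first.
  exact: cimage_coef0c.
apply: (cimage_subl (y := cst ('C(J, 2))%:R * diag_term d (k + J) k.+2)); last first.
  by apply: cimage_coef0; rewrite bin_gt0.
apply: (cimage_subl h).
by apply: cimage_coef0c; rewrite bin_gt0.
Qed.

Lemma low_terms_second c d k J : c != 0 -> (0 < J)%N -> cimage n (low_terms c d k J) ->
  cimage n (diag_term d (k + J) k) -> ((1 < J)%N -> cimage n (diag_term d (k + J) k.+2)) ->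
  ((2 < J)%N -> cimage n (diag_term d (k + J) k.+3)) -> cimage n (diag_term d (k + J) k.+1).
Proof.
move=> c0 J0 h h1 h2 h3.
apply: (@cimageCV (J%:R * c)); first by rewrite mulf_neq0 // pnatr_eq0 -lt0n.
apply: (cimage_addl (y := diag_term d (k + J) k)) => //; rewrite addrC.
apply: (cimage_subl (y := cst ('C(J, 2))%:R * diag_term d (k + J) k.+2)); last first.
  by apply: cimage_coef0; rewrite bin_gt0.
apply: (cimage_subl h).
by apply: cimage_coef0c; rewrite bin_gt0.
Qed.

(** If d >= 2, the terms m >= 2 are normal and z^d w^N, zbar z^(d+1) w^(N-1) yield the
    two others. If d = 1, the conjugate of zbar w^N has the same d and gives a further
    relation. If d = 0, so do the conjugates of w^N and of z zbar w^(N-1), and the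
    system for m = 1, 3 has determinant -2 C(N, 3), as N C(N-1, 2) = 3 C(N, 3). *)
Lemma cimage_diag d N m : (n.+2 <= d + 2 * N)%N -> (m <= N)%N -> cimage n (diag_term d N m).
Proof.
move=> hn.
have nE l : (l <= N)%N -> normal_idx (d + l) l -> cimage n (diag_term d N l) by move=> *; apply: cimage_diag_normal.
have h0 := low_terms_hol hn.
have h1 : (0 < N)%N -> cimage n (low_terms (iC R) d 1 N.-1).
  by case: N hn {nE h0} => // N hn _; apply: low_terms_zbar_hol.
(* a term of index m >= 4 is normal, whatever d *)
have red : ((0 <= N)%N -> cimage n (diag_term d N 0)) -> ((1 <= N)%N -> cimage n (diag_term d N 1)) ->
    ((2 <= N)%N -> cimage n (diag_term d N 2)) -> ((3 <= N)%N -> cimage n (diag_term d N 3)) ->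
    forall m, (m <= N)%N -> cimage n (diag_term d N m).
  move=> g0 g1 g2 g3 [|[|[|[|l]]]] hl; try by [apply: g0|apply: g1|apply: g2|apply: g3].
  by apply: nE => //; rewrite /normal_idx; lia.
have N1 : (0 < N)%N -> (1 + N.-1)%N = N by case: (N).
move=> hm; move: m hm.
case: (leqP 2 d) => hd.
  have g2 : (2 <= N)%N -> cimage n (diag_term d N 2) by move=> h; apply: nE => //; rewrite /normal_idx; lia.
  have g3 : (3 <= N)%N -> cimage n (diag_term d N 3) by move=> h; apply: nE => //; rewrite /normal_idx; lia.
  have g1 : (1 <= N)%N -> cimage n (diag_term d N 1).
    move=> h; have := low_terms_head (h1 h); rewrite (N1 h); apply.
    - by move=> ?; apply: g2; lia.
    - by move=> ?; apply: g3; lia.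
    - by move=> ?; apply: nE; rewrite /normal_idx; lia.
  by apply: red => // _; apply: (low_terms_head h0).
have h0' : cimage n (low_terms (- iC R) d 0 N).
  apply: (cimage_low_terms iC_N2 bar_W_re_im) => //; rewrite addn0 expr0 mulr1.
  case: (d) hd hn => [|[|//]] _ hn.
    rewrite expr0 mul1r -bar_W -barX; apply: cimage_bar; rewrite -[_ ^+ _]mul1r -(expr0 Z).
    exact: cimage_ZW.
  rewrite expr1 -bar_Zc -bar_W -barX -barM; apply: cimage_bar.
  by rewrite -[W ^+ _]mul1r -(expr0 Z); apply: cimage_ZcZW.
have [P Q] := low_terms_split h0 h0'.
have i0 := iC_neq0 R.
case: d hd hn nE h0 h1 h0' red P Q => [|[|//]] _ hn nE h0 h1 h0' red P Q.
  have PQ1 (h : (0 < N)%N) : cimage n (diag_term 0 N 1 - cst ('C(N.-1, 2))%:R * diag_term 0 N 3) /\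
    cimage n (cst N.-1%:R * diag_term 0 N 2 - cst ('C(N.-1, 3))%:R * diag_term 0 N 4).
    have := low_terms_split (h1 h); rewrite (N1 h); apply.
    apply: (cimage_low_terms iC_N2 bar_W_re_im); first by rewrite (N1 h).
    have -> : Z ^+ (0 + 1) * Zc ^+ 1 * Wc ^+ N.-1 = bar (Zc * (Z ^+ 1 * W ^+ N.-1)).
      by rewrite !barM !barX !barE mulrA.
    by apply: cimage_bar; apply: cimage_ZcZW; lia.
  have g2 : (2 <= N)%N -> cimage n (diag_term 0 N 2).
    move=> h; have [|_ Q1] := PQ1; first by lia.
    have h' : (0 < N.-1)%N by lia.
    apply: (cimage_natV h'); apply: (cimage_subl Q1).
    by apply: cimage_coef0; rewrite bin_gt0 => ?; apply: nE; rewrite /normal_idx; lia.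
  have g3 : (3 <= N)%N -> cimage n (diag_term 0 N 3).
    move=> h; have [|P1 _] := PQ1; first by lia.
    have h' : (0 < 2 * 'C(N, 3))%N by rewrite muln_gt0 bin_gt0.
    apply: (cimage_natV h'); have := cimageB Q (cimageC N%:R P1).
    have eN : (N * 'C(N.-1, 2) = 3 * 'C(N, 3))%N by apply: mul_bin_diag.
    have {}eN : cst N%:R * cst ('C(N.-1, 2))%:R = 3%:R * cst ('C(N, 3))%:R :> A.
      by rewrite -mpolyCM -natrM eN natrM mpolyCM; congr (_ * _); apply: mpolyC_nat.
    rewrite natrM mpolyCM (_ : cst 2 = 2%:R); last exact: mpolyC_nat.
    by rewrite add0n (diag_elimination_ring _ _ eN).
  have g1 : (1 <= N)%N -> cimage n (diag_term 0 N 1).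
    move=> h; have [//|P1 _] := PQ1; apply: (cimage_subl P1).
    by apply: cimage_coef0; rewrite bin_gt0 => ?; apply: g3; lia.
  apply: red => // _; apply: (cimage_subl P).
  by apply: cimage_coef0; rewrite bin_gt0.
have g3 : (3 <= N)%N -> cimage n (diag_term 1 N 3) by move=> h; apply: nE.
have g1 : (1 <= N)%N -> cimage n (diag_term 1 N 1).
  move=> h; apply: (cimage_natV h); apply: (cimage_subl Q).
  by apply: cimage_coef0; rewrite bin_gt0.
have g2 : (2 <= N)%N -> cimage n (diag_term 1 N 2).
  move=> h; have h' : (0 < N)%N by lia.
  have := low_terms_second i0 _ (h1 h'); rewrite (N1 h'); apply.
  - by lia.
  - exact: g1.
  - by move=> ?; apply: g3; lia.
  - by move=> ?; apply: nE; rewrite /normal_idx; lia.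
apply: red => // _; apply: (cimage_subl P).
by apply: cimage_coef0; rewrite bin_gt0.
Qed.

Lemma cimage_real_mono i k j : (n.+2 <= i + k + 2 * j)%N -> cimage n (Z ^+ i * Zc ^+ k * u ^+ j).
Proof.
have aux d m l : (n.+2 <= d + m + m + 2 * l)%N -> cimage n (Z ^+ (d + m) * Zc ^+ m * u ^+ l).
  move=> h; have := @cimage_diag d (m + l)%N m; rewrite /diag_term addKn; apply; lia.
case: (leqP k i) => hki h.
  by have := @aux (i - k)%N k j; rewrite subnK //; apply; lia.
have := @aux (k - i)%N i j; rewrite subnK ?(ltnW hki) // => /(_ _)/cimage_bar.
rewrite !barM !barX !barE bar_re [Zc ^+ _ * _]mulrC; apply; lia.
Qed.

Lemma Filt_mono4 i k j l : Filt (@w4) (i + k + 2 * j + 2 * l) (Z ^+ i * Zc ^+ k * W ^+ j * Wc ^+ l).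
Proof.
apply: FiltM; last by rewrite mulnC; apply/FiltX/Filt_Wc.
apply: FiltM; last by rewrite mulnC; apply/FiltX/Filt_W.
by apply: FiltM; [rewrite -[X in Filt _ X]muln1; apply/FiltX/Filt_Z
                 |rewrite -[X in Filt _ X]muln1; apply/FiltX/Filt_Zc].
Qed.

(** Modulo the defining function, w can be replaced with u + i z zbar, one factor at
    a time; the same is done for the conjugate of w in the next lemma. *)
Lemma cimage_mono_ZZcWu j i k j' : (n.+2 <= i + k + 2 * j + 2 * j')%N ->
  cimage n (Z ^+ i * Zc ^+ k * W ^+ j * u ^+ j').
Proof.
elim: j i k j' => [|j IH] i k j' h.
  by rewrite expr0 mulr1; apply: cimage_real_mono; lia.
have -> : Z ^+ i * Zc ^+ k * W ^+ j.+1 * u ^+ j' =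
   Z ^+ i * Zc ^+ k * W ^+ j * u ^+ j'.+1
   + cst (iC R) * (Z ^+ i.+1 * Zc ^+ k.+1 * W ^+ j * u ^+ j')
   + cst (iC R) * (Z ^+ i * Zc ^+ k * W ^+ j * u ^+ j') * quadric R.
  rewrite [W ^+ j.+1]exprS {1}re_im_W (_ : im W = quadric R + Z * Zc); last by rewrite subrK.
  by rewrite !exprS; apply: cimage_mono_ring1.
apply: cimageD; first apply: cimageD.
- by apply: IH; lia.
- by apply/cimageC/IH; lia.
- apply: cimage_quadric; apply: FiltMl.
  apply: (@FiltW _ _ _ _ (i + k + 2 * j + 2 * 0 + j' * 2)); first by lia.
  apply: FiltM; last by apply/FiltX/Filt_re/Filt_W.
  by have := @Filt_mono4 i k j 0; rewrite expr0 mulr1.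
Qed.

Lemma cimage_mono l i k j : (n.+2 <= i + k + 2 * j + 2 * l)%N ->
  cimage n (Z ^+ i * Zc ^+ k * W ^+ j * Wc ^+ l).
Proof.
elim: l i k j => [|l IH] i k j h.
  by rewrite expr0 -(expr0 u); apply: cimage_mono_ZZcWu; lia.
have eW : Wc = W - cst (2 * iC R) * (quadric R + Z * Zc).
  rewrite subrK [LHS]bar_W_re_im [X in X - _]re_im_W mpolyCN mpolyCM.
  by rewrite (_ : cst 2 = 2%:R); [apply: cimage_mono_ring2 | apply: mpolyC_nat].
have -> : Z ^+ i * Zc ^+ k * W ^+ j * Wc ^+ l.+1 =
   Z ^+ i * Zc ^+ k * W ^+ j.+1 * Wc ^+ l
   - cst (2 * iC R) * (Z ^+ i.+1 * Zc ^+ k.+1 * W ^+ j * Wc ^+ l)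
   - cst (2 * iC R) * (Z ^+ i * Zc ^+ k * W ^+ j * Wc ^+ l) * quadric R.
  by rewrite [Wc ^+ l.+1]exprS {1}eW !exprS; apply: cimage_mono_ring3.
apply: cimageB; first apply: cimageB.
- by apply: IH; lia.
- by apply/cimageC/IH; lia.
- apply: cimage_quadric; apply: FiltMl.
  by apply: FiltW (@Filt_mono4 i k j l); lia.
Qed.

Lemma mpolyX4 m : mpolyX C m = Z ^+ m 0 * Zc ^+ m 2 * W ^+ m 1 * Wc ^+ m 3.
Proof.
rewrite mpolyXE_id !big_ord_recl big_ord0 mulr1.
have -> : lift ord0 (ord0 : 'I_3) = 1 by apply/val_inj.
have -> : lift ord0 (lift ord0 (ord0 : 'I_2)) = 2 by apply/val_inj.
have -> : lift ord0 (lift ord0 (lift ord0 (ord0 : 'I_1))) = 3 by apply/val_inj.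
have -> : ord0 = 0 :> 'I_4 by apply/val_inj.
rewrite -!/(mvar _ _) -/Z -/W -/Zc -/Wc.
by rewrite [W ^+ _ * _]mulrCA !mulrA.
Qed.

Lemma cimage_Filt (K : A) : Filt (@w4) n.+2 K -> cimage n K.
Proof.
move=> hK; rewrite (mpolyE K) big_seq; apply: cimage_sum => m hm.
rewrite -mul_mpolyC; apply: cimageC; rewrite mpolyX4; apply: cimage_mono.
have := Filt_supp hK hm; rewrite /wt !big_ord_recl big_ord0 /w4 /=.
have -> : lift ord0 (ord0 : 'I_3) = 1 by apply/val_inj.
have -> : lift ord0 (lift ord0 (ord0 : 'I_2)) = 2 by apply/val_inj.
have -> : lift ord0 (lift ord0 (lift ord0 (ord0 : 'I_1))) = 3 by apply/val_inj.
have -> : ord0 = 0 :> 'I_4 by apply/val_inj.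
by rewrite !(tnth_nth 0%N) /=; move: (m 0) (m 1) (m 2) (m 3) => a b c d; lia.
Qed.

(** The Chern-Moser lemma. The operator maps onto all real polynomials, without loss in
    the order. *)
Lemma chern_moser_surjective (K : A) : Filt (@w4) n.+2 K -> bar K = K -> cm_image n K.
Proof.
move=> hK bK; case: (cimage_Filt hK) => /(_ 2^-1).
rewrite barM bK barC (_ : conjc 2^-1 = 2^-1); last by rewrite fmorphV rmorph_nat.
rewrite -mulrDl -mpolyCD; have -> : 2^-1 + 2^-1 = 1 :> C by rewrite [RHS]splitr !div1r.
by rewrite mpolyC1 mul1r.
Qed.
End ChernMoserSpan.

(** * Raising the order of contact with a normal form *)

Lemma defect_ring (T : comNzRingType) (ig f fb F Fb z zc c c' d v u q r ig' : T) :
  ig - (F * Fb + c) - u * r = ig' - (zc * f + z * fb) - d - v * q ->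
  (ig - ig') - ((F - f) * (Fb - fb) + c') - (u - v) * r =
  f * (Fb - zc) + fb * (F - z) - f * fb - (c' + d - c) + v * (r - q).
Proof.
move=> h.
have -> : ig = ig' - (zc * f + z * fb) - d - v * q + (F * Fb + c) + u * r.
  by rewrite -h; ring.
ring.
Qed.

Lemma addrB_ring (T : comNzRingType) (a b c d t : T) : t = a - b -> t + c - d = (a - d) - (b - c).
Proof. by move=> ->; ring. Qed.

Lemma subrKN_ring (T : comNzRingType) (a b : T) : a - b - a = - b.
Proof. ring. Qed.

Section Normalisation.
Variable R : realType.
Local Notation C := R[i].
Local Notation A := (mpoly 4 C).
Local Notation Z := (Zv R).
Local Notation W := (Wv R).
Local Notation Zc := (Zb R).
Local Notation Wc := (Wb R).
Local Notation cst := (mpolyC 4).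

Lemma holD p q : hol (p + q) = hol p + hol q :> A. Proof. exact: rmorphD. Qed.
Lemma holB p q : hol (p - q) = hol p - hol q :> A. Proof. exact: rmorphB. Qed.
Lemma holM p q : hol (p * q) = hol p * hol q :> A. Proof. exact: rmorphM. Qed.
Lemma imB p q : im (p - q) = im p - im q :> A.
Proof. by rewrite /im -mulrBr barB !opprD !opprK addrACA. Qed.
Lemma reB p q : re (p - q) = re p - re q :> A.
Proof. by rewrite /re -mulrBr barB opprD addrACA. Qed.

Definition phi_at (a b : A) (p : mpoly 3 C) : A := comp_mpoly [tuple a; bar a; re b] p.
Lemma phi_atB a b p q : phi_at a b (p - q) = phi_at a b p - phi_at a b q. Proof. exact: rmorphB. Qed.

Lemma bar_phi_at a b p : bar (phi_at a b p) = phi_at a b (bar3 p).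
Proof.
apply: (@mpoly_rmorph_ext _ _ _ (@bar R \o comp_mpoly [tuple a; bar a; re b])
   (comp_mpoly [tuple a; bar a; re b] \o @bar3 R)) => [c|].
  by rewrite -[LHS]/(bar (comp_mpoly _ _)) -[RHS]/(comp_mpoly _ (bar3 _)) comp_mpolyC barC bar3C comp_mpolyC.
case: (bar3_var R) => e0 e1 e2.
by apply: ord3P; rewrite -[LHS]/(bar (comp_mpoly _ _)) -[RHS]/(comp_mpoly _ (bar3 _)) ?e0 ?e1 ?e2
  !comp_mvar /= ?barK ?bar_re.
Qed.

Lemma phi_std_phi_at p : phi_std p = phi_at Z W p.
Proof. by rewrite /phi_std /phi_at bar_Z. Qed.

Lemma Filt_phi_atB s k p a b a' b' : Filt (@w4) 1 a -> Filt (@w4) 2 b ->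
  Filt (@w4) (1 + s) (a - a') -> Filt (@w4) (2 + s) (b - b') -> Filt (@w3) k p ->
  Filt (@w4) (k + s) (phi_at a b p - phi_at a' b' p).
Proof.
move=> ha hb haa hbb; apply: Filt_compB; apply: ord3P; rewrite /= /w3 /=.
- exact: ha.
- exact: Filt_bar.
- exact: Filt_re.
- exact: haa.
- by rewrite -barB; apply: Filt_bar.
- by rewrite -reB; apply: Filt_re.
Qed.

(** A stage of the normalisation: coordinates (F, G), the series phi without its term
    z zbar, and the unit U. *)
Record approx := Approx { aF : mpoly 2 C; aG : mpoly 2 C; aphi : mpoly 3 C; aU : A }.

(** The error in the equation Im G - phi (F, conj F, Re G) = U r that defines a normal
    form of {r = 0}. *)
Definition defect (r : A) (x : approx) : A :=
  im (hol (aG x)) - (hol (aF x) * bar (hol (aF x)) + phi_at (hol (aF x)) (hol (aG x)) (aphi x))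
  - aU x * r.

Record admissible (x : approx) : Prop := Admissible {
  adF : Filt (@w2) 3 (aF x - mvar C 0);
  adG : Filt (@w2) 3 (aG x - mvar C 1);
  adphi : cm_normal (aphi x);
  adphi7 : Filt (@w3) 7 (aphi x);
  adU : Filt (@w4) 1 (aU x - 1);
  adUr : bar (aU x) = aU x }.

Record close (m : nat) (x y : approx) : Prop := Close {
  clF : Filt (@w2) m.+1 (aF y - aF x);
  clG : Filt (@w2) m.+2 (aG y - aG x);
  clphi : Filt (@w3) m.+2 (aphi y - aphi x);
  clU : Filt (@w4) m (aU y - aU x) }.

Lemma bar3B p q : bar3 (p - q) = bar3 p - bar3 q :> mpoly 3 C. Proof. exact: rmorphB. Qed.

Lemma cm_normalB (p q : mpoly 3 C) : cm_normal p -> cm_normal q -> cm_normal (p - q).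
Proof.
move=> [p1 p2 p3] [q1 q2 q3]; split=> [|i k j|i k j h].
- by rewrite bar3B p1 q1.
- by rewrite !mcoeffB p2 q2 rmorphB.
- by rewrite mcoeffB p3 // q3 // subr0.
Qed.

Lemma bar_defect r x : bar r = r -> admissible x -> bar (defect r x) = defect r x.
Proof.
move=> br hx; have [ph _ _] := adphi hx.
by rewrite /defect !barB bar_im barD !barM barK bar_phi_at ph (adUr hx) br [bar _ * _]mulrC.
Qed.

(** The solution of the linearised equation is subtracted. F, G, U and r agree with
    z, w, 1 and the quadric to first order and aphi starts in weight 7; the errors of
    the linearisation therefore have one weight more than the defect. *)
Lemma normalisation_step r m x : bar r = r -> Filt (@w4) 3 (r - quadric R) -> (5 <= m)%N ->
  admissible x -> Filt (@w4) m.+2 (defect r x) ->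
  exists y, [/\ admissible y, Filt (@w4) m.+3 (defect r y) & close m x y].
Proof.
move=> br hr hm hx hd.
have [f [g [q [V [hf hg [hq hq'] [hV bV] eK]]]]] := chern_moser_surjective hd (bar_defect br hx).
have [xF xG xp xp7 xU xUr] := hx.
pose y := Approx (aF x - f) (aG x - g) (aphi x - q) (aU x - V).
have yF : Filt (@w2) 3 (aF y - mvar C 0).
  by rewrite /= addrAC; apply: FiltB => //; apply: FiltW hf; lia.
have yG : Filt (@w2) 3 (aG y - mvar C 1).
  by rewrite /= addrAC; apply: FiltB => //; apply: FiltW hg; lia.
have hy : admissible y.
  split=> //=.
  - exact: cm_normalB.
  - by apply: FiltB => //; apply: FiltW hq'; lia.
  - by rewrite addrAC; apply: FiltB => //; apply: FiltW hV; lia.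
  - by rewrite barB xUr bV.
exists y; split=> //; last first.
  by split; rewrite /= addrC addKr; apply: FiltN.
have holF z k : Filt (@w2) k (z - mvar C 0) -> Filt (@w4) k (hol z - Z).
  by move=> h; rewrite -hol0 -holB; apply: Filt_hol.
have holG z k : Filt (@w2) k (z - mvar C 1) -> Filt (@w4) k (hol z - W).
  by move=> h; rewrite -hol1 -holB; apply: Filt_hol.
have hf' : Filt (@w4) m.+1 (hol f) by exact: Filt_hol.
have hg' : Filt (@w4) m.+2 (hol g) by exact: Filt_hol.
have F1 : Filt (@w4) 1 (hol (aF y)).
  rewrite -[hol _](subrK Z); apply: FiltD; last exact: Filt_Z.
  by apply: FiltW (holF _ _ yF).
have G2 : Filt (@w4) 2 (hol (aG y)).
  rewrite -[hol _](subrK W); apply: FiltD; last exact: Filt_W.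
  by apply: FiltW (holG _ _ yG).
have -> : defect r y = hol f * (bar (hol (aF x)) - Zc) + bar (hol f) * (hol (aF x) - Z)
   - hol f * bar (hol f)
   - (phi_at (hol (aF y)) (hol (aG y)) (aphi y) + phi_std q - phi_at (hol (aF x)) (hol (aG x)) (aphi x))
   + V * (r - quadric R).
  rewrite /defect /= !holB imB barB; exact: defect_ring.
apply: FiltD; last by rewrite -[m.+3]addn3; apply: FiltM.
apply: FiltB.
  apply: FiltB; last by apply: (@FiltW _ _ _ _ (m.+1 + m.+1)); [lia | apply: FiltM => //; apply: Filt_bar].
  apply: (@FiltW _ _ _ _ (m.+1 + 3)); first lia.
  apply: FiltD; apply: FiltM => //; first by rewrite -bar_Z -barB; apply/Filt_bar/holF.
    exact: Filt_bar.
  exact: holF.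
have e1 := phi_atB (hol (aF y)) (hol (aG y)) (aphi x) q.
rewrite (addrB_ring _ _ e1).
apply: FiltB.
  apply: (@FiltW _ _ _ _ (7 + m)); first lia.
  apply: Filt_phi_atB => //.
    by rewrite /= holB (subrKN_ring (hol (aF x)) (hol f)); exact: (FiltN hf').
  by rewrite /= holB (subrKN_ring (hol (aG x)) (hol g)); exact: (FiltN hg').
rewrite -[m.+3]addn1 phi_std_phi_at; apply: Filt_phi_atB => //; last exact: holG.
by apply: FiltW (holF _ _ yF).
Qed.

End Normalisation.

(** * Formal limits and linear changes of coordinates *)

Section FormalLimit.
Variable K : comNzRingType.
Variables (n : nat).
Implicit Types (f : fps K n) (P : nat -> mpoly n K).

Definition unit_weight k (i : 'I_k) : nat := 1%N.

Lemma trunc_coeff N f m : (mdeg m < N)%N -> mcoeff m (trunc N f) = f m.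
Proof. by move=> h; rewrite /trunc mcoeff_mpoly. Qed.

Lemma Filt_deg N (p : mpoly n K) :
  Filt (@unit_weight n) N p <-> forall m, (mdeg m < N)%N -> mcoeff m p = 0.
Proof. by split=> h m hm; apply: h; rewrite ?wt_mdeg // -wt_mdeg. Qed.

(** When the k-th difference has degree at least k / 2, a coefficient of degree d is
    stationary from the index 2 (d + 1) on. *)
Definition fps_lim P : fps K n := fun m => mcoeff m (P (2 * (mdeg m).+1)%N).

Lemma fps_limP P : (forall k, Filt (@unit_weight n) k./2 (P k.+1 - P k)) ->
  forall N k, (2 * N <= k)%N -> Filt (@unit_weight n) N (trunc N (fps_lim P) - P k).
Proof.
move=> h N k hk; apply/Filt_deg => m hm; rewrite mcoeffB trunc_coeff // /fps_lim.
have h' j j' : (j <= j')%N -> Filt (@unit_weight n) j./2 (P j' - P j).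
  move=> /subnKC <-; elim: (j' - j)%N => [|i IH].
    by rewrite addn0 subrr; apply: Filt0.
  rewrite addnS -[P _](subrK (P (j + i)%N)) -addrA; apply: FiltD => //.
  by apply: FiltW (h (j + i)%N); lia.
have /Filt_deg/(_ m) := h' (2 * (mdeg m).+1)%N k ltac:(lia).
rewrite mcoeffB mul2n doubleK => /(_ (ltnSn _))/eqP; rewrite subr_eq0 => /eqP ->.
by rewrite subrr.
Qed.

End FormalLimit.

Lemma limit_ring (T : comNzRingType) (a b c e x y z t : T) :
  a - b - c = (x - (y + z) - t) + (a - x) - (b - e) - (e - (y + z)) - (c - t).
Proof. ring. Qed.

Lemma limit_mul_ring (T : comNzRingType) (u v w : T) : u * w - v * w = (u - v) * w.
Proof. ring. Qed.

Section Limit.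
Variable R : realType.
Local Notation C := R[i].
Local Notation A := (mpoly 4 C).
Local Notation Z := (Zv R).
Local Notation W := (Wv R).
Local Notation Zc := (Zb R).
Local Notation Wc := (Wb R).
Local Notation cst := (mpolyC 4).

Lemma Filt_deg_bar k (p : A) : Filt (@unit_weight 4) k p -> Filt (@unit_weight 4) k (bar p).
Proof.
move=> h; apply: Filt_cconj; apply: Filt_comp h.
by apply: ord4P; apply: Filt_var.
Qed.
Lemma Filt_deg_im k (p : A) : Filt (@unit_weight 4) k p -> Filt (@unit_weight 4) k (im p).
Proof. by move=> h; apply/FiltMl/FiltB; [exact: h | exact: Filt_deg_bar]. Qed.
Lemma Filt_deg_re k (p : A) : Filt (@unit_weight 4) k p -> Filt (@unit_weight 4) k (re p).
Proof. by move=> h; apply/FiltMl/FiltD; [exact: h | exact: Filt_deg_bar]. Qed.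
Lemma Filt_deg_hol k (p : mpoly 2 C) : Filt (@unit_weight 2) k p -> Filt (@unit_weight 4) k (hol p).
Proof. by apply: Filt_comp; apply: ord2P; apply: Filt_var. Qed.

Lemma antihol_truncE N F : antihol_trunc N F = bar (hol (trunc N F)) :> A.
Proof.
rewrite bar_hol /antihol_trunc; congr comp_mpoly.
rewrite /trunc [RHS]rmorph_sum; apply: eq_bigr => m _.
by rewrite [RHS]map_mpolyZ map_mpolyX.
Qed.
Lemma im_scaled (p : A) : (2%:R * (0 +i* 1))^-1 *: (p - bar p) = im p.
Proof. by rewrite -mul_mpolyC. Qed.
Lemma re_scaled (p : A) : 2%:R^-1 *: (p + bar p) = re p.
Proof. by rewrite -mul_mpolyC. Qed.

Lemma phi_at_0 p q : phi_at p q (mvar C 0) = p :> A. Proof. by rewrite /phi_at comp_mvar. Qed.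
Lemma phi_at_1 p q : phi_at p q (mvar C 1) = bar p :> A. Proof. by rewrite /phi_at comp_mvar. Qed.
Lemma phi_at_2 p q : phi_at p q (mvar C 2) = re q :> A. Proof. by rewrite /phi_at comp_mvar. Qed.

Section LinearChange.
Variables a b c d : C.
Let l0 : mpoly 2 C := mpolyC 2 a * mvar C 0 + mpolyC 2 b * mvar C 1.
Let l1 : mpoly 2 C := mpolyC 2 c * mvar C 0 + mpolyC 2 d * mvar C 1.
Definition lin2 (p : mpoly 2 C) : mpoly 2 C := comp_mpoly [tuple l0; l1] p.
Definition lin4 (p : A) : A :=
  comp_mpoly [tuple hol l0; hol l1; bar (hol l0); bar (hol l1)] p.
HB.instance Definition _ := GRing.RMorphism.copy lin2 (comp_mpoly [tuple l0; l1]).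
HB.instance Definition _ := GRing.RMorphism.copy lin4
  (comp_mpoly [tuple hol l0; hol l1; bar (hol l0); bar (hol l1)]).
Lemma lin4C x : lin4 (cst x) = cst x. Proof. exact: comp_mpolyC. Qed.
Lemma lin4B p q : lin4 (p - q) = lin4 p - lin4 q. Proof. exact: rmorphB. Qed.
Lemma lin4D p q : lin4 (p + q) = lin4 p + lin4 q. Proof. exact: rmorphD. Qed.
Lemma lin4M p q : lin4 (p * q) = lin4 p * lin4 q. Proof. exact: rmorphM. Qed.
Lemma lin4_Z : lin4 Z = hol l0. Proof. by rewrite /lin4 comp_mvar. Qed.
Lemma lin4_W : lin4 W = hol l1. Proof. by rewrite /lin4 comp_mvar. Qed.
Lemma lin4_Zc : lin4 Zc = bar (hol l0). Proof. by rewrite /lin4 comp_mvar. Qed.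
Lemma lin4_Wc : lin4 Wc = bar (hol l1). Proof. by rewrite /lin4 comp_mvar. Qed.

Lemma lin4_bar p : lin4 (bar p) = bar (lin4 p).
Proof.
apply: (@mpoly_rmorph_ext _ _ _ (lin4 \o @bar R) (@bar R \o lin4)) => [x|].
  by rewrite -[LHS]/(lin4 (bar (cst x))) -[RHS]/(bar (lin4 (cst x))) (barC x) !lin4C (barC x).
apply: ord4P.
- by rewrite -[LHS]/(lin4 (bar Z)) -[RHS]/(bar (lin4 Z)) bar_Z lin4_Z lin4_Zc.
- by rewrite -[LHS]/(lin4 (bar W)) -[RHS]/(bar (lin4 W)) bar_W lin4_W lin4_Wc.
- by rewrite -[LHS]/(lin4 (bar Zc)) -[RHS]/(bar (lin4 Zc)) bar_Zc lin4_Z lin4_Zc barK.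
- by rewrite -[LHS]/(lin4 (bar Wc)) -[RHS]/(bar (lin4 Wc)) bar_Wc lin4_W lin4_Wc barK.
Qed.

Lemma lin4_hol p : lin4 (hol p) = hol (lin2 p).
Proof.
apply: (@mpoly_rmorph_ext _ _ _ (lin4 \o @hol R) (@hol R \o lin2)) => [x|].
  rewrite -[LHS]/(lin4 (hol (mpolyC 2 x))) -[RHS]/(hol (lin2 (mpolyC 2 x))).
  by rewrite /lin2 (comp_mpolyC x) (holC x) lin4C.
apply: ord2P.
- by rewrite -[LHS]/(lin4 (hol (mvar C 0))) -[RHS]/(hol (lin2 (mvar C 0))) hol0 lin4_Z /lin2 comp_mvar.
- by rewrite -[LHS]/(lin4 (hol (mvar C 1))) -[RHS]/(hol (lin2 (mvar C 1))) hol1 lin4_W /lin2 comp_mvar.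
Qed.

Lemma lin4_im p : lin4 (im p) = im (lin4 p).
Proof. by rewrite /im lin4M lin4C lin4B lin4_bar. Qed.
Lemma lin4_re p : lin4 (re p) = re (lin4 p).
Proof. by rewrite /re lin4M lin4C lin4D lin4_bar. Qed.

Lemma lin4_phi_at p q s : lin4 (phi_at p q s) = phi_at (lin4 p) (lin4 q) s.
Proof.
apply: (@mpoly_rmorph_ext _ _ _ (lin4 \o comp_mpoly [tuple p; bar p; re q])
   (comp_mpoly [tuple lin4 p; bar (lin4 p); re (lin4 q)])) => [x|].
  rewrite -[LHS]/(lin4 (comp_mpoly [tuple p; bar p; re q] (mpolyC 3 x))).
  by rewrite [in LHS](comp_mpolyC x) [RHS](comp_mpolyC x) lin4C.
apply: ord3P.
- exact: etrans (congr1 lin4 (phi_at_0 p q)) (esym (phi_at_0 (lin4 p) (lin4 q))).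
- exact: etrans (congr1 lin4 (phi_at_1 p q)) (etrans (lin4_bar p) (esym (phi_at_1 (lin4 p) (lin4 q)))).
- exact: etrans (congr1 lin4 (phi_at_2 p q)) (etrans (lin4_re q) (esym (phi_at_2 (lin4 p) (lin4 q)))).
Qed.

Lemma Filt_l01 : Filt (@unit_weight 2) 1 l0 /\ Filt (@unit_weight 2) 1 l1.
Proof. by split; apply: FiltD; apply/FiltMl/Filt_var. Qed.

Lemma Filt_lin2 k p : Filt (@unit_weight 2) k p -> Filt (@unit_weight 2) k (lin2 p).
Proof. by have [h0 h1] := Filt_l01; apply: Filt_comp; apply: ord2P. Qed.
Lemma Filt_lin4 k p : Filt (@unit_weight 4) k p -> Filt (@unit_weight 4) k (lin4 p).
Proof.
have [h0 h1] := Filt_l01; apply: Filt_comp; apply: ord4P; rewrite /=.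
- exact: Filt_deg_hol.
- exact: Filt_deg_hol.
- exact/Filt_deg_bar/Filt_deg_hol.
- exact/Filt_deg_bar/Filt_deg_hol.
Qed.

Lemma lin2_coef : [/\ mcoeff (mnm1 0) l0 = a, mcoeff (mnm1 1) l0 = b,
  mcoeff (mnm1 0) l1 = c & mcoeff (mnm1 1) l1 = d].
Proof.
by split; rewrite mcoeffD !mcoeffCM !mcoeffX !eqxx ?mulr1 (_ : (mnm1 _ == mnm1 _) = false)
  ?mulr0 ?addr0 ?add0r //; apply/eqP => /mnmP/(_ 0); rewrite !mnm1E.
Qed.

End LinearChange.
End Limit.

(** * Umbilicity from contact of weight seven with the quadric *)

Section UmbilicalLimit.
Variable R : realType.
Local Notation C := R[i].
Local Notation A := (mpoly 4 C).
Local Notation Z := (Zv R).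
Local Notation W := (Wv R).
Local Notation Zc := (Zb R).
Local Notation Wc := (Wb R).
Local Notation cst := (mpolyC 4).

Lemma approx_sequence (r : A) x0 : bar r = r -> Filt (@w4) 3 (r - quadric R) ->
  admissible x0 -> Filt (@w4) 7 (defect r x0) ->
  exists s : nat -> approx R, forall k,
   [/\ admissible (s k), Filt (@w4) (k + 7) (defect r (s k)) & close (k + 5) (s k) (s k.+1)].
Proof.
move=> br hr h0 d0.
have next k x : {y | admissible x -> Filt (@w4) (k + 7) (defect r x) ->
    [/\ admissible y, Filt (@w4) (k + 8) (defect r y) & close (k + 5) x y]}.
  apply: cid; have [[hx hd]|h] := pselect (admissible x /\ Filt (@w4) (k + 7) (defect r x)).
    have e7 : (k + 7 = (k + 5).+2)%N by lia.
    have e8 : (k + 8 = (k + 5).+3)%N by lia.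
    rewrite e7 in hd; rewrite e8.
    have [|y hy] := normalisation_step br hr _ hx hd; first by lia.
    by exists y.
  by exists x => hx hd; case: h.
pose s := fix s k := if k is j.+1 then sval (next j (s j)) else x0.
have hs k : admissible (s k) /\ Filt (@w4) (k + 7) (defect r (s k)).
  elim: k => [|k [IH1 IH2]]; first by split.
  have [h1 h2 _] := svalP (next k (s k)) IH1 IH2.
  by split; [exact: h1 | rewrite addSnnS; exact: h2].
exists s => k; have [h1 h2] := hs k.
by have [_ _ h3] := svalP (next k (s k)) h1 h2; split; [exact: h1 | exact: h2 | exact: h3].
Qed.

Variables a b c d kap : C.
Hypothesis det_neq0 : a * d - b * c != 0.
Hypothesis kap_neq0 : kap != 0.
Variables (rho : A) (p : C * C) (r : A).
Hypothesis bar_r : bar r = r.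
Hypothesis r_quadric : Filt (@w4) 3 (r - quadric R).
Hypothesis lin_r : lin4 a b c d r = cst kap * recenter rho p.
Local Notation lin4 := (lin4 a b c d).
Local Notation lin2 := (lin2 a b c d).
Variable s : nat -> approx R.
Hypothesis hs : forall k,
   [/\ admissible (s k), Filt (@w4) (k + 7) (defect r (s k)) & close (k + 5) (s k) (s k.+1)].

Let QF k := lin2 (aF (s k)).
Let QG k := lin2 (aG (s k)).
Let Qphi k := mvar C 0 * mvar C 1 + aphi (s k).
Let QU k := cst kap * lin4 (aU (s k)).
Let F := fps_lim QF.
Let G := fps_lim QG.
Let phi := fps_lim Qphi.
Let U := fps_lim QU.

Lemma w2_le i : (w2 i <= 2 * unit_weight i)%N. Proof. by move: i; apply: ord2P. Qed.
Lemma w3_le i : (w3 i <= 2 * unit_weight i)%N. Proof. by move: i; apply: ord3P. Qed.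
Lemma w4_le i : (w4 i <= 2 * unit_weight i)%N. Proof. by move: i; apply: ord4P. Qed.

Lemma lin2B x y : lin2 (x - y) = lin2 x - lin2 y. Proof. exact: rmorphB. Qed.

Lemma QF_lim N k : (2 * N <= k)%N -> Filt (@unit_weight 2) N (trunc N F - QF k).
Proof.
apply: fps_limP => j; rewrite /QF -lin2B; apply: Filt_lin2.
have [_ _ h] := hs j; apply: (Filt_change_weight w2_le _ (clF h)); lia.
Qed.
Lemma QG_lim N k : (2 * N <= k)%N -> Filt (@unit_weight 2) N (trunc N G - QG k).
Proof.
apply: fps_limP => j; rewrite /QG -lin2B; apply: Filt_lin2.
have [_ _ h] := hs j; apply: (Filt_change_weight w2_le _ (clG h)); lia.
Qed.
Lemma Qphi_lim N k : (2 * N <= k)%N -> Filt (@unit_weight 3) N (trunc N phi - Qphi k).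
Proof.
apply: fps_limP => j; rewrite /Qphi opprD addrACA subrr add0r.
have [_ _ h] := hs j; apply: (Filt_change_weight w3_le _ (clphi h)); lia.
Qed.
Lemma QU_lim N k : (2 * N <= k)%N -> Filt (@unit_weight 4) N (trunc N U - QU k).
Proof.
apply: fps_limP => j; rewrite /QU -mulrBr -lin4B; apply/FiltMl/Filt_lin4.
have [_ _ h] := hs j; apply: (Filt_change_weight w4_le _ (clU h)); lia.
Qed.

Lemma QF_linear k : Filt (@unit_weight 2) 2 (QF k - (mpolyC 2 a * mvar C 0 + mpolyC 2 b * mvar C 1)).
Proof.
have -> : mpolyC 2 a * mvar C 0 + mpolyC 2 b * mvar C 1 = lin2 (mvar C 0).
  by rewrite /lin2 comp_mvar.
rewrite -lin2B; apply: Filt_lin2.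
have [h _ _] := hs k; exact: (Filt_change_weight w2_le _ (adF h)).
Qed.
Lemma QG_linear k : Filt (@unit_weight 2) 2 (QG k - (mpolyC 2 c * mvar C 0 + mpolyC 2 d * mvar C 1)).
Proof.
have -> : mpolyC 2 c * mvar C 0 + mpolyC 2 d * mvar C 1 = lin2 (mvar C 1).
  by rewrite /lin2 comp_mvar.
rewrite -lin2B; apply: Filt_lin2.
have [h _ _] := hs k; exact: (Filt_change_weight w2_le _ (adG h)).
Qed.

Lemma coef_Filt n N m (x y : mpoly n C) : Filt (@unit_weight n) N (x - y) -> (mdeg m < N)%N ->
  mcoeff m x = mcoeff m y.
Proof.
by move=> /Filt_deg h /h; rewrite mcoeffB => /eqP; rewrite subr_eq0 => /eqP.
Qed.

Lemma QF_low k : Filt (@unit_weight 2) 1 (QF k).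
Proof.
have [h _] := Filt_l01 a b c d.
rewrite -[QF k](subrK (mpolyC 2 a * mvar C 0 + mpolyC 2 b * mvar C 1)); apply: FiltD; last exact: h.
by apply: FiltW (@QF_linear k).
Qed.
Lemma QG_low k : Filt (@unit_weight 2) 1 (QG k).
Proof.
have [_ h] := Filt_l01 a b c d.
rewrite -[QG k](subrK (mpolyC 2 c * mvar C 0 + mpolyC 2 d * mvar C 1)); apply: FiltD; last exact: h.
by apply: FiltW (@QG_linear k).
Qed.

Lemma lim_formal_coordinates : formal_coordinates F G.
Proof.
have [ea eb ec ed] := lin2_coef a b c d.
split.
- by have /Filt_deg h := QF_low (2 * (mdeg (@mnm0 2)).+1); apply: h; rewrite mdeg0.
- by have /Filt_deg h := QG_low (2 * (mdeg (@mnm0 2)).+1); apply: h; rewrite mdeg0.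
have hF i : F (mnm1 i) = mcoeff (mnm1 i) (mpolyC 2 a * mvar C 0 + mpolyC 2 b * mvar C 1).
  by apply: (coef_Filt (QF_linear _)); rewrite mdeg1.
have hG i : G (mnm1 i) = mcoeff (mnm1 i) (mpolyC 2 c * mvar C 0 + mpolyC 2 d * mvar C 1).
  by apply: (coef_Filt (QG_linear _)); rewrite mdeg1.
by rewrite !hF !hG ea eb ec ed.
Qed.

Lemma lin4_defect x : lin4 (defect r x) = im (hol (lin2 (aG x)))
  - (hol (lin2 (aF x)) * bar (hol (lin2 (aF x)))
     + phi_at (hol (lin2 (aF x))) (hol (lin2 (aG x))) (aphi x))
  - cst kap * lin4 (aU x) * recenter rho p.
Proof.
have eF : lin4 (hol (aF x)) = hol (lin2 (aF x)) := lin4_hol _ _ _ _ _.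
have eG : lin4 (hol (aG x)) = hol (lin2 (aG x)) := lin4_hol _ _ _ _ _.
have e1 : lin4 (im (hol (aG x))) = im (hol (lin2 (aG x))) :=
  etrans (lin4_im _ _ _ _ _) (congr1 (@im R) eG).
have e2 : lin4 (hol (aF x) * bar (hol (aF x))) = hol (lin2 (aF x)) * bar (hol (lin2 (aF x))) :=
  etrans (lin4M _ _ _ _ _ _) (congr2 *%R eF (etrans (lin4_bar _ _ _ _ _) (congr1 (@bar R) eF))).
have e3 : lin4 (phi_at (hol (aF x)) (hol (aG x)) (aphi x)) =
    phi_at (hol (lin2 (aF x))) (hol (lin2 (aG x))) (aphi x) :=
  etrans (lin4_phi_at _ _ _ _ _ _ _) (congr2 (fun y z => phi_at y z (aphi x)) eF eG).
have e4 : lin4 (aU x * r) = cst kap * lin4 (aU x) * recenter rho p.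
  rewrite lin4M lin_r mulrCA; exact: mulrA.
clear eF eG.
rewrite /defect lin4B lin4B lin4D e1 e2 e3 e4; exact: erefl.
Qed.

(** Modulo degree N the limit is compared with stage 2 N, whose defect has degree at
    least N and which differs from the limit in degrees at least N only. *)
Lemma lim_given_by : given_by rho p F G (fun k l j => phi (mn3 k l j)).
Proof.
exists U.
  have [h _ _] := hs (2 * (mdeg (@mnm0 4)).+1).
  rewrite /U /fps_lim /QU mcoeffCM mulf_neq0 //.
  have hU1 : Filt (@unit_weight 4) 1 (lin4 (aU (s (2 * (mdeg (@mnm0 4)).+1))) - 1).
    have -> : 1 = lin4 1 by rewrite rmorph1.
    rewrite -lin4B; apply: Filt_lin4; exact: (Filt_change_weight w4_le _ (adU h)).
  by rewrite (coef_Filt hU1) ?mdeg0 // mcoeff1 eqxx oner_neq0.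
have ephi : phi_fps (fun k l j => phi (mn3 k l j)) = phi.
  by apply: funext => m; rewrite /phi_fps -mn3E.
move=> N f fb g gb im_g re_g.
have efb : fb = bar (hol (trunc N F)) := antihol_truncE N F.
have ei : im_g = im (hol (trunc N G)).
  exact: etrans (congr1 (fun x => (2%:R * (0 +i* 1))^-1 *: (g - x)) (antihol_truncE N G)) (im_scaled _).
have er : re_g = re (hol (trunc N G)).
  exact: etrans (congr1 (fun x => 2%:R^-1 *: (g + x)) (antihol_truncE N G)) (re_scaled _).
suff h : Filt (@unit_weight 4) N (im (hol (trunc N G)) - phi_at (hol (trunc N F)) (hol (trunc N G)) (trunc N phi)
   - trunc N U * recenter rho p).
  by rewrite ei er efb ephi => m hm; exact: (coef_Filt h hm).
move=> {ei er efb ephi f fb g gb im_g re_g}.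
pose k := (2 * N)%N.
have hk : (2 * N <= k)%N by [].
have [adk dk _] := hs k.
have e := lin4_defect (s k); rewrite -/(QF k) -/(QG k) -/(QU k) in e.
have e' : phi_at (hol (QF k)) (hol (QG k)) (Qphi k) =
   hol (QF k) * bar (hol (QF k)) + phi_at (hol (QF k)) (hol (QG k)) (aphi (s k)).
  rewrite /Qphi; apply: etrans (rmorphD _ _ _) _; congr (_ + _).
  apply: etrans (rmorphM _ _ _) _.
  exact: (congr2 *%R (phi_at_0 _ _) (phi_at_1 _ _)).
pose X := im (hol (QG k)); pose t := QU k * recenter rho p.
pose ee := phi_at (hol (QF k)) (hol (QG k)) (trunc N phi).
rewrite (limit_ring _ _ _ ee X (hol (QF k) * bar (hol (QF k)))
  (phi_at (hol (QF k)) (hol (QG k)) (aphi (s k))) t).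
apply: FiltB.
  apply: FiltB.
    apply: FiltB.
      apply: FiltD.
        rewrite -e; apply: Filt_lin4.
        apply: (Filt_change_weight w4_le _ dk); rewrite /k; lia.
      rewrite -imB -holB; apply/Filt_deg_im/Filt_deg_hol; exact: (QG_lim hk).
    (* weights 0 for the variables of phi: a perturbation of its arguments in degree N
       changes the composite in degree N *)
    rewrite -[N]add0n; apply: (@Filt_compB _ _ _ (fun=> 0%N) (@unit_weight 4)).
    - by move=> i; apply: Filt_all.
    - apply: ord3P; rewrite /= add0n.
      + by rewrite -holB; apply: Filt_deg_hol; exact: (QF_lim hk).
      + by rewrite -barB -holB; apply/Filt_deg_bar/Filt_deg_hol; exact: (QF_lim hk).
      + by rewrite -reB -holB; apply/Filt_deg_re/Filt_deg_hol; exact: (QG_lim hk).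
    - exact: Filt_all.
  rewrite -e' -(rmorphB (comp_mpoly _)).
  apply: (Filt_comp _ (Qphi_lim hk)); apply: ord3P; rewrite /= /unit_weight.
  - exact: (Filt_deg_hol (QF_low k)).
  - exact: (Filt_deg_bar (Filt_deg_hol (QF_low k))).
  - exact: (Filt_deg_re (Filt_deg_hol (QG_low k))).
rewrite limit_mul_ring; apply: FiltMr; exact: (QU_lim hk).
Qed.

Lemma mdeg_mn3 k l j : mdeg (mn3 k l j) = (k + l + j)%N.
Proof. by rewrite mdegE !big_ord_recl big_ord0 /= addn0 addnA. Qed.

Lemma phi_coef k l j : exists x : approx R, [/\ admissible x,
  phi (mn3 k l j) = [&& 1 == k, 1 == l & 0 == j]%N%:R + mcoeff (mn3 k l j) (aphi x)
  & phi (mn3 l k j) = [&& 1 == l, 1 == k & 0 == j]%N%:R + mcoeff (mn3 l k j) (aphi x)].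
Proof.
have e01 : mvar C 0 * mvar C 1 = mpolyX C (mn3 1 1 0).
  by rewrite mpolyX3 !expr1 expr0 mulr1.
exists (s (2 * (k + l + j).+1)); have [h _ _] := hs (2 * (k + l + j).+1); split=> //.
  by rewrite /phi /fps_lim mdeg_mn3 /Qphi mcoeffD e01 mcoeffX mn3_eq.
by rewrite /phi /fps_lim mdeg_mn3 /Qphi mcoeffD e01 mcoeffX mn3_eq [(l + k)%N]addnC.
Qed.

Lemma phi_normal k l : ~~ normal_idx k l -> ~~ ((1 == k) && (1 == l))%N ->
  (fun j => phi (mn3 k l j)) = constant_series 0.
Proof.
move=> hn h1; apply: funext => j; have [x [/adphi[_ _ h] -> _]] := phi_coef k l j.
rewrite h // addr0 andbA (negbTE h1) /constant_series.
by case: (j == 0)%N.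
Qed.

Lemma lim_normal_form : normal_form (fun k l j => phi (mn3 k l j)).
Proof.
split.
- move=> k l j; have [x [/adphi[_ h _] -> ->]] := phi_coef k l j.
  by rewrite h rmorphD rmorph_nat andbCA.
- apply: funext => j; have [x [/adphi[_ _ h] -> _]] := phi_coef 1 1 j.
  by rewrite h // addr0 eq_sym /constant_series /=; case: (j == 0)%N.
- by move=> k; apply: phi_normal.
- by move=> k hk; apply: phi_normal => //; rewrite /= eq_sym; case: k hk => [|[|k]].
- by split; apply: phi_normal.
Qed.

Lemma lim_umbilical : umbilical rho p.
Proof.
exists F, G, (fun k l j => phi (mn3 k l j)); split.
- exact: lim_formal_coordinates.
- exact: lim_normal_form.
- exact: lim_given_by.
- have [x [hx -> _]] := phi_coef 2 4 0.
  by rewrite (adphi7 hx) ?addr0 // wt_mn3.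
Qed.

End UmbilicalLimit.

(** The corrections of phi have weight at least 7, and z^2 zbar^4 has weight 6. *)
Lemma umbilical_of_approx (R : realType) (a b c d kap : R[i]) (rho r : mpoly 4 R[i]) p x0 :
  a * d - b * c != 0 -> kap != 0 -> bar r = r -> Filt (@w4) 3 (r - quadric R) ->
  lin4 a b c d r = mpolyC 4 kap * recenter rho p ->
  admissible x0 -> Filt (@w4) 7 (defect r x0) -> umbilical rho p.
Proof.
move=> hdet hk br hr hlin h0 d0.
have [s hs] := approx_sequence br hr h0 d0.
exact: (lim_umbilical hdet hk hlin hs).
Qed.

(** * Osculation at a point with isotropic complex tangent *)

Section Osculation.
Variable T : comNzRingType.
Variables I q e k z w : T.
(** Here q z + e w is the linear factor h, and osc_w is the function omega = w (1 + h).
    osc_d is 1 / (1 + i omega) up to weight 7. osc_g and osc_f absorb the remaining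
    terms: with x = w h, the summand 2 i (w x + x^2) of osc_g has imaginary part
    2 Re (w x + x^2), and the summands with k = |q|^2 remove k |z|^2 |w|^2 by way of
    |z|^2 |w|^2 = Im w^3 - 2 |z|^2 Re w^2 on the model. osc_f collects the terms that
    come with a factor zbar. *)
Definition osc_h := q * z + e * w.
Definition osc_w := w * (1 + osc_h).
Definition osc_d := 1 - I * osc_w - osc_w ^+ 2 + I * osc_w ^+ 3.
Definition osc_g := 2%:R * I * (w * (w * osc_h) + (w * osc_h) ^+ 2) - k * w ^+ 3.
Definition osc_f := 2%:R * I * (z * (w * osc_h)) - k * (z * w ^+ 2).
Definition osc_G := osc_d * (osc_w + osc_g).
Definition osc_F := osc_d * (z + osc_f).
End Osculation.

Section OsculationRing.
Variable T : comNzRingType.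

(** The effect of the division by 1 + i omega: 1 - omega^4 = (1 + i omega) d is used to
    pull d and its conjugate out, up to terms with a factor omega^4. *)
Lemma osc_inversion_ring (I om omb G G' F F' U r : T) : I * I = -1 ->
  let d := 1 - I * om - om ^+ 2 + I * om ^+ 3 in
  let d' := 1 - (- I) * omb - omb ^+ 2 + (- I) * omb ^+ 3 in
  - I * (d * G - d' * G') - 2%:R * (d * F) * (d' * F') - d * d' * U * r
  = - I * (d * G * omb ^+ 4 - d' * G' * om ^+ 4)
    + d * d' * (- I * (G * (1 - I * omb) - G' * (1 + I * om)) - 2%:R * F * F' - U * r).
Proof. by move=> h d d'; rewrite /d /d'; ring: h. Qed.

Lemma osc_absorption_ring (I z w z' w' h h' k : T) : I * I = -1 ->
  let om := w * (1 + h) in let om' := w' * (1 + h') in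
  let g := 2%:R * I * (w * (w * h) + (w * h) ^+ 2) - k * w ^+ 3 in
  let g' := 2%:R * (- I) * (w' * (w' * h') + (w' * h') ^+ 2) - k * w' ^+ 3 in
  let f := 2%:R * I * (z * (w * h)) - k * (z * w ^+ 2) in
  let f' := 2%:R * (- I) * (z' * (w' * h')) - k * (z' * w' ^+ 2) in
  let S := w ^+ 2 + w' ^+ 2 + w * w' in
  - I * ((om + g) * (1 - I * om') - (om' + g') * (1 + I * om)) - 2%:R * (z + f) * (z' + f')
  - (1 + (2%:R * I * (w * h - w' * h') - k * S))
    * (- I * (om - om') - 2%:R * (z * z') - 2%:R * (w * w'))
  = - (g * om' + g' * om) - 2%:R * (f * f') + 4%:R * I * ((w * h - w' * h') * (w * w'))
    + 2%:R * (w * w' * (h * h' - k * (z * z')))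
    - k * ((2%:R * (w * w') + I * (w * h - w' * h')) * S).
Proof. by move=> hI om om' g g' f f' S; rewrite /om /om' /g /g' /f /f' /S; ring: hI. Qed.

Lemma hermitian_product_ring (q e q' e' z w z' w' : T) :
  (q * z + e * w) * (q' * z' + e' * w') - q * q' * (z * z')
  = q * z * (e' * w') + e * w * (q' * z' + e' * w').
Proof. ring. Qed.

Lemma osc_U_sub1_ring (d d' y : T) : d * d' * (1 + y) - 1 = (d - 1) * (d' * (1 + y)) + (d' - 1) * (1 + y) + y.
Proof. ring. Qed.
Lemma osc_F_subz_ring (d z f : T) : d * (z + f) - z = (d - 1) * z + d * f.
Proof. ring. Qed.
Lemma osc_G_subw_ring (d w h g : T) : d * (w * (1 + h) + g) - w = (d - 1) * (w * (1 + h)) + w * h + d * g.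
Proof. ring. Qed.
Lemma osc_d_sub1_ring (I om : T) : 1 - I * om - om ^+ 2 + I * om ^+ 3 - 1 = om * (- I - om + I * om ^+ 2).
Proof. ring. Qed.
Lemma osc_w_subw_ring (w h : T) : w * (1 + h) - w = w * h.
Proof. ring. Qed.
Lemma osc_U_swap_ring (d d' I x x' k w w' : T) :
  d' * d * (1 + (2%:R * - I * (x' - x) - k * (w' ^+ 2 + w ^+ 2 + w' * w)))
  = d * d' * (1 + (2%:R * I * (x - x') - k * (w ^+ 2 + w' ^+ 2 + w * w'))).
Proof. ring. Qed.
End OsculationRing.

Section OsculationFilt.
Variables (K : comNzRingType) (n : nat) (v : 'I_n -> nat).
Variables I q e k z w : mpoly n K.
Hypothesis hz : Filt v 1 z.
Hypothesis hw : Filt v 2 w.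

Lemma Filt_osc_h : Filt v 1 (osc_h q e z w).
Proof. by apply: FiltD; apply: FiltMl => //; apply: FiltW hw. Qed.
Lemma Filt_osc_x : Filt v 3 (w * osc_h q e z w).
Proof. by apply: (@FiltM _ _ _ 2 1) => //; apply: Filt_osc_h. Qed.
Lemma Filt_osc_w : Filt v 2 (osc_w q e z w).
Proof. exact: FiltMr. Qed.
Lemma Filt_osc_d : Filt v 2 (osc_d I q e z w - 1).
Proof. by rewrite /osc_d osc_d_sub1_ring; apply/FiltMr/Filt_osc_w. Qed.
Lemma Filt_osc_g : Filt v 5 (osc_g I q e k z w).
Proof.
apply: FiltB; last by apply/FiltMl/(@FiltW _ _ _ _ 6) => //; apply: (@FiltX _ _ _ 2 3).
apply: FiltMl; apply: FiltD; first by apply: (@FiltM _ _ _ 2 3) => //; apply: Filt_osc_x.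
by apply: (@FiltW _ _ _ _ 6) => //; apply: (@FiltX _ _ _ 3 2); apply: Filt_osc_x.
Qed.
Lemma Filt_osc_f : Filt v 4 (osc_f I q e k z w).
Proof.
apply: FiltB; apply: FiltMl; first by apply: (@FiltM _ _ _ 1 3) => //; apply: Filt_osc_x.
by apply: (@FiltW _ _ _ _ 5) => //; apply: (@FiltM _ _ _ 1 4) => //; apply: (@FiltX _ _ _ 2 2).
Qed.
Lemma Filt_osc_F : Filt v 3 (osc_F I q e k z w - z).
Proof.
rewrite /osc_F osc_F_subz_ring; apply: FiltD.
  by apply: (@FiltM _ _ _ 2 1) => //; apply: Filt_osc_d.
by apply: FiltMl; apply: FiltW Filt_osc_f.
Qed.
Lemma Filt_osc_G : Filt v 3 (osc_G I q e k z w - w).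
Proof.
rewrite /osc_G /osc_w osc_G_subw_ring; apply: FiltD; last by apply: FiltMl; apply: FiltW Filt_osc_g.
apply: FiltD; last exact: Filt_osc_x.
apply: (@FiltW _ _ _ _ 4) => //; apply: (@FiltM _ _ _ 2 2); [exact: Filt_osc_d | exact: Filt_osc_w].
Qed.
End OsculationFilt.

Section OsculationIdentity.
Variable T : comNzRingType.
Variables I q e q' e' k z w z' w' : T.
(** Primed letters stand for conjugates. osc_U is the unit by which the defining function
    gets multiplied, and osc_r is twice the defining function
    Im omega - |z|^2 - |w|^2, which avoids denominators. *)
Definition osc_x := w * osc_h q e z w - w' * osc_h q' e' z' w'.
Definition osc_s := w ^+ 2 + w' ^+ 2 + w * w'.
Definition osc_U := osc_d I q e z w * osc_d (- I) q' e' z' w' * (1 + (2%:R * I * osc_x - k * osc_s)).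
Definition osc_r := - I * (osc_w q e z w - osc_w q' e' z' w') - 2%:R * (z * z') - 2%:R * (w * w').

(** The right-hand side consists of products of weight at least 7. In it
    q z e' w' + e w h' is what is left of |h|^2 - k |z|^2. *)
Lemma osc_identity : I * I = -1 -> k = q * q' ->
  - I * (osc_G I q e k z w - osc_G (- I) q' e' k z' w')
  - 2%:R * (osc_F I q e k z w * osc_F (- I) q' e' k z' w') - osc_U * osc_r =
  - I * (osc_G I q e k z w * osc_w q' e' z' w' ^+ 4 - osc_G (- I) q' e' k z' w' * osc_w q e z w ^+ 4)
  + osc_d I q e z w * osc_d (- I) q' e' z' w' *
   (- (osc_g I q e k z w * osc_w q' e' z' w' + osc_g (- I) q' e' k z' w' * osc_w q e z w)
    - 2%:R * (osc_f I q e k z w * osc_f (- I) q' e' k z' w')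
    + 4%:R * I * (osc_x * (w * w'))
    + 2%:R * (w * w' * (q * z * (e' * w') + e * w * osc_h q' e' z' w'))
    - k * ((2%:R * (w * w') + I * osc_x) * osc_s)).
Proof.
move=> hI hk.
have h1 := osc_inversion_ring (osc_w q e z w) (osc_w q' e' z' w') (osc_w q e z w + osc_g I q e k z w)
  (osc_w q' e' z' w' + osc_g (- I) q' e' k z' w') (z + osc_f I q e k z w) (z' + osc_f (- I) q' e' k z' w')
  (1 + (2%:R * I * osc_x - k * osc_s)) osc_r hI.
have h2 := osc_absorption_ring z w z' w' (osc_h q e z w) (osc_h q' e' z' w') k hI.
have h3 := hermitian_product_ring q e q' e' z w z' w'; rewrite -hk in h3.
rewrite mulrA; apply: etrans h1 _; congr (_ + _ * _).
rewrite -h3; exact: h2.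
Qed.
End OsculationIdentity.

Section OsculationRemainder.
Variables (K : comNzRingType) (n : nat) (v : 'I_n -> nat).
Variables I q e q' e' k z w z' w' : mpoly n K.
Hypothesis hz : Filt v 1 z.
Hypothesis hw : Filt v 2 w.
Hypothesis hz' : Filt v 1 z'.
Hypothesis hw' : Filt v 2 w'.

Lemma Filt_osc_xx : Filt v 3 (osc_x q e q' e' z w z' w').
Proof. by apply: FiltB; apply: Filt_osc_x. Qed.

Lemma Filt_osc_s : Filt v 4 (osc_s w w').
Proof.
apply: FiltD; last exact: (@FiltM _ _ _ 2 2).
by apply: FiltD; apply: (@FiltX _ _ _ 2 2).
Qed.

Lemma Filt_osc_U : Filt v 1 (osc_U I q e q' e' k z w z' w' - 1).
Proof.
rewrite /osc_U osc_U_sub1_ring; apply: FiltD; first apply: FiltD.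
- by apply: FiltMr; exact: (@FiltW _ _ v 1 2 _ isT (@Filt_osc_d _ _ v I q e z w hw)).
- by apply: FiltMr; exact: (@FiltW _ _ v 1 2 _ isT (@Filt_osc_d _ _ v (- I) q' e' z' w' hw')).
- by apply: FiltB; apply: FiltMl; [apply: FiltW Filt_osc_xx | apply: FiltW Filt_osc_s].
Qed.

Lemma Filt_osc_remainder : I * I = -1 -> k = q * q' ->
  Filt v 7 (- I * (osc_G I q e k z w - osc_G (- I) q' e' k z' w')
   - 2%:R * (osc_F I q e k z w * osc_F (- I) q' e' k z' w')
   - osc_U I q e q' e' k z w z' w' * osc_r I q e q' e' z w z' w').
Proof.
move=> hI hk; rewrite osc_identity //.
have hww : Filt v 4 (w * w') by apply: (@FiltM _ _ _ 2 2).
have hom := @Filt_osc_w _ _ v q e z w hw; have hom' := @Filt_osc_w _ _ v q' e' z' w' hw'.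
apply: FiltD.
  apply: FiltMl; apply: FiltB; apply: FiltMl; apply: (@FiltW _ _ _ _ 8) => //.
    exact: (@FiltX _ _ _ 2 4).
  exact: (@FiltX _ _ _ 2 4).
apply: FiltMl; apply: FiltB; last first.
  apply: FiltMl; apply: (@FiltM _ _ _ 3 4); last exact: Filt_osc_s.
  apply: FiltD; apply: FiltMl; last exact: Filt_osc_xx.
  exact: FiltW hww.
apply: FiltD; last first.
  apply: FiltMl; apply: (@FiltM _ _ _ 4 3) => //; apply: FiltD.
    by apply: (@FiltM _ _ _ 1 2); apply: FiltMl.
  by apply: (@FiltM _ _ _ 2 1); [apply: FiltMl | apply: Filt_osc_h].
apply: FiltD; last by apply: FiltMl; apply: (@FiltM _ _ _ 3 4) => //; apply: Filt_osc_xx.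
apply: FiltB; last first.
  by apply: FiltMl; apply: (@FiltW _ _ _ _ 8) => //; apply: (@FiltM _ _ _ 4 4); apply: Filt_osc_f.
apply: FiltN; apply: FiltD; apply: (@FiltM _ _ _ 5 2) => //; exact: Filt_osc_g.
Qed.
End OsculationRemainder.

Lemma defect2_ring (T : comNzRingType) (ig f r U : T) :
  2%:R * (ig - (f + 0) - U * r) = 2%:R * ig - 2%:R * f - U * (2%:R * r).
Proof. ring. Qed.
Lemma r2_ring (T : comNzRingType) (iw a b : T) :
  2%:R * (iw - a - b) = 2%:R * iw - 2%:R * a - 2%:R * b.
Proof. ring. Qed.
Lemma rquad_ring (T : comNzRingType) (iw iw' a b : T) :
  iw - a - b - (iw' - a) = (iw - iw') - b.
Proof. ring. Qed.

Section OsculationMorph.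
Variable R : realType.
Local Notation A := (mpoly 4 R[i]).
Local Notation B := (mpoly 2 R[i]).

Lemma bar_osc_w (q e z w : A) : bar (osc_w q e z w) = osc_w (bar q) (bar e) (bar z) (bar w).
Proof. by rewrite /osc_w /osc_h barM !barD !barM rmorph1. Qed.
Lemma bar_osc_x (q e z w : A) :
  bar (w * osc_h q e z w) = bar w * osc_h (bar q) (bar e) (bar z) (bar w).
Proof. by rewrite /osc_h barM barD !barM. Qed.
Lemma bar_osc_d (I q e z w : A) : bar (osc_d I q e z w) = osc_d (bar I) (bar q) (bar e) (bar z) (bar w).
Proof. by rewrite /osc_d barD !barB (barX _ 2) !(barM I) (barX _ 3) bar_osc_w rmorph1. Qed.
Lemma bar_osc_F (I q e k z w : A) :
  bar (osc_F I q e k z w) = osc_F (bar I) (bar q) (bar e) (bar k) (bar z) (bar w).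
Proof.
rewrite /osc_F /osc_f barM bar_osc_d barD barB; congr (_ * (_ + (_ - _))).
  by rewrite (barM (2%:R * I)) (barM 2%:R I) rmorph_nat (barM z) bar_osc_x.
by rewrite !(barM k) ?(barM z) (barX w).
Qed.
Lemma bar_osc_G (I q e k z w : A) :
  bar (osc_G I q e k z w) = osc_G (bar I) (bar q) (bar e) (bar k) (bar z) (bar w).
Proof.
rewrite /osc_G /osc_g barM bar_osc_d barD bar_osc_w barB; congr (_ * (_ + (_ - _))).
  by rewrite (barM (2%:R * I)) (barM 2%:R I) rmorph_nat barD (barM w) (barX _ 2) !bar_osc_x.
by rewrite !(barM k) ?(barM z) (barX w).
Qed.

Lemma holX p n : hol (p ^+ n) = hol p ^+ n :> A. Proof. exact: rmorphXn. Qed.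
Lemma hol_osc_w (q e z w : B) : hol (osc_w q e z w) = osc_w (hol q) (hol e) (hol z) (hol w).
Proof. by rewrite /osc_w /osc_h holM !holD !holM rmorph1. Qed.
Lemma hol_osc_x (q e z w : B) :
  hol (w * osc_h q e z w) = hol w * osc_h (hol q) (hol e) (hol z) (hol w).
Proof. by rewrite /osc_h holM holD !holM. Qed.
Lemma hol_osc_d (I q e z w : B) : hol (osc_d I q e z w) = osc_d (hol I) (hol q) (hol e) (hol z) (hol w).
Proof. by rewrite /osc_d holD !holB (holX _ 2) !(holM I) (holX _ 3) hol_osc_w rmorph1. Qed.
Lemma hol_osc_F (I q e k z w : B) :
  hol (osc_F I q e k z w) = osc_F (hol I) (hol q) (hol e) (hol k) (hol z) (hol w).
Proof.
rewrite /osc_F /osc_f holM hol_osc_d holD holB; congr (_ * (_ + (_ - _))).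
  by rewrite (holM (2%:R * I)) (holM 2%:R I) rmorph_nat (holM z) hol_osc_x.
by rewrite !(holM k) ?(holM z) (holX w).
Qed.
Lemma hol_osc_G (I q e k z w : B) :
  hol (osc_G I q e k z w) = osc_G (hol I) (hol q) (hol e) (hol k) (hol z) (hol w).
Proof.
rewrite /osc_G /osc_g holM hol_osc_d holD hol_osc_w holB; congr (_ * (_ + (_ - _))).
  by rewrite (holM (2%:R * I)) (holM 2%:R I) rmorph_nat holD (holM w) (holX _ 2) !hol_osc_x.
by rewrite !(holM k) ?(holM z) (holX w).
Qed.

Lemma bar_osc_U (I q e q' e' k z w z' w' : A) :
  bar I = - I -> bar q = q' -> bar q' = q -> bar e = e' -> bar e' = e -> bar k = k ->
  bar z = z' -> bar z' = z -> bar w = w' -> bar w' = w ->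
  bar (osc_U I q e q' e' k z w z' w') = osc_U I q e q' e' k z w z' w'.
Proof.
move=> hI hq hq' he he' hk hz hz' hw hw'.
have hx : bar (osc_x q e q' e' z w z' w') = osc_x q' e' q e z' w' z w.
  by rewrite /osc_x barB !bar_osc_x hq hq' he he' hz hz' hw hw'.
have hs : bar (osc_s w w') = osc_s w' w.
  by rewrite /osc_s barD barD (barX w) (barX w') (barM w) hw hw'.
have hi : bar (2%:R * I * osc_x q e q' e' z w z' w') = 2%:R * - I * osc_x q' e' q e z' w' z w.
  by rewrite (barM (2%:R * I)) (barM 2%:R I) rmorph_nat hI hx.
have hd : bar (osc_d I q e z w) = osc_d (- I) q' e' z' w' by rewrite bar_osc_d hI hq he hz hw.
have hd' : bar (osc_d (- I) q' e' z' w') = osc_d I q e z w.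
  rewrite bar_osc_d barN hI opprK hq' he' hz' hw'; exact: erefl.
have h1 : bar (1 + (2%:R * I * osc_x q e q' e' z w z' w' - k * osc_s w w')) =
    1 + (2%:R * - I * osc_x q' e' q e z' w' z w - k * osc_s w' w).
  rewrite barD rmorph1 barB hi (barM k) hk hs; exact: erefl.
have h2 := etrans (barM (osc_d I q e z w * osc_d (- I) q' e' z' w') _)
  (congr2 *%R (etrans (barM (osc_d I q e z w) (osc_d (- I) q' e' z' w')) (congr2 *%R hd hd')) h1).
apply: etrans h2 _; clear; exact: osc_U_swap_ring.
Qed.
End OsculationMorph.

Section OsculatedQuadric.
Variable R : realType.
Local Notation C := R[i].
Local Notation A := (mpoly 4 C).
Local Notation Z := (Zv R).
Local Notation W := (Wv R).
Local Notation Zc := (Zb R).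
Local Notation Wc := (Wb R).
Local Notation cst := (mpolyC 4).
Variables q e : C.
Let k : C := q * conjc q.
Let J := mpolyC 2 (iC R).
Let r : A := im (hol (osc_w (mpolyC 2 q) (mpolyC 2 e) (mvar C 0) (mvar C 1))) - Z * Zc - W * Wc.

Lemma two_im (p : A) : 2%:R * im p = - cst (iC R) * (p - bar p).
Proof.
rewrite /im mulrA; congr (_ * _).
have -> : 2%:R = cst 2 :> A by apply: esym; apply: mpolyC_nat.
rewrite -mpolyCM -mpolyCN; congr mpolyC.
by rewrite inv2i mulrN mulrCA divff ?pnatr_eq0 // mulr1.
Qed.

Lemma cstI2 : cst (iC R) * cst (iC R) = -1.
Proof. by rewrite -mpolyCM iC2 mpolyCN mpolyC1. Qed.

Lemma bar_cstI : bar (cst (iC R)) = - cst (iC R).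
Proof. by rewrite barC -mpolyCN; congr mpolyC; apply: conj_iC. Qed.

Lemma conj_k : conjc k = k.
Proof. by rewrite /k rmorphM /= conjcK mulrC. Qed.

Lemma hol_osc : [/\ hol (osc_w (mpolyC 2 q) (mpolyC 2 e) (mvar C 0) (mvar C 1)) = osc_w (cst q) (cst e) Z W,
  hol (osc_F J (mpolyC 2 q) (mpolyC 2 e) (mpolyC 2 k) (mvar C 0) (mvar C 1)) = osc_F (cst (iC R)) (cst q) (cst e) (cst k) Z W &
  hol (osc_G J (mpolyC 2 q) (mpolyC 2 e) (mpolyC 2 k) (mvar C 0) (mvar C 1)) = osc_G (cst (iC R)) (cst q) (cst e) (cst k) Z W].
Proof.
split.
- by rewrite hol_osc_w hol0 hol1 !holC.
- by rewrite hol_osc_F hol0 hol1 !holC.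
- by rewrite hol_osc_G hol0 hol1 !holC.
Qed.

Lemma bar_cstk : bar (cst k) = cst k.
Proof. by rewrite barC conj_k. Qed.

Lemma bar_osc : [/\ bar (osc_w (cst q) (cst e) Z W) = osc_w (cst (conjc q)) (cst (conjc e)) Zc Wc,
  bar (osc_F (cst (iC R)) (cst q) (cst e) (cst k) Z W) = osc_F (- cst (iC R)) (cst (conjc q)) (cst (conjc e)) (cst k) Zc Wc &
  bar (osc_G (cst (iC R)) (cst q) (cst e) (cst k) Z W) = osc_G (- cst (iC R)) (cst (conjc q)) (cst (conjc e)) (cst k) Zc Wc].
Proof.
split.
- by rewrite bar_osc_w bar_Z bar_W !barC.
- by rewrite bar_osc_F bar_Z bar_W bar_cstI bar_cstk !barC.
- by rewrite bar_osc_G bar_Z bar_W bar_cstI bar_cstk !barC.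
Qed.

Definition osc_approx : approx R := Approx
  (osc_F J (mpolyC 2 q) (mpolyC 2 e) (mpolyC 2 k) (mvar C 0) (mvar C 1))
  (osc_G J (mpolyC 2 q) (mpolyC 2 e) (mpolyC 2 k) (mvar C 0) (mvar C 1))
  0
  (osc_U (cst (iC R)) (cst q) (cst e) (cst (conjc q)) (cst (conjc e)) (cst k) Z W Zc Wc).

Lemma osc_r2 : 2%:R * r = osc_r (cst (iC R)) (cst q) (cst e) (cst (conjc q)) (cst (conjc e)) Z W Zc Wc.
Proof.
have [hw _ _] := hol_osc; have [bw _ _] := bar_osc.
by rewrite /r hw r2_ring two_im bw.
Qed.

Lemma defect2_gen (r0 : A) (x : approx R) (F G F' G' r2 : A) :
  hol (aF x) = F -> hol (aG x) = G -> bar F = F' -> bar G = G' ->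
  phi_at (hol (aF x)) (hol (aG x)) (aphi x) = 0 -> 2%:R * r0 = r2 ->
  2%:R * defect r0 x = - cst (iC R) * (G - G') - 2%:R * (F * F') - aU x * r2.
Proof.
move=> hF hG hF' hG' h0 <-; rewrite /defect h0 hF hG defect2_ring two_im hF' hG'.
exact: erefl.
Qed.

Lemma osc_hF : hol (aF osc_approx) = osc_F (cst (iC R)) (cst q) (cst e) (cst k) Z W.
Proof. by have [_ h _] := hol_osc; exact: h. Qed.
Lemma osc_hG : hol (aG osc_approx) = osc_G (cst (iC R)) (cst q) (cst e) (cst k) Z W.
Proof. by have [_ _ h] := hol_osc; exact: h. Qed.
Lemma osc_bF : bar (osc_F (cst (iC R)) (cst q) (cst e) (cst k) Z W) = osc_F (- cst (iC R)) (cst (conjc q)) (cst (conjc e)) (cst k) Zc Wc.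
Proof. by have [_ h _] := bar_osc; exact: h. Qed.
Lemma osc_bG : bar (osc_G (cst (iC R)) (cst q) (cst e) (cst k) Z W) = osc_G (- cst (iC R)) (cst (conjc q)) (cst (conjc e)) (cst k) Zc Wc.
Proof. by have [_ _ h] := bar_osc; exact: h. Qed.
Lemma osc_phi_at : phi_at (hol (aF osc_approx)) (hol (aG osc_approx)) (aphi osc_approx) = 0.
Proof. exact: rmorph0. Qed.

Lemma osc_defect2 : 2%:R * defect r osc_approx =
  - cst (iC R) * (osc_G (cst (iC R)) (cst q) (cst e) (cst k) Z W
                  - osc_G (- cst (iC R)) (cst (conjc q)) (cst (conjc e)) (cst k) Zc Wc)
  - 2%:R * (osc_F (cst (iC R)) (cst q) (cst e) (cst k) Z W
            * osc_F (- cst (iC R)) (cst (conjc q)) (cst (conjc e)) (cst k) Zc Wc)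
  - osc_U (cst (iC R)) (cst q) (cst e) (cst (conjc q)) (cst (conjc e)) (cst k) Z W Zc Wc
    * osc_r (cst (iC R)) (cst q) (cst e) (cst (conjc q)) (cst (conjc e)) Z W Zc Wc.
Proof.
exact: (defect2_gen osc_hF osc_hG osc_bF osc_bG osc_phi_at osc_r2).
Qed.

Lemma osc_defect : Filt (@w4) 7 (defect r osc_approx).
Proof.
have h : Filt (@w4) 7 (2%:R * defect r osc_approx).
  rewrite osc_defect2.
  apply: Filt_osc_remainder.
  - exact: Filt_Z.
  - exact: Filt_W.
  - exact: Filt_Zc.
  - exact: Filt_Wc.
  - exact: cstI2.
  - exact: mpolyCM.
have -> : defect r osc_approx = cst 2^-1 * (2%:R * defect r osc_approx).
  have -> : 2%:R = cst 2 :> A by apply: esym; apply: mpolyC_nat.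
  by rewrite mulrA -mpolyCM mulVf ?pnatr_eq0 // mpolyC1 mul1r.
exact: FiltMl.
Qed.

Lemma osc_admissible : admissible osc_approx.
Proof.
have h0 : Filt (@w2) 1 (mvar C 0) by apply: Filt_var.
have h1 : Filt (@w2) 2 (mvar C 1) by apply: Filt_var.
split.
- exact: Filt_osc_F.
- exact: Filt_osc_G.
- exact: cm_normal0.
- exact: Filt0.
- exact: (@Filt_osc_U _ _ _ _ _ _ _ _ _ _ _ _ _ (@Filt_Z R) (@Filt_W R) (@Filt_Zc R) (@Filt_Wc R)).
- apply: bar_osc_U.
  + exact: bar_cstI.
  + exact: barC.
  + by rewrite barC conjcK.
  + exact: barC.
  + by rewrite barC conjcK.
  + exact: bar_cstk.
  + exact: bar_Z.
  + exact: bar_Zc.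
  + exact: bar_W.
  + exact: bar_Wc.
Qed.

Lemma osc_bar_r : bar r = r.
Proof. by rewrite /r !barB bar_im !barM !barE [Zc * _]mulrC [Wc * _]mulrC. Qed.

Lemma osc_r_quadric : Filt (@w4) 3 (r - quadric R).
Proof.
rewrite /r /quadric rquad_ring; apply: FiltB; last first.
  by apply: (@FiltW _ _ _ _ 4) => //; apply: (@FiltM _ _ _ 2 2); [apply: Filt_W | apply: Filt_Wc].
have [hw _ _] := hol_osc; rewrite hw -imB; apply: Filt_im.
rewrite /osc_w osc_w_subw_ring; apply: Filt_osc_x; [exact: Filt_Z | exact: Filt_W].
Qed.

End OsculatedQuadric.

(** * Quadratic hypersurfaces in adapted linear coordinates *)

Section EllipsoidRing.
Variable T : comNzRingType.

Lemma recenter_ring (al P be Q z w z' w' a a' b b' f : T) :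
  al * (a ^+ 2 + a' ^+ 2) + P * (a * a') + be * (b ^+ 2 + b' ^+ 2) + Q * (b * b') - f = 0 ->
  al * ((z + a) ^+ 2 + (z' + a') ^+ 2) + P * ((z + a) * (z' + a'))
  + be * ((w + b) ^+ 2 + (w' + b') ^+ 2) + Q * ((w + b) * (w' + b')) - f =
  (2%:R * al * a + P * a') * z + (2%:R * al * a' + P * a) * z'
  + (2%:R * be * b + Q * b') * w + (2%:R * be * b' + Q * b) * w'
  + al * (z ^+ 2 + z' ^+ 2) + P * (z * z') + be * (w ^+ 2 + w' ^+ 2) + Q * (w * w').
Proof.
move=> h; rewrite -[RHS]addr0 -h; ring.
Qed.

(** The Hermitian form P |z|^2 + Q |w|^2 and the form al z^2 + be w^2, in coordinates
    adapted to the linear part L1 z + L2 w. *)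
Lemma linear_coord_ring (c s J J' P Q al be L1 L2 l1 l2 lam mu lam' mu' z w z' w' : T) :
  al = L1 * lam -> be = L2 * mu -> L1 * mu = - (L2 * lam) ->
  al = l1 * lam' -> be = l2 * mu' -> l1 * mu' = - (l2 * lam') ->
  s * s * (P * (L2 * l2) + Q * (L1 * l1)) = c -> J * J' = s * s * (P * Q) ->
  - c * ((L1 * z + L2 * w) * (1 + (lam * z + mu * w)))
  + - c * ((l1 * z' + l2 * w') * (1 + (lam' * z' + mu' * w')))
  - (s * P * l2 * z + - (s * Q * l1) * w) * (s * P * L2 * z' + - (s * Q * L1) * w')
  - (J * L1 * z + J * L2 * w) * (J' * l1 * z' + J' * l2 * w') =
  - c * (L1 * z + l1 * z' + L2 * w + l2 * w'
    + al * (z ^+ 2 + z' ^+ 2) + P * (z * z') + be * (w ^+ 2 + w' ^+ 2) + Q * (w * w')).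
Proof.
move=> h1 h2 h3 h4 h5 h6 hs hJ.
have e1 : (L1 * z + L2 * w) * (1 + (lam * z + mu * w)) =
  L1 * z + L2 * w + al * z ^+ 2 + be * w ^+ 2 + (L1 * mu + L2 * lam) * (z * w).
  by rewrite h1 h2; ring.
have e2 : (l1 * z' + l2 * w') * (1 + (lam' * z' + mu' * w')) =
  l1 * z' + l2 * w' + al * z' ^+ 2 + be * w' ^+ 2 + (l1 * mu' + l2 * lam') * (z' * w').
  by rewrite h4 h5; ring.
have e3 : (J * L1 * z + J * L2 * w) * (J' * l1 * z' + J' * l2 * w') =
  J * J' * ((L1 * z + L2 * w) * (l1 * z' + l2 * w')) by ring.
rewrite e1 e2 e3 h3 h6 hJ -hs; ring.
Qed.

Definition quadratic (al P be Q f z w z' w' : T) :=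
  al * (z ^+ 2 + z' ^+ 2) + P * (z * z') + be * (w ^+ 2 + w' ^+ 2) + Q * (w * w') - f.
End EllipsoidRing.

Lemma quadratic_morph (S T : comNzRingType) (g : {rmorphism S -> T}) al P be Q f z w z' w' :
  g (quadratic al P be Q f z w z' w') =
  quadratic (g al) (g P) (g be) (g Q) (g f) (g z) (g w) (g z') (g w').
Proof. by rewrite /quadratic !(rmorphD, rmorphB, rmorphM, rmorphXn, rmorphN). Qed.

Lemma det_ring (T : comNzRingType) (s P Q J L1 L2 l1 l2 : T) :
  s * P * l2 * (J * L2) - - (s * Q * l1) * (J * L1) = s * J * (P * (L2 * l2) + Q * (L1 * l1)).
Proof. ring. Qed.

Lemma cramer_solution (F : fieldType) (a b c d x y : F) : a * d - b * c != 0 ->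
  (x * d - y * c) / (a * d - b * c) * a + (y * a - x * b) / (a * d - b * c) * c = x /\
  (x * d - y * c) / (a * d - b * c) * b + (y * a - x * b) / (a * d - b * c) * d = y.
Proof. by move=> h; split; field. Qed.

Lemma osc_lin_ring (T : comNzRingType) (q e a b J L1 L2 lam mu z w : T) :
  q * a + e * (J * L1) = lam -> q * b + e * (J * L2) = mu ->
  osc_w q e (a * z + b * w) (J * L1 * z + J * L2 * w)
  = J * ((L1 * z + L2 * w) * (1 + (lam * z + mu * w))).
Proof. by move=> <- <-; rewrite /osc_w /osc_h; ring. Qed.

Lemma norm_J_ring (T : comNzRingType) (i t N : T) : i * i = -1 ->
  2%:R * i * - (t * N) * (2%:R * - i * - (t * N)) = t * (4%:R * (t * N * N)).
Proof. by move=> h; ring: h. Qed.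

Section EllipsoidUmbilical.
Variable R : realType.
Local Notation C := R[i].
Local Notation A := (mpoly 4 C).
Local Notation Z := (Zv R).
Local Notation W := (Wv R).
Local Notation Zc := (Zb R).
Local Notation Wc := (Wb R).
Local Notation cst := (mpolyC 4).

Lemma ellipsoid_quadratic (eps a b : R) :
  ellipsoid a b eps = quadratic (cst (eps * a)%:C) (cst (2 * (2 + eps * a))%:C)
    (cst (eps * b)%:C) (cst (2 * (2 + eps * b))%:C) (cst 4) Z W Zc Wc.
Proof. by rewrite /ellipsoid /quadratic !mul_mpolyC. Qed.

Lemma meval_vars (p : C * C) : [/\ meval (point4 p) Z = p.1, meval (point4 p) W = p.2,
  meval (point4 p) Zc = conjc p.1 & meval (point4 p) Wc = conjc p.2].
Proof. by split; rewrite mevalXU. Qed.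

Lemma recenter_vars (p : C * C) : [/\ recenter Z p = Z + cst p.1, recenter W p = W + cst p.2,
  recenter Zc p = Zc + cst (conjc p.1) & recenter Wc p = Wc + cst (conjc p.2)].
Proof. by split; rewrite /recenter comp_mvar tnth_mktuple. Qed.

Lemma recenterC c (p : C * C) : recenter (cst c) p = cst c.
Proof. exact: comp_mpolyC. Qed.

Lemma recenter_quadratic (al P be Q f : C) (p : C * C) :
  let rho := quadratic (cst al) (cst P) (cst be) (cst Q) (cst f) Z W Zc Wc in
  hypersurface rho p ->
  recenter rho p =
    cst (2%:R * al * p.1 + P * conjc p.1) * Z + cst (2%:R * al * conjc p.1 + P * p.1) * Zc
  + cst (2%:R * be * p.2 + Q * conjc p.2) * W + cst (2%:R * be * conjc p.2 + Q * p.2) * Wc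
  + cst al * (Z ^+ 2 + Zc ^+ 2) + cst P * (Z * Zc) + cst be * (W ^+ 2 + Wc ^+ 2) + cst Q * (W * Wc).
Proof.
move=> rho h.
have [m1 m2 m3 m4] := meval_vars p.
have h0 : quadratic al P be Q f p.1 p.2 (conjc p.1) (conjc p.2) = 0.
  rewrite -{}h /rho quadratic_morph /= m1 m2 m3 m4 !mevalC; exact: erefl.
have h1 : quadratic (cst al) (cst P) (cst be) (cst Q) (cst f) (cst p.1) (cst p.2) (cst (conjc p.1)) (cst (conjc p.2)) = 0.
  by rewrite -quadratic_morph h0 rmorph0.
have [r1 r2 r3 r4] := recenter_vars p.
rewrite /recenter quadratic_morph /= -!/(recenter _ p) r1 r2 r3 r4 !recenterC.
clear - h1.
apply: etrans (recenter_ring _ _ _ _ h1) _.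
have e2 : cst 2%:R = 2%:R :> A by apply: mpolyC_nat.
by rewrite !mpolyCD !mpolyCM e2.
Qed.

Lemma conjcD (x y : C) : conjc (x + y) = conjc x + conjc y. Proof. exact: rmorphD. Qed.
Lemma conjcM (x y : C) : conjc (x * y) = conjc x * conjc y. Proof. exact: rmorphM. Qed.

Lemma conjcN (x : C) : conjc (- x) = - conjc x. Proof. exact: rmorphN. Qed.

(** L1 z + L2 w is the holomorphic part of the differential at p. The hypotheses on lam
    and mu express that al z^2 + be w^2 is (L1 z + L2 w) (lam z + mu w), which is the
    isotropy of the complex tangent line. The new coordinates are
    zeta = s (P conj L2 z - Q conj L1 w) and eta = - 2 i c (L1 z + L2 w): they are
    orthogonal for P |z|^2 + Q |w|^2, and s, c are such that this form multiplied by c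
    becomes |zeta|^2 + |eta|^2. *)
Lemma umbilical_of_isotropic (al P be Q s N c L1 L2 : C) (rho : A) (p : C * C) (lam mu : C) :
  N = P * (L2 * conjc L2) + Q * (L1 * conjc L1) -> c = s * s * N ->
  conjc al = al -> conjc be = be -> conjc P = P -> conjc Q = Q -> conjc s = s ->
  al = L1 * lam -> be = L2 * mu -> L1 * mu = - (L2 * lam) ->
  s != 0 -> N != 0 -> 4%:R * (c * N) = P * Q ->
  recenter rho p = cst L1 * Z + cst (conjc L1) * Zc + cst L2 * W + cst (conjc L2) * Wc
    + cst al * (Z ^+ 2 + Zc ^+ 2) + cst P * (Z * Zc) + cst be * (W ^+ 2 + Wc ^+ 2) + cst Q * (W * Wc) ->
  umbilical rho p.
Proof.
move=> hN hc cal cbe cP cQ cs h1 h2 h3 s0 N0 hcN hrec.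
have cN : conjc N = N.
  rewrite hN !(conjcM, conjcD) cP cQ !conjcK.
  by rewrite [conjc L2 * _]mulrC [conjc L1 * _]mulrC.
have cc : conjc c = c by rewrite hc !conjcM cs cN.
have c0 : c != 0 by rewrite hc !mulf_neq0.
pose J := 2 * iC R * - c.
have J0 : J != 0 by rewrite /J !mulf_neq0 ?pnatr_eq0 ?iC_neq0 ?oppr_eq0.
pose a := s * P * conjc L2; pose b := - (s * Q * conjc L1); pose d1 := J * L1; pose d2 := J * L2.
have hdet : a * d2 - b * d1 = s * J * N.
  by rewrite /a /b /d1 /d2 hN; apply: det_ring.
have det0 : a * d2 - b * d1 != 0 by rewrite hdet; exact: (mulf_neq0 (mulf_neq0 s0 J0) N0).
pose q := (lam * d2 - mu * d1) / (a * d2 - b * d1).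
pose e := (mu * a - lam * b) / (a * d2 - b * d1).
have [hq he] := cramer_solution lam mu det0.
apply: (@umbilical_of_approx R a b d1 d2 (- c) rho _ p (osc_approx q e) det0 _
  (osc_bar_r q e) (osc_r_quadric q e) _ (osc_admissible q e) (osc_defect q e)).
  by rewrite oppr_eq0.
rewrite -/q -/e in hq he.
have {}hq : cst q * (cst s * cst P * cst (conjc L2)) + cst e * (cst J * cst L1) = cst lam.
  by rewrite -!mpolyCM -mpolyCD hq.
have {}he : cst q * - (cst s * cst Q * cst (conjc L1)) + cst e * (cst J * cst L2) = cst mu.
  by rewrite -!mpolyCM -mpolyCN -mpolyCM -mpolyCD he.
have e2 : hol (mpolyC 2 a * mvar C 0 + mpolyC 2 b * mvar C 1) = cst s * cst P * cst (conjc L2) * Z + - (cst s * cst Q * cst (conjc L1)) * W.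
  rewrite holD !holM !holC hol0 hol1 /a /b mpolyCN !mpolyCM; exact: erefl.
have e3 : hol (mpolyC 2 d1 * mvar C 0 + mpolyC 2 d2 * mvar C 1) = cst J * cst L1 * Z + cst J * cst L2 * W.
  rewrite holD !holM !holC hol0 hol1 /d1 /d2 !mpolyCM; exact: erefl.
have e4 : bar (cst s * cst P * cst (conjc L2) * Z + - (cst s * cst Q * cst (conjc L1)) * W) = cst s * cst P * cst L2 * Zc + - (cst s * cst Q * cst L1) * Wc.
  rewrite barD !(barM _ Z) !(barM _ W) barN -!mpolyCM !barC !conjcM !conjcK cs cP cQ bar_Z bar_W !mpolyCM.
  exact: erefl.
have e5 : bar (cst J * cst L1 * Z + cst J * cst L2 * W) = cst (conjc J) * cst (conjc L1) * Zc + cst (conjc J) * cst (conjc L2) * Wc.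
  rewrite barD !(barM _ Z) !(barM _ W) -!mpolyCM !barC !conjcM bar_Z bar_W !mpolyCM.
  exact: erefl.
have e0 : osc_w (cst q) (cst e) (cst s * cst P * cst (conjc L2) * Z + - (cst s * cst Q * cst (conjc L1)) * W)
     (cst J * cst L1 * Z + cst J * cst L2 * W) =
   cst J * ((cst L1 * Z + cst L2 * W) * (1 + (cst lam * Z + cst mu * W))).
  exact: osc_lin_ring hq he.
have e1 : lin4 a b d1 d2 (im (hol (osc_w (mpolyC 2 q) (mpolyC 2 e) (mvar C 0) (mvar C 1)))) =
   - cst c * ((cst L1 * Z + cst L2 * W) * (1 + (cst lam * Z + cst mu * W)))
   + - cst c * ((cst (conjc L1) * Zc + cst (conjc L2) * Wc) * (1 + (cst (conjc lam) * Zc + cst (conjc mu) * Wc))).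
  have [hw _ _] := hol_osc q e.
  have hl : lin4 a b d1 d2 (osc_w (cst q) (cst e) Z W) = osc_w (cst q) (cst e)
      (hol (mpolyC 2 a * mvar C 0 + mpolyC 2 b * mvar C 1)) (hol (mpolyC 2 d1 * mvar C 0 + mpolyC 2 d2 * mvar C 1)).
    rewrite /osc_w /osc_h lin4M lin4D rmorph1 lin4D !(lin4M _ _ _ _ (cst _)) !lin4C lin4_Z lin4_W.
    exact: erefl.
  rewrite lin4_im hw hl e2 e3 e0 /J im_2i barM barC conjcN cc mpolyCN.
  by congr (_ + _ * _); rewrite barM !barD rmorph1 !(barM (cst _)) !barC bar_Z bar_W.
clear e0 hq he.
rewrite lin4B lin4B (lin4M _ _ _ _ Z Zc) (lin4M _ _ _ _ W Wc) lin4_Z lin4_W lin4_Zc lin4_Wc e1 e2 e3 e4 e5 hrec mpolyCN.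
clear e1 e2 e3 e4 e5 det0 hdet.
have hJ : J * conjc J = s * s * (P * Q).
  rewrite /J !conjcM conj_iC conjc_nat conjcN cc -hcN hc; apply: norm_J_ring.
  exact: iC2.
apply: linear_coord_ring.
- by rewrite h1 mpolyCM.
- by rewrite h2 mpolyCM.
- by rewrite -!mpolyCM h3 mpolyCN.
- by rewrite -mpolyCM -conjcM -h1 cal.
- by rewrite -mpolyCM -conjcM -h2 cbe.
- by rewrite -!mpolyCM -!conjcM h3 conjcN mpolyCN.
- by rewrite -!mpolyCM -mpolyCD -mpolyCM hc hN.
- by rewrite -!mpolyCM hJ.
Qed.
End EllipsoidUmbilical.

(** * Points of the ellipsoid *)

Section EllipsoidPoints.
Variable R : realType.
Local Notation C := R[i].

Lemma complexP (x y : C) : complex.Re x = complex.Re y -> complex.Im x = complex.Im y -> x = y.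
Proof. by move=> h1 h2; apply/eqP; rewrite eq_complex h1 h2 !eqxx. Qed.

Lemma meval_ellipsoid (eps a b x y u v : R) :
  (1 + eps * a) * x ^+ 2 + y ^+ 2 + (1 + eps * b) * u ^+ 2 + v ^+ 2 = 1 ->
  hypersurface (ellipsoid a b eps) (x +i* y, u +i* v).
Proof.
move=> h; rewrite /hypersurface /= ellipsoid_quadratic quadratic_morph /=.
have [m1 m2 m3 m4] := meval_vars (x +i* y, u +i* v).
rewrite m1 m2 m3 m4 !mevalC {m1 m2 m3 m4} /quadratic /=.
apply: complexP; rewrite !expr2 /=; last by ring.
by move: h; lra.
Qed.

Lemma gradient_coord (t x y : R) :
  2%:R * t%:C * (x +i* y) + (2 * (2 + t))%:C * conjc (x +i* y) =
  (4 * ((1 + t) * x)) +i* (- (4 * y)).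
Proof. by apply: complexP => /=; ring. Qed.

Lemma ellipsoid_umbilical (eps a b al be x y u v : R) (z1 z2 lam mu : C) :
  al = eps * a -> be = eps * b ->
  z1 = (4 * ((1 + al) * x)) +i* (- (4 * y)) ->
  z2 = (4 * ((1 + be) * u)) +i* (- (4 * v)) ->
  0 <= al -> 0 <= be ->
  (1 + al) * x ^+ 2 + y ^+ 2 + (1 + be) * u ^+ 2 + v ^+ 2 = 1 ->
  al%:C = z1 * lam -> be%:C = z2 * mu -> z1 * mu = - (z2 * lam) ->
  umbilical_points (ellipsoid a b eps) (x +i* y, u +i* v).
Proof.
move=> hal hbe ez1 ez2 ha hb h h1 h2 h3.
have hyp : hypersurface (ellipsoid a b eps) (x +i* y, u +i* v).
  by apply: meval_ellipsoid; rewrite -hal -hbe.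
split; first exact: hyp.
pose P : R := 2 * (2 + al); pose Q : R := 2 * (2 + be).
pose n1 : R := (4 * ((1 + al) * x)) ^+ 2 + (4 * y) ^+ 2.
pose n2 : R := (4 * ((1 + be) * u)) ^+ 2 + (4 * v) ^+ 2.
have en1 : z1 * conjc z1 = n1%:C by rewrite ez1; apply: complexP => /=; rewrite /n1; ring.
have en2 : z2 * conjc z2 = n2%:C by rewrite ez2; apply: complexP => /=; rewrite /n2; ring.
pose N : R := P * n2 + Q * n1.
have P0 : 0 < P by rewrite /P; lra.
have Q0 : 0 < Q by rewrite /Q; lra.
have n10 : 0 <= n1 by rewrite addr_ge0 ?sqr_ge0.
have n20 : 0 <= n2 by rewrite addr_ge0 ?sqr_ge0.
have n12 : 0 < n1 + n2.
  have hx : (1 + al) * x ^+ 2 <= (4 * ((1 + al) * x)) ^+ 2.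
    rewrite !exprMn; apply: (@le_trans _ _ ((1 + al) ^+ 2 * x ^+ 2)).
      by rewrite ler_wpM2r ?sqr_ge0 // expr2; nra.
    by have := sqr_ge0 ((1 + al) * x); rewrite exprMn; lra.
  have hu : (1 + be) * u ^+ 2 <= (4 * ((1 + be) * u)) ^+ 2.
    rewrite !exprMn; apply: (@le_trans _ _ ((1 + be) ^+ 2 * u ^+ 2)).
      by rewrite ler_wpM2r ?sqr_ge0 // expr2; nra.
    by have := sqr_ge0 ((1 + be) * u); rewrite exprMn; lra.
  have := sqr_ge0 y; have := sqr_ge0 v; rewrite /n1 /n2.
  rewrite (exprMn _ 4 y) (exprMn _ 4 v); lra.
have N0 : 0 < N.
  have h4P : 4 * n2 <= P * n2 by apply: ler_wpM2r => //; rewrite /P; lra.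
  have h4Q : 4 * n1 <= Q * n1 by apply: ler_wpM2r => //; rewrite /Q; lra.
  by rewrite /N; lra.
pose s : R := Num.sqrt (P * Q) / (2 * N).
have s0 : 0 < s.
  apply: divr_gt0; first by rewrite sqrtr_gt0; exact: mulr_gt0.
  by apply: mulr_gt0 => //; rewrite ltr0n.
have hs : s * s = P * Q / (4 * N * N).
  have : Num.sqrt (P * Q) ^+ 2 = P * Q by rewrite sqr_sqrtr // mulr_ge0 // ltW.
  rewrite /s; move: (Num.sqrt _) => t <-; field; exact: lt0r_neq0.
have cr (t : R) : conjc t%:C = t%:C :> C by apply: complexP => //=; rewrite oppr0.
apply: (@umbilical_of_isotropic R al%:C P%:C be%:C Q%:C s%:C N%:C (s * s * N)%:C z1 z2 _ _ lam mu) => //.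
- rewrite en1 en2; apply: complexP => /=; rewrite /N; ring.
- by apply: complexP => /=; ring.
- by rewrite eq_complex /= eqxx andbT; exact: lt0r_neq0.
- by rewrite eq_complex /= eqxx andbT; exact: lt0r_neq0.
- apply: complexP => /=; last by ring.
  rewrite hs !mul0r !subr0; field; exact: lt0r_neq0.
rewrite ellipsoid_quadratic -hal -hbe -/P -/Q in hyp *.
apply: etrans (recenter_quadratic hyp) _.
have g1 : 2%:R * al%:C * (x +i* y) + P%:C * conjc (x +i* y) = z1.
  by rewrite ez1; apply: gradient_coord.
have g2 : 2%:R * be%:C * (u +i* v) + Q%:C * conjc (u +i* v) = z2.
  by rewrite ez2; apply: gradient_coord.
have g3 : 2%:R * al%:C * conjc (x +i* y) + P%:C * (x +i* y) = conjc z1.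
  by rewrite -g1 conjcD !conjcM conjcK !cr conjc_nat.
have g4 : 2%:R * be%:C * conjc (u +i* v) + Q%:C * (u +i* v) = conjc z2.
  by rewrite -g2 conjcD !conjcM conjcK !cr conjc_nat.
rewrite -{}g3 -{}g4 -{}g1 -{}g2; exact: erefl.
Qed.

End EllipsoidPoints.

(** * Closure properties of real-analytic functions *)

Section AnalyticClosure.
Variables (R : realType) (n : nat) (x : 'rV[R]_n).
Implicit Types (f g : 'rV[R]_n -> R).

Local Notation shift y := (fun i => y 0 i - x 0 i).

Lemma trunc_coeffE N (c : fps R n) m :
  mcoeff m (trunc N c) = if (mdeg m < N)%N then c m else 0.
Proof.
case: ifP => h; first exact: trunc_coeff.
rewrite /trunc raddf_sum big1 // => m' _; rewrite /= mcoeffZ mcoeffX.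
case: eqP => [E|_]; last by rewrite mulr0.
by move: (bmdeg m'); rewrite E h.
Qed.

Lemma bound_le (c : fps R n) r r' M : 0 < r' -> r' <= r ->
  (forall m, `|c m| * r ^+ mdeg m <= M) -> forall m, `|c m| * r' ^+ mdeg m <= M.
Proof.
move=> r0 rr h m; apply: le_trans (h m); apply: ler_wpM2l => //.
by apply: lerXn2r => //; rewrite nnegrE ltW // (lt_le_trans r0).
Qed.

Lemma analytic_cst a : analytic_at (fun=> a) x.
Proof.
exists (fun m => if m == mnm0 then a else 0), 1, `|a|; split=> //.
  by move=> m; rewrite expr1n mulr1; case: eqP => // _; rewrite normr0.
move=> y _; apply: cvg_near_cst; exists 1%N => // N /= N0.
suff -> : trunc N (fun m => if m == mnm0 then a else 0) = mpolyC n a by rewrite mevalC.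
apply/mpolyP => m; rewrite trunc_coeffE mcoeffC; case: eqP => [->|_].
  by rewrite mdeg0 N0 mulr1.
by rewrite mulr0 if_same.
Qed.

Lemma analyticD f g : analytic_at f x -> analytic_at g x -> analytic_at (fun y => f y + g y) x.
Proof.
move=> [c [r [M [r0 hM hf]]]] [c' [r' [M' [r0' hM' hg]]]].
exists (fun m => c m + c' m), (Num.min r r'), (M + M'); split.
- by rewrite lt_min r0 r0'.
- move=> m; have m0 : 0 < Num.min r r' by rewrite lt_min r0 r0'.
  apply: (@le_trans _ _ ((`|c m| + `|c' m|) * Num.min r r' ^+ mdeg m)).
    by rewrite ler_wpM2r ?ler_normD // exprn_ge0 // ltW.
  rewrite mulrDl; apply: lerD.
    by apply: (bound_le m0 _ hM); rewrite ge_min lexx.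
  by apply: (bound_le m0 _ hM'); rewrite ge_min lexx orbT.
move=> y hy.
have -> : (fun N => meval (shift y) (trunc N (fun m => c m + c' m))) =
   (fun N => meval (shift y) (trunc N c)) \+ (fun N => meval (shift y) (trunc N c')).
  apply: funext => N /=; rewrite -mevalD; congr meval.
  by rewrite /trunc -big_split; apply: eq_bigr => m _; rewrite scalerDl.
apply: cvgD; [apply: hf | apply: hg] => i.
  by apply: lt_le_trans (hy i) _; rewrite ge_min lexx.
by apply: lt_le_trans (hy i) _; rewrite ge_min lexx orbT.
Qed.

Lemma analyticZ a f : analytic_at f x -> analytic_at (fun y => a * f y) x.
Proof.
move=> [c [r [M [r0 hM hf]]]]; exists (fun m => a * c m), r, (`|a| * M); split=> //.
  by move=> m; rewrite normrM -mulrA ler_wpM2l.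
move=> y hy.
have -> : (fun N => meval (shift y) (trunc N (fun m => a * c m))) =
   (fun N => a * meval (shift y) (trunc N c)).
  apply: funext => N /=; rewrite -mevalZ; congr meval.
  by rewrite /trunc scaler_sumr; apply: eq_bigr => m _; rewrite scalerA.
by apply: cvgM; [apply: cvg_cst | apply: hf].
Qed.

Lemma analytic_mulshift i f : analytic_at f x -> analytic_at (fun y => (y 0 i - x 0 i) * f y) x.
Proof.
move=> [c [r [M [r0 hM hf]]]].
pose c' (m : multinom n) := if (0 < m i)%N then c (mnm_sub m (mnm1 i)) else 0.
have hsub (m : multinom n) : (0 < m i)%N -> mnm_add (mnm1 i) (mnm_sub m (mnm1 i)) = m.
  by move=> h; rewrite addmC; apply: submK; apply/mnm_lepP => j; rewrite mnm1E; case: eqP => // <-.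
have hdeg (m : multinom n) : (0 < m i)%N -> mdeg m = (mdeg (mnm_sub m (mnm1 i))).+1.
  by move=> h; rewrite -{1}(hsub m h) mdegD mdeg1 add1n.
exists c', r, (M * r); split=> //.
  move=> m; rewrite /c'; case: ifP => h; last first.
    rewrite normr0 mul0r mulr_ge0 ?(ltW r0) //.
    by apply: le_trans (hM mnm0); rewrite mulr_ge0 // exprn_ge0 // ltW.
  by rewrite hdeg // exprSr mulrA ler_wpM2r // ltW.
move=> y hy; rewrite -cvg_shiftS /=.
have -> : (fun N => meval (shift y) (trunc N.+1 c')) =
   (fun N => (y 0 i - x 0 i) * meval (shift y) (trunc N c)).
  apply: funext => N; rewrite -[y 0 i - x 0 i](mevalXU (shift y) i) -mevalM; congr meval.
  apply/mpolyP => m; rewrite trunc_coeffE mulrC /c'.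
  case: (posnP (m i)) => hi.
    have hF : Filt (fun j => nat_of_bool (j == i)) 1 (trunc N c * mpolyX R (mnm1 i)).
      by apply: FiltMl; apply: FiltXm; rewrite wt1 eqxx.
    rewrite hF ?if_same //; rewrite /wt big1 // => j _.
    by case: eqP => [->|_]; [rewrite hi | rewrite mul0n].
  rewrite -[X in _ = mcoeff X _](hsub m hi) mcoeffMX trunc_coeffE.
  by rewrite hdeg // ltnS.
by apply: cvgM; [apply: cvg_cst | apply: hf].
Qed.

Lemma analytic_mulvar i f : analytic_at f x -> analytic_at (fun y => y 0 i * f y) x.
Proof.
move=> h; have := analyticD (analytic_mulshift i h) (analyticZ (x 0 i) h).
by congr (analytic_at _ x); apply: funext => y; rewrite -mulrDl subrK.
Qed.

Section Inverse.
Variables u v : R.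
(** The Taylor coefficients of 1 / (1 + u t + v t^2). *)
Fixpoint inv_coef (k : nat) : R :=
  match k with
  | 0 => 1
  | k1.+1 => match k1 with
             | 0 => - u
             | k2.+1 => - (u * inv_coef k1 + v * inv_coef k2)
             end
  end.
Let K := `|u| + `|v| + 1.

Lemma inv_coefS k : inv_coef k.+2 = - (u * inv_coef k.+1 + v * inv_coef k).
Proof. by []. Qed.

Lemma K_ge1 : 1 <= K. Proof. by rewrite /K lerDr addr_ge0. Qed.

Lemma inv_coef_bound k : `|inv_coef k| <= K ^+ k.
Proof.
have K1 := K_ge1; have K0 : 0 <= K by apply: le_trans K1.
suff : `|inv_coef k| <= K ^+ k /\ `|inv_coef k.+1| <= K ^+ k.+1 by case.
elim: k => [|k [h1 h2]].
  by rewrite /= normr1 expr0 expr1 normrN; split=> //; rewrite /K -addrA lerDl addr_ge0.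
split=> //; rewrite inv_coefS normrN; apply: le_trans (ler_normD _ _) _; rewrite !normrM.
apply: (@le_trans _ _ (`|u| * K ^+ k.+1 + `|v| * K ^+ k.+1)).
  apply: lerD; apply: ler_wpM2l => //; apply: le_trans h1 _.
  by rewrite ler_weXn2l.
by rewrite -mulrDl [K ^+ k.+2]exprS ler_wpM2r ?exprn_ge0 // /K lerDl.
Qed.

Lemma inv_coef_sum (d : R) N :
  (1 + u * d + v * d ^+ 2) * (\sum_(k < N.+2) inv_coef k * d ^+ k) =
  1 - inv_coef N.+2 * d ^+ N.+2 + v * inv_coef N.+1 * d ^+ N.+3.
Proof.
elim: N => [|N IH].
  by rewrite !big_ord_recl big_ord0 /=; ring.
by rewrite big_ord_recr mulrDr IH inv_coefS [inv_coef N.+3]inv_coefS !exprS /=; ring.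
Qed.

Lemma inv_series (d : R) : `|d| < (2 * K)^-1 ->
  (fun N => \sum_(k < N) inv_coef k * d ^+ k) @ \oo --> (1 + u * d + v * d ^+ 2)^-1.
Proof.
move=> hd; have K1 := K_ge1; have K0 : 0 < K by apply: lt_le_trans K1.
have hKd : K * `|d| < 2^-1 by rewrite -ltr_pdivlMl // -invfM mulrC.
have d1 : `|d| < 1.
  by apply: lt_trans hd _; rewrite invf_lt1 ?mulr_gt0 //; lra.
pose q := 1 + u * d + v * d ^+ 2.
have q0 : q != 0.
  have : `|u * d + v * d ^+ 2| < 1.
    apply: le_lt_trans (ler_normD _ _) _; rewrite !normrM.
    have hv : `|v| * (`|d| * `|d|) <= `|v| * `|d| by rewrite ler_wpM2l // ler_piMr // ltW.
    by move: hKd hv (normr_ge0 d); rewrite /K !mulrDl mul1r; lra.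
  rewrite /q -addrA; apply: contraTneq => h.
  have -> : u * d + v * d ^+ 2 = - 1 by apply/eqP; rewrite -addr_eq0 addrC h.
  by rewrite normrN normr1 ltxx.
have hp : (fun N => inv_coef N * d ^+ N) @ \oo --> (0 : R).
  have hgeo : (fun N => (K * `|d|) ^+ N) @ \oo --> (0 : R).
    by apply: cvg_expr; rewrite ger0_norm ?mulr_ge0 // ?ltW //; apply: lt_trans hKd _; lra.
  apply/norm_cvg0P; apply: (squeeze_cvgr _ (cvg_cst 0) hgeo); apply: nearW => N.
  by rewrite normr_ge0 /= normrM normrX exprMn ler_wpM2r ?inv_coef_bound.
rewrite -(cvg_shiftn 2) /=.
have -> : (fun N => \sum_(k < N + 2) inv_coef k * d ^+ k) =
  (fun N => q^-1 * (1 - inv_coef N.+2 * d ^+ N.+2 + v * d ^+ 2 * (inv_coef N.+1 * d ^+ N.+1))).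
  apply: funext => N; rewrite addn2; apply: (mulfI q0); rewrite (mulVKf q0) inv_coef_sum.
  by congr (_ + _); rewrite [d ^+ N.+3]exprS [d ^+ N.+2]exprS expr2; ring.
have hp1 : (fun N => inv_coef N.+1 * d ^+ N.+1) @ \oo --> (0 : R).
  by have := hp; rewrite -cvg_shiftS.
have hp2 : (fun N => inv_coef N.+2 * d ^+ N.+2) @ \oo --> (0 : R).
  by have := hp1; rewrite -cvg_shiftS.
have h1 : (fun N => 1 - inv_coef N.+2 * d ^+ N.+2) @ \oo --> (1 - 0 : R).
  by apply: cvgB; [apply: cvg_cst | exact: hp2].
have h2 : (fun N => v * d ^+ 2 * (inv_coef N.+1 * d ^+ N.+1)) @ \oo --> (v * d ^+ 2 * 0 : R).
  by apply: cvgM; [apply: cvg_cst | exact: hp1].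
have h3 : (fun N => q^-1 * (1 - inv_coef N.+2 * d ^+ N.+2
    + v * d ^+ 2 * (inv_coef N.+1 * d ^+ N.+1))) @ \oo --> q^-1 * (1 - 0 + v * d ^+ 2 * 0).
  by apply: cvgM; [apply: cvg_cst | apply: cvgD; [exact: h1 | exact: h2]].
by rewrite mulr0 subr0 addr0 mulr1 in h3.
Qed.

(** The coefficients grow at most like K^k, so the radius 1 / (2 K) is admissible. *)
Lemma analytic_inv i :
  analytic_at (fun y => (1 + u * (y 0 i - x 0 i) + v * (y 0 i - x 0 i) ^+ 2)^-1) x.
Proof.
have K1 := K_ge1; have K0 : 0 < K by apply: lt_le_trans K1.
pose e k := mnm_muln (mnm1 i) k : multinom n.
pose c (m : multinom n) := if m == e (m i) then inv_coef (m i) else 0.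
have ei k : e k i = k by rewrite mulmnE mnm1E eqxx mul1n.
have de k : mdeg (e k) = k by rewrite mdegMn mdeg1 mul1n.
exists c, (2 * K)^-1, 1; split.
- by rewrite invr_gt0 mulr_gt0.
- move=> m; rewrite /c; case: eqP => [->|_]; last by rewrite normr0 mul0r.
  rewrite de ei exprVn; rewrite ler_pdivrMr ?exprn_gt0 ?mulr_gt0 // mul1r.
  apply: le_trans (inv_coef_bound _) _; rewrite exprMn ler_peMl ?exprn_ge0 ?(ltW K0) //.
  by rewrite exprn_ege1 //; lra.
move=> y hy.
have -> : (fun N => meval (shift y) (trunc N c)) =
    (fun N => \sum_(k < N) inv_coef k * (y 0 i - x 0 i) ^+ k).
  apply: funext => N.
  have -> : trunc N c = \sum_(k < N) inv_coef k *: mvar R i ^+ k.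
    apply/mpolyP => m; rewrite trunc_coeffE raddf_sum /=.
    under eq_bigr do rewrite mcoeffZ mcoeffXn -/(e _).
    case: ifP => hm.
      rewrite /c; case: eqP => [E|hE]; last first.
        rewrite big1 // => k _; case: eqP => [E|_]; last by rewrite mulr0.
        by case: hE; rewrite -E ei.
      have hmi : (m i < N)%N by rewrite -[m i]de -E.
      rewrite (bigD1 (Ordinal hmi)) //= -E eqxx mulr1 big1 ?addr0 // => k hk.
      case: eqP => [E'|_]; last by rewrite mulr0.
      by case/negP: hk; apply/eqP/val_inj; rewrite /= -E' ei.
    rewrite big1 // => k _; case: eqP => [E|_]; last by rewrite mulr0.
    by move: hm; rewrite -E de ltn_ord.
  rewrite raddf_sum /=; apply: eq_bigr => k _.
  by rewrite mevalZ rmorphXn /= mevalXU.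
exact: inv_series.
Qed.
End Inverse.

Lemma analytic_inv_quadratic (p q s : R) i : p + q * x 0 i + s * x 0 i ^+ 2 != 0 ->
  analytic_at (fun y => (p + q * y 0 i + s * y 0 i ^+ 2)^-1) x.
Proof.
set p0 := p + _ + _ => h.
have := analyticZ p0^-1 (analytic_inv ((q + 2 * s * x 0 i) / p0) (s / p0) i).
congr (analytic_at _ x); apply: funext => y; rewrite -invfM; congr (_^-1).
rewrite /p0; move: h; rewrite /p0; move: (y 0 i) (x 0 i) => a b h; field.
exact: h.
Qed.

Lemma analytic_var i : analytic_at (fun y => y 0 i) x.
Proof.
have := analytic_mulvar i (analytic_cst 1).
by congr (analytic_at _ x); apply: funext => y; rewrite mulr1.
Qed.

End AnalyticClosure.

(** * Arcs of ellipses are curves *)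

Section Ellipse.
Variables (R : realType) (i0 i1 i2 i3 : 'I_4) (c c' k k' : R).
Hypothesis idx_uniq : uniq [:: i0; i1; i2; i3].
Hypothesis c_gt0 : 0 < c.
Hypothesis c'_neq0 : c' != 0.
Implicit Types y w : 'rV[R]_4.

(** The point of the ellipse left out, where y_i0 = - c, is the centre of the
    stereographic projection below. *)
Definition ellipse_arc : set 'rV[R]_4 := [set y | [/\ -1 < y 0 i0 / c,
  (y 0 i0 / c) ^+ 2 + (y 0 i1 / c') ^+ 2 = 1, y 0 i2 = k * y 0 i1 & y 0 i3 = k' * y 0 i0]].

(** With S = y_i0 / c and T = y_i1 / c', the first coordinate T / (1 + S) is the
    stereographic projection from (-1, 0), and the second one is
    (S^2 + T^2 - 1) / (1 + S). This multiple of S^2 + T^2 - 1 makes the inverse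
    polynomial in the second coordinate, with denominators that depend on the first
    coordinate alone. *)
Definition straighten y : 'rV[R]_4 := \row_i
  tnth [tuple (y 0 i1 / c') / (1 + y 0 i0 / c);
              (y 0 i1 / c') ^+ 2 / (1 + y 0 i0 / c) - 1 + y 0 i0 / c;
              y 0 i2 - k * y 0 i1; y 0 i3 - k' * y 0 i0] i.

Definition unstraighten w : 'rV[R]_4 :=
  let s := (w 0 1 + 2) / (1 + w 0 0 ^+ 2) in
  \row_i (if i == i0 then c * (s - 1)
     else if i == i1 then c' * (w 0 0 * s)
     else if i == i2 then w 0 2 + k * (c' * (w 0 0 * s))
     else w 0 3 + k' * (c * (s - 1))).

Lemma idx_neq : [/\ (i1 == i0) = false, (i2 == i0) = false, (i3 == i0) = false &
  [/\ (i2 == i1) = false, (i3 == i1) = false & (i3 == i2) = false]].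
Proof.
move: idx_uniq; rewrite /= !inE !negb_or => /and4P[/and3P[a b d] /andP[e f] g _].
by split; last split; rewrite eq_sym; exact: negbTE.
Qed.

Lemma idx_cover i : [\/ i = i0, i = i1, i = i2 | i = i3].
Proof.
have : i \in [:: i0; i1; i2; i3].
  apply: contraT => hi; have hu : uniq (i :: [:: i0; i1; i2; i3]) by rewrite cons_uniq hi.
  by have := max_card [in i :: [:: i0; i1; i2; i3]]; rewrite (card_uniqP hu) card_ord.
by rewrite !inE => /or4P[] /eqP ->; [constructor 1|constructor 2|constructor 3|constructor 4].
Qed.

Lemma unstraightenE w : let s := (w 0 1 + 2) / (1 + w 0 0 ^+ 2) in
  [/\ unstraighten w 0 i0 = c * (s - 1), unstraighten w 0 i1 = c' * (w 0 0 * s),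
      unstraighten w 0 i2 = w 0 2 + k * (c' * (w 0 0 * s)) &
      unstraighten w 0 i3 = w 0 3 + k' * (c * (s - 1))].
Proof.
have [h1 h2 h3 [h4 h5 h6]] := idx_neq.
by split; rewrite mxE ?eqxx ?h1 ?h2 ?h3 ?h4 ?h5 ?h6 ?eqxx.
Qed.

Lemma straightenE y :
  [/\ straighten y 0 0 = (y 0 i1 / c') / (1 + y 0 i0 / c),
      straighten y 0 1 = (y 0 i1 / c') ^+ 2 / (1 + y 0 i0 / c) - 1 + y 0 i0 / c,
      straighten y 0 2 = y 0 i2 - k * y 0 i1 & straighten y 0 3 = y 0 i3 - k' * y 0 i0].
Proof. by split; rewrite mxE. Qed.

Lemma den_gt0 (t : R) : 0 < 1 + t ^+ 2.
Proof. by rewrite ltr_pwDl ?sqr_ge0. Qed.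

Lemma unstraightenK w : -2 < w 0 1 ->
  -1 < unstraighten w 0 i0 / c /\ straighten (unstraighten w) = w.
Proof.
move=> hw; have [e0 e1 e2 e3] := unstraightenE w.
have d0 := den_gt0 (w 0 0).
set s := (w 0 1 + 2) / (1 + w 0 0 ^+ 2) in e0 e1 e2 e3.
have s0 : 0 < s by apply: divr_gt0 => //; lra.
have es : unstraighten w 0 i0 / c = s - 1 by rewrite e0 mulrC mulKf // lt0r_neq0.
have et : unstraighten w 0 i1 / c' = w 0 0 * s by rewrite e1 mulrC mulKf.
split; first by rewrite es; lra.
have [f0 f1 f2 f3] := straightenE (unstraighten w).
have s1 : 1 + (s - 1) = s by ring.
have sn : s != 0 by exact: lt0r_neq0.
apply/rowP; apply: ord4P.
- by rewrite f0 es et s1 mulfK.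
- rewrite f1 es et s1.
  have -> : (w 0 0 * s) ^+ 2 / s - 1 + (s - 1) = s * (1 + w 0 0 ^+ 2) - 2.
    by field.
  by rewrite /s divfK ?addrK // lt0r_neq0.
- by rewrite f2 e2 e1 addrK.
- by rewrite f3 e3 e0 addrK.
Qed.

Lemma straightenK y : -1 < y 0 i0 / c ->
  -2 < straighten y 0 1 /\ unstraighten (straighten y) = y.
Proof.
move=> hy; have [f0 f1 f2 f3] := straightenE y.
have [e0 e1 e2 e3] := unstraightenE (straighten y).
set S := y 0 i0 / c in hy f0 f1; set T := y 0 i1 / c' in f0 f1.
have S0 : 0 < 1 + S by lra.
have Sn : 1 + S != 0 by exact: lt0r_neq0.
have es : (straighten y 0 1 + 2) / (1 + straighten y 0 0 ^+ 2) = 1 + S.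
  have hd : 1 + (T / (1 + S)) ^+ 2 != 0 by apply: lt0r_neq0; apply: den_gt0.
  rewrite f0 f1; apply: (mulIf hd); rewrite divfK //; field; exact: Sn.
rewrite es f0 divfK // in e0 e1 e2 e3.
have hS : c * S = y 0 i0 by rewrite /S mulrC divfK // lt0r_neq0.
have hT : c' * T = y 0 i1 by rewrite /T mulrC divfK.
have s1 : 1 + S - 1 = S by ring.
split.
  have : 0 <= T ^+ 2 / (1 + S) by rewrite divr_ge0 ?sqr_ge0 // ltW.
  by rewrite f1; lra.
rewrite s1 hS hT in e0 e1 e2 e3.
apply/rowP => i; case: (idx_cover i) => ->.
- by rewrite e0.
- by rewrite e1.
- by rewrite e2 f2 subrK.
- by rewrite e3 f3 subrK.
Qed.

Lemma ellipse_arc_straighten y : -1 < y 0 i0 / c ->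
  ellipse_arc y <-> forall i : 'I_4, (1 <= i)%N -> straighten y 0 i = 0.
Proof.
move=> hy; have [f0 f1 f2 f3] := straightenE y.
have S0 : 1 + y 0 i0 / c != 0 by apply: lt0r_neq0; lra.
have key : straighten y 0 1 = ((y 0 i0 / c) ^+ 2 + (y 0 i1 / c') ^+ 2 - 1) / (1 + y 0 i0 / c).
  rewrite f1; move: (y 0 i0 / c) (y 0 i1 / c') S0 => S T S0; field; exact: S0.
split=> [[_ h1 h2 h3]|h].
  apply: ord4P => // _; first by rewrite key h1 subrr mul0r.
    by rewrite f2 h2 subrr.
  by rewrite f3 h3 subrr.
split=> //.
- have := h 1 isT; rewrite key => /eqP; rewrite mulf_eq0 invr_eq0 (negbTE S0) orbF subr_eq0.
  by move/eqP.
- by apply/eqP; rewrite -subr_eq0 -f2; apply/eqP/h.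
- by apply/eqP; rewrite -subr_eq0 -f3; apply/eqP/h.
Qed.

Lemma straighten_analytic y : -1 < y 0 i0 / c -> analytic_map_at straighten y.
Proof.
move=> hy.
have hinv : analytic_at (fun z : 'rV[R]_4 => (1 + z 0 i0 / c)^-1) y.
  have h : 1 + c^-1 * y 0 i0 + 0 * y 0 i0 ^+ 2 != 0.
    by rewrite mul0r addr0 mulrC; apply: lt0r_neq0; lra.
  have := analytic_inv_quadratic h; congr (analytic_at _ y); apply: funext => z.
  by rewrite mul0r addr0 [c^-1 * _]mulrC.
apply: ord4P.
- have := analyticZ c'^-1 (analytic_mulvar i1 hinv).
  congr (analytic_at _ y); apply: funext => z; have [-> _ _ _] := straightenE z.
  by rewrite mulrA [c'^-1 * _]mulrC.
- have := analyticD (analyticD (analyticZ (c'^-1 ^+ 2) (analytic_mulvar i1 (analytic_mulvar i1 hinv)))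
    (analytic_cst y (-1))) (analyticZ c^-1 (analytic_var y i0)).
  congr (analytic_at _ y); apply: funext => z; have [_ -> _ _] := straightenE z.
  by rewrite [c^-1 * _]mulrC exprMn; congr (_ + _ + _); ring.
- have := analyticD (analytic_var y i2) (analyticZ (- k) (analytic_var y i1)).
  congr (analytic_at _ y); apply: funext => z; have [_ _ -> _] := straightenE z.
  by rewrite mulNr.
- have := analyticD (analytic_var y i3) (analyticZ (- k') (analytic_var y i0)).
  congr (analytic_at _ y); apply: funext => z; have [_ _ _ ->] := straightenE z.
  by rewrite mulNr.
Qed.

Lemma unstraighten_analytic w : analytic_map_at unstraighten w.
Proof.
have hinv : analytic_at (fun z : 'rV[R]_4 => (1 + z 0 0 ^+ 2)^-1) w.
  have h : 1 + 0 * w 0 0 + 1 * w 0 0 ^+ 2 != 0.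
    by rewrite mul0r addr0 mul1r; apply: lt0r_neq0; apply: den_gt0.
  have := analytic_inv_quadratic h; congr (analytic_at _ w); apply: funext => z.
  by rewrite mul0r addr0 mul1r.
have hs : analytic_at (fun z : 'rV[R]_4 => (z 0 1 + 2) / (1 + z 0 0 ^+ 2)) w.
  have := analyticD (analytic_mulvar 1 hinv) (analyticZ 2 hinv).
  by congr (analytic_at _ w); apply: funext => z; rewrite [RHS]mulrDl.
have hS : analytic_at (fun z : 'rV[R]_4 => c * ((z 0 1 + 2) / (1 + z 0 0 ^+ 2) - 1)) w.
  exact: (analyticZ c (analyticD hs (analytic_cst w (-1)))).
have hT : analytic_at (fun z : 'rV[R]_4 => c' * (z 0 0 * ((z 0 1 + 2) / (1 + z 0 0 ^+ 2)))) w.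
  exact: (analyticZ c' (analytic_mulvar 0 hs)).
move=> i; case: (idx_cover i) => ->.
- move: hS; congr (analytic_at _ w); apply: funext => z; by have [-> _ _ _] := unstraightenE z.
- move: hT; congr (analytic_at _ w); apply: funext => z; by have [_ -> _ _] := unstraightenE z.
- have := analyticD (analytic_var w 2) (analyticZ k hT).
  congr (analytic_at _ w); apply: funext => z; by have [_ _ -> _] := unstraightenE z.
- have := analyticD (analytic_var w 3) (analyticZ k' hS).
  congr (analytic_at _ w); apply: funext => z; by have [_ _ _ ->] := unstraightenE z.
Qed.

Lemma open_coord (i : 'I_4) (a b : R) : open [set y : 'rV[R]_4 | a < y 0 i * b].
Proof.
have hc : continuous (fun y : 'rV[R]_4 => y 0 i * b).
  move=> y; have h := @coord_continuous R 1 4 0 i y.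
  by apply: (cvgM h); apply: cvg_cst.
have -> : [set y : 'rV[R]_4 | a < y 0 i * b] = (fun y : 'rV[R]_4 => y 0 i * b) @^-1` [set t | a < t] by [].
by apply: open_comp => //; apply: open_gt.
Qed.

Lemma ellipse_arc_submanifold y : ellipse_arc y -> submanifold_at ellipse_arc 1 y.
Proof.
move=> hy; split=> //.
exists [set z | -1 < z 0 i0 / c], [set z | -2 < z 0 1], straighten, unstraighten; split.
- split; first exact: open_coord.
  have := @open_coord 1 (-2) 1; congr open; apply/seteqP; split=> z /=; by rewrite mulr1.
- by case: hy.
- by move=> z hz; have [h1 h2] := straightenK hz; split=> //; apply: straighten_analytic.
- by move=> z hz; have [h1 h2] := unstraightenK hz; split=> //; apply: unstraighten_analytic.
- by move=> z hz; apply: ellipse_arc_straighten.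
Qed.

Definition arc_param (t : R) : 'rV[R]_4 := unstraighten (\row_i (if i == 0 then t else 0)).

Lemma arc_param_image : arc_param @` setT = ellipse_arc.
Proof.
apply/seteqP; split=> [y [t _ <-]|y hy].
  have hw : -2 < (\row_i (if i == 0 then t else 0) : 'rV[R]_4) 0 1 by rewrite mxE /=; lra.
  have [h1 h2] := unstraightenK hw.
  apply/(ellipse_arc_straighten h1); rewrite h2.
  by apply: ord4P => // _; rewrite mxE.
have h0 : -1 < y 0 i0 / c by case: hy.
have [_ h2] := straightenK h0.
exists (straighten y 0 0) => //; rewrite -[RHS]h2 /arc_param; congr unstraighten.
have /(ellipse_arc_straighten h0) h := hy.
by apply/rowP; apply: ord4P; rewrite mxE //= h.
Qed.

Lemma arc_param_continuous : continuous arc_param.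
Proof.
pose s (t : R) : R := 2 / (1 + t ^+ 2).
pose va : 'rV[R]_4 := \row_i (if i == i0 then c else if i == i1 then 0
  else if i == i2 then 0 else k' * c).
pose vb : 'rV[R]_4 := \row_i (if i == i0 then 0 else if i == i1 then c'
  else if i == i2 then k * c' else 0).
have -> : arc_param = (fun t => (s t - 1) *: va + (t * s t) *: vb).
  apply: funext => t; apply/rowP => i; rewrite !mxE /= add0r -/(s t).
  by case: ifP => _; [|case: ifP => _; [|case: ifP => _]]; ring.
have hs : continuous s.
  move=> t; apply: cvgM; first by apply: cvg_cst.
  apply: cvgV; first exact: lt0r_neq0 (den_gt0 t).
  apply: cvgD; first by apply: cvg_cst.
  by apply: cvgM; exact: cvg_id.
move=> t; apply: cvgD; apply: cvgZr_tmp.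
  by apply: cvgB; [exact: hs | apply: cvg_cst].
by apply: cvgM; [exact: cvg_id | exact: hs].
Qed.

Lemma ellipse_arc_curve : curve ellipse_arc.
Proof.
split.
- by rewrite -arc_param_image; exists (arc_param 0), 0.
- rewrite -arc_param_image; apply: connected_continuous_connected.
    by apply/connected_intervalP => x y _ _ z _.
  by apply: continuous_subspaceT; exact: arc_param_continuous.
- exact: ellipse_arc_submanifold.
Qed.

End Ellipse.

(** * An ellipse of umbilical points *)

Lemma mul_div_field (F : fieldType) (u a z : F) : z != 0 ->
  u * z * - (u * (a / z)) = - (u * u * a).
Proof. by move=> z0; field. Qed.

Section EllipsoidCurve.
Variable R : realType.
Local Notation C := R[i].

Lemma scaled_square (d t : R) : 0 < d -> (t / (Num.sqrt d)^-1) ^+ 2 = d * t ^+ 2.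
Proof. by move=> d0; rewrite invrK exprMn sqr_sqrtr ?ltW // mulrC. Qed.

Lemma complex_neq0 (x y : R) : x ^+ 2 + y ^+ 2 != 0 -> x +i* y != 0 :> C.
Proof.
apply: contra => /eqP[-> ->].
by rewrite expr0n addr0.
Qed.

(** On this ellipse the components of the gradient satisfy z2 = i kap z1, hence
    al z2^2 + be z1^2 = 0, and (- z2, z1) spans the complex tangent line. *)
Lemma ellipsoid_arc_tilted (A B eps : R) : 0 < eps * A -> 0 <= eps * B ->
  let al := eps * A in let be := eps * B in
  let kap := Num.sqrt (be / al) in
  let c := (Num.sqrt ((1 + al) + kap ^+ 2 * (1 + al) ^+ 2))^-1 in
  let c' := (Num.sqrt (1 + kap ^+ 2 / (1 + be)))^-1 in
  ellipse_arc 0 1 2 3 c c' (kap / (1 + be)) (- (kap * (1 + al)))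
    `<=` realification (umbilical_points (ellipsoid A B eps)).
Proof.
move=> al0 be0 al be kap c c' y [_ h1 h2 h3].
have hk : kap ^+ 2 * al = be.
  by rewrite sqr_sqrtr ?divr_ge0 ?(ltW al0) // divfK // lt0r_neq0.
have k0 : 0 <= kap by apply: sqrtr_ge0.
have kk0 : 0 <= kap ^+ 2 by apply: sqr_ge0.
have b0 : 0 < 1 + be by rewrite ltr_pwDl.
have a0 : 0 < 1 + al by rewrite addr_gt0.
have d0 : 0 < (1 + al) + kap ^+ 2 * (1 + al) ^+ 2.
  by rewrite ltr_pwDl // mulr_ge0 // sqr_ge0.
have d'0 : 0 < 1 + kap ^+ 2 / (1 + be).
  by rewrite ltr_pwDl // divr_ge0 // ltW.
rewrite /c /c' !scaled_square // in h1.
rewrite /realification /= /to_C2 h2 h3.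
set x := y 0 0 in h1 *; set t := y 0 1 in h1 *.
have bn : 1 + be != 0 by exact: lt0r_neq0.
pose z1 : C := (4 * ((1 + al) * x)) +i* (- (4 * t)).
have z1n : z1 != 0.
  apply: complex_neq0; apply/eqP => h0.
  have hx : (4 * ((1 + al) * x)) ^+ 2 = 0.
    by apply/eqP; move/eqP: h0; rewrite paddr_eq0 ?sqr_ge0 // => /andP[].
  have ht : (- (4 * t)) ^+ 2 = 0.
    by apply/eqP; move/eqP: h0; rewrite paddr_eq0 ?sqr_ge0 // => /andP[].
  move/eqP: hx; rewrite sqrf_eq0 !mulf_eq0 pnatr_eq0 /= (gt_eqF a0) /= => /eqP ex.
  move/eqP: ht; rewrite sqrf_eq0 oppr_eq0 mulf_eq0 pnatr_eq0 /= => /eqP et.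
  by move/eqP: h1; rewrite ex et expr0n !mulr0 addr0 eq_sym oner_eq0.
pose ik : C := 0 +i* kap.
have z2E : (4 * ((1 + be) * (kap / (1 + be) * t))) +i* (- (4 * (- (kap * (1 + al)) * x))) = ik * z1.
  apply: complexP; rewrite /=; last by ring.
  by field.
have ik2 : ik * ik * al%:C = - be%:C.
  by rewrite -hk; apply: complexP => /=; ring.
apply: (@ellipsoid_umbilical R eps A B al be _ _ _ _ z1 (ik * z1) (al%:C / z1) (- (ik * (al%:C / z1)))) => //.
- exact: ltW.
- rewrite -[RHS]h1; field; exact: bn.
- by rewrite mulrCA divff // mulr1.
- by rewrite (mul_div_field ik al%:C z1n) ik2 opprK.
- by rewrite mulrN; congr (- _); rewrite mulrCA mulrA.
Qed.

(** The quadratic form is be w^2, which is isotropic in the direction of z; this is the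
    complex tangent direction where z = 0. *)
Lemma ellipsoid_arc_axis (A B eps : R) : eps * A = 0 -> 0 < eps * B ->
  ellipse_arc 2 3 0 1 (Num.sqrt (1 + eps * B))^-1 (Num.sqrt 1)^-1 0 0
    `<=` realification (umbilical_points (ellipsoid A B eps)).
Proof.
move=> al0 be0 y [_ h1 h2 h3].
set be := eps * B in be0 h1 *.
have b0 : 0 < 1 + be by rewrite addr_gt0.
rewrite !scaled_square // mul1r in h1.
rewrite /realification /= /to_C2 h2 h3 !mul0r.
set x := y 0 2 in h1 *; set t := y 0 3 in h1 *.
pose z2 : C := (4 * ((1 + be) * x)) +i* (- (4 * t)).
have z2n : z2 != 0.
  apply: complex_neq0; apply/eqP => h0.
  have hx : (4 * ((1 + be) * x)) ^+ 2 = 0.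
    by apply/eqP; move/eqP: h0; rewrite paddr_eq0 ?sqr_ge0 // => /andP[].
  have ht : (- (4 * t)) ^+ 2 = 0.
    by apply/eqP; move/eqP: h0; rewrite paddr_eq0 ?sqr_ge0 // => /andP[].
  move/eqP: hx; rewrite sqrf_eq0 !mulf_eq0 pnatr_eq0 /= (gt_eqF b0) /= => /eqP ex.
  move/eqP: ht; rewrite sqrf_eq0 oppr_eq0 mulf_eq0 pnatr_eq0 /= => /eqP et.
  by move/eqP: h1; rewrite ex et expr0n mulr0 addr0 eq_sym oner_eq0.
apply: (@ellipsoid_umbilical R eps A B 0 be _ _ _ _ 0 z2 0 (be%:C / z2)) => //.
- by apply: complexP => /=; ring.
- exact: ltW.
- by rewrite -[RHS]h1; ring.
- by rewrite mulr0.
- by rewrite mulrCA divff // mulr1.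
- by rewrite mul0r mulr0 oppr0.
Qed.

End EllipsoidCurve.

Theorem theorem5p1 (R : realType) (A B : R)
    (hA : 0 <= A) (hB : 0 <= B) (hAB : ~ (A = 0 /\ B = 0)) :
  exists2 eps0 : R, 0 < eps0 &
    forall eps : R, 0 < eps -> eps < eps0 ->
      let U := realification (umbilical_points (ellipsoid A B eps)) in
      contains_points_of_dim_ge U 2 \/ contains_curve U.
Proof.
exists 1 => // eps eps0 _ U; right.
have [A0|A0] := eqVneq A 0.
  have B0 : 0 < eps * B.
    by rewrite mulr_gt0 // lt0r hB andbT; apply/eqP => B0; apply: hAB.
  have eA : eps * A = 0 by rewrite A0 mulr0.
  exists (ellipse_arc 2 3 0 1 (Num.sqrt (1 + eps * B))^-1 (Num.sqrt 1)^-1 0 0).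
    apply: ellipse_arc_curve => //; first by rewrite invr_gt0 sqrtr_gt0 addr_gt0.
  exact: ellipsoid_arc_axis.
have al0 : 0 < eps * A by rewrite mulr_gt0 // lt0r A0.
have be0 : 0 <= eps * B by rewrite mulr_ge0 // ltW.
exists (ellipse_arc 0 1 2 3
   (Num.sqrt ((1 + eps * A) + Num.sqrt (eps * B / (eps * A)) ^+ 2 * (1 + eps * A) ^+ 2))^-1
   (Num.sqrt (1 + Num.sqrt (eps * B / (eps * A)) ^+ 2 / (1 + eps * B)))^-1
   (Num.sqrt (eps * B / (eps * A)) / (1 + eps * B))
   (- (Num.sqrt (eps * B / (eps * A)) * (1 + eps * A)))); last exact: ellipsoid_arc_tilted.
apply: ellipse_arc_curve => //.
  rewrite invr_gt0 sqrtr_gt0 ltr_pwDl //; first by rewrite addr_gt0.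
  by rewrite mulr_ge0 ?sqr_ge0.
apply: lt0r_neq0; rewrite invr_gt0 sqrtr_gt0 ltr_pwDl // divr_ge0 ?sqr_ge0 //.
by rewrite addr_ge0.
Qed.
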